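(* Let $M$ be a real supermanifold and let $(\Omega^\bullet_M, d)$ be the de Rham complex of sheaves of differential forms on $M$. Then the cohomology sheaves of this complex are $$H^k_d(\Omega^\bullet_M)\cong \begin{cases}\mathbb{R}_M & k=0,\\ 0 & k>0,\end{cases}$$ where $\mathbb{R}_M$ is the sheaf of locally constant real-valued functions on $M$. In particular: (1) the de Rham complex is a right resolution $0\to \mathbb{R}_M\to\Omega^\bullet_M$ of the sheaf $\mathbb{R}_M$; (2) any closed form of positive degree on a real supermanifold is locally exact.
   Context: A real supermanifold $M$ of dimension $p|q$ is a locally ringed space $(|M|,\mathcal{O}_M)$ in $\mathbb{Z}_2$-graded supercommutative $\mathbb{R}$-algebras, locally isomorphic to $(U, C^\infty_U\otimes\bigwedge^\bullet(\mathbb{R}^q)^* )$ with $U\subset\mathbb{R}^p$ open. Local coordinates are $x_a=z_1,\dots,z_p|\theta_1,\dots,\theta_q$ ($z_i$ even, $\theta_\alpha$ odd), and $|\cdot|$ denotes $\mathbb{Z}_2$-parity. $\mathcal{T}_M$ is the tangent sheaf (superderivations of $\mathcal{O}_M$), $\Pi$ is the parity-reversing functor. The sheaf of 1-forms is $\Omega^1_M:=\mathcal{H}om_{\mathcal{O}_M}(\Pi\mathcal{T}_M,\mathcal{O}_M)$, locally free with generators $dx_a$ of parity $|dx_a|=|x_a|+1$ (so the $dz_i$ are odd and the $d\theta_\alpha$ are even). $\Omega^k_M:=S^k_{\mathcal{O}_M}\Omega^1_M$ ($k$-th supersymmetric power) is the sheaf of $k$-forms, $\Omega^\bullet_M=\bigoplus_{k\ge0}\Omega^k_M$,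 which is not bounded above if $q\geq 1$. The de Rham differential is $d(dx^I\otimes f)=\sum_a(-1)^{|x_a||dx^I|}dx_a\,dx^I\otimes\partial_{x_a}f$ for monomials $dx^I$ in the $dx_a$ and $f\in\mathcal{O}_M$; it is globally defined and $d^2=0$. *)

(* Defs.v *)
From HB Require Import structures.
From mathcomp Require Import all_boot all_order all_algebra perm.
From mathcomp Require Import all_classical all_reals all_analysis.

Set Implicit Arguments.
Unset Strict Implicit.
Unset Printing Implicit Defensive.

Import Order.TTheory GRing.Theory Num.Theory.
Import numFieldNormedType.Exports.
Local Open Scope classical_set_scope.
Local Open Scope ring_scope.

Record opens (X : topologicalType) :=
  Opens { oset :> set X; open_oset : open oset }.

Identity Coercion set_to_fun : set >-> Funclass.

Record presheaf (R : realType) (X : topologicalType) := Presheaf {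
  psec :> opens X -> lmodType R;
  res : forall U V : opens X, V `<=` U -> {linear psec U -> psec V};
  res_id : forall (U : opens X) (h : U `<=` U) (s : psec U), res h s = s;
  res_comp : forall (U V W : opens X) (hVU : V `<=` U) (hWV : W `<=` V)
    (hWU : W `<=` U) (s : psec U), res hWV (res hVU s) = res hWU s
}.

Arguments res {R X} F {U V} h : rename.

Definition covers (X : topologicalType) (I : Type) (V : I -> opens X)
  (U : opens X) : Prop := forall x, U x -> exists i, V i x.

Definition is_sheaf (R : realType) (X : topologicalType)
    (F : presheaf R X) : Prop :=
  (forall (U : opens X) (I : Type) (V : I -> opens X)
      (hV : forall i, V i `<=` U) (s t : F U),
    covers V U -> (forall i, res F (hV i) s = res F (hV i) t) -> s = t) /\
  (forall (U : opens X) (I : Type) (V : I -> opens X)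
      (hV : forall i, V i `<=` U) (s : forall i, F (V i)),
    covers V U ->
    (forall i j (W : opens X) (hi : W `<=` V i) (hj : W `<=` V j),
       res F hi (s i) = res F hj (s j)) ->
    exists t : F U, forall i, res F (hV i) t = s i).

Record psh_hom (R : realType) (X : topologicalType) (F G : presheaf R X) :=
  PshHom {
  phom :> forall U : opens X, {linear F U -> G U};
  phom_res : forall (U V : opens X) (h : V `<=` U) (s : F U),
    phom V (res F h s) = res G h (phom U s)
}.

Definition psh_iso (R : realType) (X : topologicalType)
    (F G : presheaf R X) : Prop :=
  exists (f : psh_hom F G) (g : psh_hom G F),
    (forall (U : opens X) (s : F U), g U (f U s) = s) /\
    (forall (U : opens X) (t : G U), f U (g U t) = t).

(* Exactness at [G] in the category of sheaves: the kernel of [g] is the image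
   sheaf of [f], whose sections are those that lift through [f] locally. *)
Definition exact_at (R : realType) (X : topologicalType)
    (F G H : presheaf R X) (f : psh_hom F G) (g : psh_hom G H) : Prop :=
  forall (U : opens X) (s : G U),
    g U s = 0 <->
    forall x, U x -> exists (V : opens X) (h : V `<=` U) (t : F V),
      V x /\ f V t = res G h s.

Definition points (X : topologicalType) (U : opens X) : Type := {x : X | U x}.

Definition points_incl (X : topologicalType) (U V : opens X) (h : V `<=` U)
  (x : points V) : points U := exist _ (sval x) (h _ (svalP x)).

Definition locally_constant (R : realType) (X : topologicalType)
    (U : opens X) (f : points U -> R) : Prop :=
  forall x : points U, exists V : opens X,
    V (sval x) /\ forall y : points U, V (sval y) -> f y = f x.

Section ConstantSheaf.
Variables (R : realType) (X : topologicalType).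

Definition locconst_pred (U : opens X) : {pred (points U -> R)} :=
  [pred f | `[< locally_constant f >]].
Arguments locconst_pred : clear implicits.

Lemma locconst_submod (U : opens X) : submod_closed (locconst_pred U).
Proof.
split=> [|a f g /asboolP hf /asboolP hg]; apply/asboolP.
  by move=> x; exists U; split=> //; exact: (svalP x).
move=> x; have [V [Vx hV]] := hf x; have [W [Wx hW]] := hg x.
exists (Opens (openI (open_oset V) (open_oset W))).
split=> [|y [Vy Wy]]; first by [].
have -> : forall z, (a *: f + g) z = a *: f z + g z by [].
by rewrite hV // hW.
Qed.

HB.instance Definition _ (U : opens X) :=
  GRing.isSubmodClosed.Build R (points U -> R) (locconst_pred U)
    (@locconst_submod U).

Definition locconst (U : opens X) : Type :=
  {f : points U -> R | f \in locconst_pred U}.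

HB.instance Definition _ (U : opens X) := SubType.on (locconst U).
HB.instance Definition _ (U : opens X) := [Choice of locconst U by <:].
HB.instance Definition _ (U : opens X) :=
  [SubChoice_isSubLmodule of locconst U by <:].

Lemma locconst_res_subproof (U V : opens X) (h : V `<=` U)
    (f : locconst U) :
  (fun y => val f (points_incl h y)) \in locconst_pred V.
Proof.
apply/asboolP => y.
have [W [Wy hW]] := asboolP _ (valP f) (points_incl h y).
by exists W; split=> // z Wz; exact: hW.
Qed.

Definition locconst_res (U V : opens X) (h : V `<=` U) (f : locconst U) :
  locconst V :=
  exist (fun g => g \in locconst_pred V) _ (locconst_res_subproof h f).

Lemma locconst_res_linear (U V : opens X) (h : V `<=` U) :
  linear (@locconst_res U V h).
Proof. by move=> a f g; apply: val_inj. Qed.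

HB.instance Definition _ (U V : opens X) (h : V `<=` U) :=
  GRing.isLinear.Build R (locconst U) (locconst V) *:%R
    (@locconst_res U V h) (@locconst_res_linear U V h).

Lemma points_incl_id (U : opens X) (h : U `<=` U) (x : points U) :
  points_incl h x = x.
Proof. by case: x => x Ux; congr exist; exact: Prop_irrelevance. Qed.

Lemma locconst_res_id (U : opens X) (h : U `<=` U) (f : locconst U) :
  locconst_res h f = f.
Proof.
by apply: val_inj; apply/funext => y /=; rewrite points_incl_id.
Qed.

Lemma locconst_res_comp (U V W : opens X) (hVU : V `<=` U) (hWV : W `<=` V)
    (hWU : W `<=` U) (f : locconst U) :
  locconst_res hWV (locconst_res hVU f) = locconst_res hWU f.
Proof.
apply: val_inj; apply/funext => y /=; congr (val f _).
by congr exist; exact: Prop_irrelevance.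
Qed.

Definition locconst_psh : presheaf R X :=
  @Presheaf R X (fun U => locconst U)
    (fun U V h => @locconst_res U V h)
    locconst_res_id locconst_res_comp.

Lemma locconst_cst_subproof (U : opens X) (a : R) :
  (fun _ => a) \in locconst_pred U.
Proof.
by apply/asboolP => x; exists U; split=> //; exact: (svalP x).
Qed.

Definition locconst_cst (U : opens X) (a : R) : locconst_psh U :=
  exist (fun g => g \in locconst_pred U) _ (locconst_cst_subproof U a).

Definition zero_psh : presheaf R X :=
  @Presheaf R X (fun=> 'rV[R]_0) (fun _ _ _ => idfun)
    (fun _ _ _ => erefl) (fun _ _ _ _ _ _ _ => erefl).

End ConstantSheaf.

(* The grading is given by the two projections [hpart false] (even) and
   [hpart true] (odd). *)
Record superpsh (R : realType) (X : topologicalType) := SuperPsh {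
  spsh :> presheaf R X;
  hpart : bool -> forall U : opens X, {linear spsh U -> spsh U};
  hpart_hpart : forall (b c : bool) (U : opens X) (s : spsh U),
    hpart b U (hpart c U s) = if b == c then hpart c U s else 0;
  hpart_sum : forall (U : opens X) (s : spsh U),
    hpart false U s + hpart true U s = s;
  hpart_res : forall (b : bool) (U V : opens X) (h : V `<=` U) (s : spsh U),
    hpart b V (res spsh h s) = res spsh h (hpart b U s)
}.

Arguments hpart {R X} F b {U} : rename.

Definition homog (R : realType) (X : topologicalType) (F : superpsh R X)
  (b : bool) (U : opens X) (s : F U) : Prop := hpart F b s = s.

Definition ksign (R : realType) (b : bool) : R := (-1) ^+ b.

(* A sheaf of supercommutative real superalgebras on a topological space. No
   separation or countability axiom is imposed on the space. *)
Record superspace (R : realType) := Superspace {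
  scarrier :> topologicalType;
  sO : superpsh R scarrier;
  sO_sheaf : is_sheaf sO;
  sone : forall U : opens scarrier, sO U;
  smul : forall U : opens scarrier, sO U -> sO U -> sO U;
  smul_linl : forall (U : opens scarrier) (g : sO U),
    linear (fun f : sO U => smul f g);
  smul_linr : forall (U : opens scarrier) (f : sO U), linear (smul f);
  smulA : forall (U : opens scarrier) (f g k : sO U),
    smul f (smul g k) = smul (smul f g) k;
  smul1l : forall (U : opens scarrier) (f : sO U), smul (sone U) f = f;
  smul1r : forall (U : opens scarrier) (f : sO U), smul f (sone U) = f;
  sone_even : forall U : opens scarrier, homog false (sone U);
  smul_homog : forall (U : opens scarrier) (b c : bool) (f g : sO U),
    homog b f -> homog c g -> homog (b (+) c) (smul f g);
  smulC : forall (U : opens scarrier) (b c : bool) (f g : sO U),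
    homog b f -> homog c g -> smul f g = ksign R (b && c) *: smul g f;
  sone_res : forall (U V : opens scarrier) (h : V `<=` U),
    res sO h (sone U) = sone V;
  smul_res : forall (U V : opens scarrier) (h : V `<=` U) (f g : sO U),
    res sO h (smul f g) = smul (res sO h f) (res sO h g)
}.

Arguments sO {R} M : rename.
Arguments sone {R M} U : rename.
Arguments smul {R M U} : rename.

(* The germ of [f] at [x] is a unit of the stalk. *)
Definition unit_at (R : realType) (M : superspace R) (x : M) (U : opens M)
    (f : sO M U) : Prop :=
  exists (V : opens M) (h : V `<=` U), V x /\ exists g : sO M V,
    smul (res (sO M) h f) g = sone V /\ smul g (res (sO M) h f) = sone V.

(* Every stalk is a local ring: [0] is not a unit, and if a sum is a unit then
   so is one of its terms. *)
Definition locally_ringed (R : realType) (M : superspace R) : Prop :=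
  forall (x : M) (U : opens M), U x ->
    ~ unit_at x (0 : sO M U) /\
    forall f g : sO M U, unit_at x (f + g) -> unit_at x f \/ unit_at x g.

(* Presheaves of left supermodules; since [sO M] is supercommutative the right
   action is [ract] below. *)
Record smodule (R : realType) (M : superspace R) := SModule {
  smod :> superpsh R M;
  sact : forall U : opens M, sO M U -> smod U -> smod U;
  sact_linl : forall (U : opens M) (s : smod U),
    linear (fun f : sO M U => sact f s);
  sact_linr : forall (U : opens M) (f : sO M U), linear (@sact U f);
  sactA : forall (U : opens M) (f g : sO M U) (s : smod U),
    sact f (sact g s) = sact (smul f g) s;
  sact1 : forall (U : opens M) (s : smod U), sact (sone U) s = s;
  sact_homog : forall (U : opens M) (b c : bool) (f : sO M U) (s : smod U),
    homog b f -> homog c s -> homog (b (+) c) (sact f s);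
  sact_res : forall (U V : opens M) (h : V `<=` U) (f : sO M U) (s : smod U),
    res smod h (sact f s) = sact (res (sO M) h f) (res smod h s)
}.

Arguments sact {R M E U} : rename.

(* [s f = (-1)^(|f||s|) f s]. *)
Definition ract (R : realType) (M : superspace R) (E : smodule M)
    (U : opens M) (s : E U) (f : sO M U) : E U :=
  \sum_(b : bool) \sum_(c : bool)
    ksign R (b && c) *: sact (hpart (sO M) b f) (hpart E c s).

Record smod_hom (R : realType) (M : superspace R) (E F : smodule M) :=
  SModHom {
  smhom :> psh_hom E F;
  smhom_even : forall (b : bool) (U : opens M) (s : E U),
    smhom U (hpart E b s) = hpart F b (smhom U s);
  smhom_act : forall (U : opens M) (f : sO M U) (s : E U),
    smhom U (sact f s) = sact f (smhom U s)
}.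

Section ModuleLemmas.
Variables (R : realType) (M : superspace R) (E : smodule M).

Lemma homog_hpart (F : superpsh R M) (b : bool) (U : opens M) (s : F U) :
  homog b (hpart F b s).
Proof. by rewrite /homog hpart_hpart eqxx. Qed.

Lemma homog_neq (F : superpsh R M) (b c : bool) (U : opens M) (s : F U) :
  homog c s -> hpart F b s = if b == c then s else 0.
Proof. by move=> hs; rewrite -{1}hs hpart_hpart hs. Qed.

Lemma sactDl (U : opens M) (f g : sO M U) (s : E U) :
  sact (f + g) s = sact f s + sact g s.
Proof. by have := sact_linl s 1 f g; rewrite !scale1r. Qed.

Lemma sactDr (U : opens M) (f : sO M U) (s t : E U) :
  sact f (s + t) = sact f s + sact f t.
Proof. by have := @sact_linr _ _ E U f 1 s t; rewrite !scale1r. Qed.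

Lemma sact0l (U : opens M) (s : E U) : sact (0 : sO M U) s = 0.
Proof. by apply: (addrI (sact 0 s)); rewrite -sactDl !addr0. Qed.

Lemma sact0r (U : opens M) (f : sO M U) : sact f (0 : E U) = 0.
Proof. by apply: (addrI (sact f 0)); rewrite -sactDr !addr0. Qed.

Lemma sactZl (U : opens M) (a : R) (f : sO M U) (s : E U) :
  sact (a *: f) s = a *: sact f s.
Proof. by have := sact_linl s a f 0; rewrite addr0 sact0l addr0. Qed.

Lemma sactZr (U : opens M) (a : R) (f : sO M U) (s : E U) :
  sact f (a *: s) = a *: sact f s.
Proof. by have := @sact_linr _ _ E U f a s 0; rewrite !addr0 sact0r addr0. Qed.

Lemma hpart_sact (b : bool) (U : opens M) (f : sO M U) (s : E U) :
  hpart E b (sact f s) =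
  sact (hpart (sO M) false f) (hpart E b s) +
  sact (hpart (sO M) true f) (hpart E (~~ b) s).
Proof.
have hh c d := sact_homog (homog_hpart c f) (homog_hpart d s).
rewrite -{1}(hpart_sum f) -{1}(hpart_sum s) sactDl !sactDr !linearD /=.
rewrite !(homog_neq _ (hh _ _)).
by case: b; rewrite /= ?add0r ?addr0 // addrC.
Qed.

End ModuleLemmas.

Definition self_smodule (R : realType) (M : superspace R) : smodule M :=
  @SModule R M (sO M) (fun U => @smul R M U)
    (@smul_linl R M) (@smul_linr R M) (@smulA R M) (@smul1l R M)
    (@smul_homog R M) (@smul_res R M).

Lemma smulDl (R : realType) (M : superspace R) (U : opens M)
    (f g k : sO M U) :
  smul (f + g) k = smul f k + smul g k.
Proof. exact: (@sactDl _ _ (self_smodule M)). Qed.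

Lemma smulDr (R : realType) (M : superspace R) (U : opens M)
    (f g k : sO M U) :
  smul f (g + k) = smul f g + smul f k.
Proof. exact: (@sactDr _ _ (self_smodule M)). Qed.

Section Parity.
Variables (R : realType) (M : superspace R) (E : smodule M).

Lemma Pi_hpart_hpart (b c : bool) (U : opens M) (s : E U) :
  hpart E (~~ b) (hpart E (~~ c) s) =
  if b == c then hpart E (~~ c) s else 0.
Proof. by rewrite hpart_hpart; case: b c => [] []. Qed.

Lemma Pi_hpart_sum (U : opens M) (s : E U) :
  hpart E (~~ false) s + hpart E (~~ true) s = s.
Proof. by rewrite addrC hpart_sum. Qed.

Definition Pi_superpsh : superpsh R M :=
  @SuperPsh R M E (fun b U => @hpart R M E (~~ b) U)
    Pi_hpart_hpart Pi_hpart_sum (fun b => @hpart_res R M E (~~ b)).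

(* The section [pi s] of the parity-shifted module is represented by [s];
   [f (pi s) = (-1)^|f| pi (f s)]. *)
Definition Pi_act (U : opens M) (f : sO M U) (s : Pi_superpsh U) :
    Pi_superpsh U :=
  sact (hpart (sO M) false f) (s : E U) - sact (hpart (sO M) true f) (s : E U).

Lemma Pi_act_homogE (U : opens M) (b : bool) (f : sO M U) (s : Pi_superpsh U) :
  homog b f -> Pi_act f s = ksign R b *: sact f (s : E U).
Proof.
move=> hf; rewrite /Pi_act !(homog_neq _ hf) /ksign.
by case: b hf => _ /=; rewrite sact0l ?subr0 ?sub0r ?expr1 ?scaleN1r ?scale1r.
Qed.

Lemma Pi_act_linl (U : opens M) (s : Pi_superpsh U) :
  linear (fun f : sO M U => Pi_act f s).
Proof.
by move=> a f g; rewrite /Pi_act !linearP /= !sact_linl scalerBr opprD addrACA.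
Qed.

Lemma Pi_act_linr (U : opens M) (f : sO M U) : linear (@Pi_act U f).
Proof.
by move=> a s t; rewrite /Pi_act /= !sact_linr scalerBr opprD addrACA.
Qed.

Lemma Pi_actDl (U : opens M) (f g : sO M U) (s : Pi_superpsh U) :
  Pi_act (f + g) s = Pi_act f s + Pi_act g s.
Proof. by have := Pi_act_linl s 1 f g; rewrite !scale1r. Qed.

Lemma Pi_actA (U : opens M) (f g : sO M U) (s : Pi_superpsh U) :
  Pi_act f (Pi_act g s) = Pi_act (smul f g) s.
Proof.
have key b c : Pi_act (hpart _ b f) (Pi_act (hpart _ c g) s) =
    Pi_act (smul (hpart _ b f) (hpart _ c g)) s.
  have hf := homog_hpart b f; have hg := homog_hpart c g.
  rewrite (Pi_act_homogE _ hf) (Pi_act_homogE _ hg).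
  rewrite (Pi_act_homogE _ (smul_homog hf hg)).
  by rewrite sactZr sactA scalerA /ksign -signr_addb.
rewrite -(hpart_sum f) -(hpart_sum g) !Pi_actDl.
have D (k : sO M U) (u v : Pi_superpsh U) :
    Pi_act k (u + v) = Pi_act k u + Pi_act k v.
  by have := @Pi_act_linr U k 1 u v; rewrite !scale1r.
by rewrite !(D _ (Pi_act _ _) (Pi_act _ _)) !key smulDl !smulDr !Pi_actDl.
Qed.

Lemma Pi_act1 (U : opens M) (s : Pi_superpsh U) : Pi_act (sone U) s = s.
Proof.
by rewrite (Pi_act_homogE _ (sone_even U)) /ksign expr0 scale1r sact1.
Qed.

Lemma Pi_act_homog (U : opens M) (b c : bool) (f : sO M U)
    (s : Pi_superpsh U) :
  homog b f -> homog c s -> homog (b (+) c) (Pi_act f s).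
Proof.
move=> hf hs; rewrite (Pi_act_homogE _ hf) /homog linearZ /=; congr (_ *: _).
have := sact_homog hf (hs : @homog R M E (~~ c) U s).
by rewrite /homog addbN.
Qed.

Lemma Pi_act_res (U V : opens M) (h : V `<=` U) (f : sO M U)
    (s : Pi_superpsh U) :
  res Pi_superpsh h (Pi_act f s) =
  Pi_act (res (sO M) h f) (res Pi_superpsh h s).
Proof. by rewrite /Pi_act !hpart_res -!sact_res linearB. Qed.

Definition Pi : smodule M :=
  @SModule R M Pi_superpsh Pi_act Pi_act_linl Pi_act_linr Pi_actA Pi_act1
    Pi_act_homog Pi_act_res.

End Parity.

(* A section over [U] of a sheaf of operators [E -> F] is a family of maps
   [E V -> F V], for [V] open in [U], compatible with restriction. *)

Section OperatorFamilies.
Variables (R : realType) (M : superspace R) (E F : superpsh R M).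

Definition opfamily (U : opens M) : Type :=
  forall V : opens M, V `<=` U -> E V -> F V.

Variable U : opens M.

HB.instance Definition _ := gen_eqMixin (opfamily U).
HB.instance Definition _ := gen_choiceMixin (opfamily U).

Let add (A B : opfamily U) : opfamily U := fun V h s => A V h s + B V h s.
Let opp (A : opfamily U) : opfamily U := fun V h s => - A V h s.
Let zero : opfamily U := fun V h s => 0.
Let scale (a : R) (A : opfamily U) : opfamily U := fun V h s => a *: A V h s.

Lemma opfamilyP (A B : opfamily U) : (forall V h s, A V h s = B V h s) -> A = B.
Proof. by move=> AB; do 3!apply: functional_extensionality_dep => ?. Qed.

Let addA : associative add.
Proof. by move=> A B C; apply: opfamilyP => V h s; exact: addrA. Qed.
Let addC : commutative add.
Proof. by move=> A B; apply: opfamilyP => V h s; exact: addrC. Qed.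
Let add0 : left_id zero add.
Proof. by move=> A; apply: opfamilyP => V h s; exact: add0r. Qed.
Let addN : left_inverse zero opp add.
Proof. by move=> A; apply: opfamilyP => V h s; exact: addNr. Qed.

HB.instance Definition _ :=
  GRing.isZmodule.Build (opfamily U) addA addC add0 addN.

Let scaleA (a b : R) (A : opfamily U) : scale a (scale b A) = scale (a * b) A.
Proof. by apply: opfamilyP => V h s; exact: scalerA. Qed.
Let scale1 : left_id 1 scale.
Proof. by move=> A; apply: opfamilyP => V h s; exact: scale1r. Qed.
Let scaleDr : right_distributive scale +%R.
Proof. by move=> a A B; apply: opfamilyP => V h s; exact: scalerDr. Qed.
Let scaleDl (A : opfamily U) : {morph scale^~ A : a b / a + b}.
Proof. by move=> a b; apply: opfamilyP => V h s; exact: scalerDl. Qed.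

HB.instance Definition _ :=
  GRing.Zmodule_isLmodule.Build R (opfamily U) scaleA scale1 scaleDr scaleDl.

Definition natural_family (A : opfamily U) : Prop :=
  (forall V h, linear (A V h)) /\
  (forall (V W : opens M) hV hW (hWV : W `<=` V) (s : E V),
     A W hW (res E hWV s) = res F hWV (A V hV s)).

(* The homogeneous component of parity [b] of a linear operator. *)
Definition oppart (V : opens M) (b : bool) (A : E V -> F V) : E V -> F V :=
  fun s =>
  hpart F b (A (hpart E false s)) + hpart F (~~ b) (A (hpart E true s)).

End OperatorFamilies.

(* The presheaf of those operators whose homogeneous components satisfy a given
   O-linear condition [P]. *)
Section OperatorModule.
Variables (R : realType) (M : superspace R) (E : superpsh R M) (F : smodule M).
Variable P : forall V : opens M, bool -> (E V -> F V) -> Prop.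
Hypothesis P_lin : forall V b (a : R) (A B : E V -> F V),
  P b A -> P b B -> P b (fun s => a *: A s + B s).
Hypothesis P_zero : forall V b, @P V b (fun=> 0).
Hypothesis P_act : forall V b c (f : sO M V) (A : E V -> F V),
  homog c f -> P b A -> P (c (+) b) (fun s => sact f (A s)).

Definition is_operator (U : opens M) (A : opfamily E F U) : Prop :=
  natural_family A /\ forall V h b, P b (oppart b (A V h)).

Definition operator_pred (U : opens M) : {pred (opfamily E F U)} :=
  [pred A | `[< is_operator A >]].
Arguments operator_pred : clear implicits.

Lemma operator_submod (U : opens M) : submod_closed (operator_pred U).
Proof.
split=> [|a A B /asboolP [[lA nA] pA] /asboolP [[lB nB] pB]]; apply/asboolP.
  split; [split|].
  - by move=> V h a s t; rewrite scaler0 addr0.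
  - by move=> V W hV hW hWV s; rewrite linear0.
  - move=> V h b; have -> : oppart b ((0 : opfamily E F U) V h) = fun=> 0.
      by apply/funext => s; rewrite /oppart !linear0 addr0.
    exact: P_zero.
have E1 V h s : (a *: A + B) V h s = a *: A V h s + B V h s by [].
split; [split|].
- move=> V h b s t; rewrite !E1 lA lB !scalerDr !scalerA [a * b]mulrC.
  by rewrite -!addrA; congr (_ + _); rewrite addrCA.
- by move=> V W hV hW hWV s; rewrite !E1 (nA V W hV) (nB V W hV) linearP.
- move=> V h b; have -> : oppart b ((a *: A + B) V h) =
      (fun s => a *: oppart b (A V h) s + oppart b (B V h) s).
    by apply/funext => s; rewrite /oppart !E1 !linearP /= scalerDr addrACA.
  exact: P_lin.
Qed.

HB.instance Definition _ (U : opens M) :=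
  GRing.isSubmodClosed.Build R (opfamily E F U) (operator_pred U)
    (@operator_submod U).

Definition operator (U : opens M) : Type :=
  {A : opfamily E F U | A \in operator_pred U}.

HB.instance Definition _ (U : opens M) := SubType.on (operator U).
HB.instance Definition _ (U : opens M) := [Choice of operator U by <:].
HB.instance Definition _ (U : opens M) :=
  [SubChoice_isSubLmodule of operator U by <:].

Definition mk_operator (U : opens M) (A : opfamily E F U) (hA : is_operator A) :
  operator U := exist (fun A => A \in operator_pred U) A (asboolT hA).

Lemma operatorP (U : opens M) (A : operator U) : is_operator (val A).
Proof. exact: asboolP (valP A). Qed.

Lemma operator_eq (U : opens M) (A B : operator U) :
  (forall V h s, val A V h s = val B V h s) -> A = B.
Proof. by move=> AB; apply: val_inj; exact: opfamilyP. Qed.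

Lemma operator_lin (U V : opens M) h (A : operator U) :
  linear (val A V h).
Proof. by case: (operatorP A) => [[]]. Qed.

Lemma operatorD (U V : opens M) h (A : operator U) s t :
  val A V h (s + t) = val A V h s + val A V h t.
Proof. by have := operator_lin h A 1 s t; rewrite !scale1r. Qed.

Lemma operator0 (U V : opens M) h (A : operator U) : val A V h 0 = 0.
Proof. by apply: (addrI (val A V h 0)); rewrite -operatorD !addr0. Qed.

Lemma operator_res_subproof (U U' : opens M) (h : U' `<=` U)
    (A : operator U) :
  is_operator (fun V (hV : V `<=` U') => val A V (subset_trans hV h)).
Proof.
case: (operatorP A) => [[lA nA] pA]; split; first split.
- by move=> V hV; exact: lA.
- by move=> V W hV hW hWV s; exact: nA.
- by move=> V hV b; exact: pA.
Qed.

Definition operator_res (U U' : opens M) (h : U' `<=` U) (A : operator U) :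
  operator U' := mk_operator (operator_res_subproof h A).

Lemma operator_res_linear (U U' : opens M) (h : U' `<=` U) :
  linear (@operator_res U U' h).
Proof. by move=> a A B; apply: operator_eq. Qed.

HB.instance Definition _ (U U' : opens M) (h : U' `<=` U) :=
  GRing.isLinear.Build R (operator U) (operator U') *:%R
    (@operator_res U U' h) (@operator_res_linear U U' h).

Lemma operator_res_id (U : opens M) (h : U `<=` U) (A : operator U) :
  operator_res h A = A.
Proof.
apply: operator_eq => V hV s /=; congr (val A _ _ _).
exact: Prop_irrelevance.
Qed.

Lemma operator_res_comp (U V W : opens M) (hVU : V `<=` U) (hWV : W `<=` V)
    (hWU : W `<=` U) (A : operator U) :
  operator_res hWV (operator_res hVU A) = operator_res hWU A.
Proof.
apply: operator_eq => Z hZ s /=; congr (val A _ _ _).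
exact: Prop_irrelevance.
Qed.

Definition operator_psh : presheaf R M :=
  @Presheaf R M (fun U => operator U)
    (fun U V h => @operator_res U V h)
    operator_res_id operator_res_comp.

Lemma oppart_oppart (V : opens M) (b c : bool) (A : E V -> F V) :
  A 0 = 0 ->
  oppart b (oppart c A) = if b == c then oppart c A else (fun=> 0).
Proof.
move=> A0; apply/funext => s; rewrite /oppart !hpart_hpart /= !A0.
rewrite !linear0 ?addr0 ?add0r !hpart_hpart.
by case: b c => [] [] //=; rewrite addr0.
Qed.

Lemma operator_part_subproof (b : bool) (U : opens M) (A : operator U) :
  is_operator (fun V (hV : V `<=` U) => oppart b (val A V hV)).
Proof.
case: (operatorP A) => [[lA nA] pA]; split; first split.
- move=> V hV a s t; rewrite /oppart !linearP /= !lA !linearP /=.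
  by rewrite scalerDr addrACA.
- move=> V W hV hW hWV s; rewrite /oppart !hpart_res !(nA V W hV).
  by rewrite !hpart_res linearD.
- move=> V hV c; rewrite oppart_oppart ?operator0 //.
  by case: eqP => [->|_]; [exact: pA|exact: P_zero].
Qed.

Definition operator_part (b : bool) (U : opens M) (A : operator U) :
  operator U := mk_operator (operator_part_subproof b A).

Lemma operator_part_linear (b : bool) (U : opens M) :
  linear (@operator_part b U).
Proof.
move=> a A B; apply: operator_eq => V h s /=.
by rewrite /oppart /= !linearP /= scalerDr addrACA.
Qed.

HB.instance Definition _ (b : bool) (U : opens M) :=
  GRing.isLinear.Build R (operator U) (operator U) *:%R
    (@operator_part b U) (@operator_part_linear b U).

Lemma operator_part_part (b c : bool) (U : opens M) (A : operator U) :
  operator_part b (operator_part c A) =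
  if b == c then operator_part c A else 0.
Proof.
apply: operator_eq => V h s /=; rewrite oppart_oppart ?operator0 //.
by case: eqP.
Qed.

Lemma operator_part_sum (U : opens M) (A : operator U) :
  operator_part false A + operator_part true A = A.
Proof.
apply: operator_eq => V h s /=; rewrite -[in RHS](hpart_sum s) operatorD.
rewrite -[in RHS](hpart_sum (val A V h (hpart E false s))).
rewrite -[in RHS](hpart_sum (val A V h (hpart E true s))).
rewrite -[LHS]/(oppart false (val A V h) s + oppart true (val A V h) s).
by rewrite /oppart /= addrACA; congr (_ + _); rewrite addrC.
Qed.

Lemma operator_part_res (b : bool) (U V : opens M) (h : V `<=` U)
    (A : operator U) :
  operator_part b (operator_res h A) = operator_res h (operator_part b A).
Proof. by apply: operator_eq. Qed.

Definition operator_superpsh : superpsh R M :=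
  @SuperPsh R M operator_psh (fun b U => @operator_part b U)
    operator_part_part operator_part_sum operator_part_res.

Lemma operator_act_subproof (U : opens M) (f : sO M U) (A : operator U) :
  is_operator (fun V (hV : V `<=` U) s =>
    sact (res (sO M) hV f) (val A V hV s)).
Proof.
case: (operatorP A) => [[lA nA] pA]; split; first split.
- by move=> V hV a s t; rewrite lA sact_linr.
- move=> V W hV hW hWV s.
  by rewrite (nA V W hV) -(res_comp hV hWV hW) sact_res.
- move=> V hV b; set g := res _ _ _.
  have -> : oppart b (fun s => sact g (val A V hV s)) = (fun s =>
      1 *: sact (hpart (sO M) false g) (oppart b (val A V hV) s) +
      sact (hpart (sO M) true g) (oppart (~~ b) (val A V hV) s)).
    apply/funext => s; rewrite /oppart scale1r !hpart_sact !sactDr negbK.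
    by rewrite addrACA; congr (_ + _); rewrite addrC.
  apply: P_lin.
    exact: (P_act (homog_hpart false g) (pA V hV b)).
  have := P_act (homog_hpart true g) (pA V hV (~~ b)).
  by rewrite addTb negbK.
Qed.

Definition operator_act (U : opens M) (f : sO M U)
  (A : operator_superpsh U) : operator_superpsh U :=
  mk_operator (operator_act_subproof f A).

Lemma operator_act_linl (U : opens M) (A : operator_superpsh U) :
  linear (fun f : sO M U => operator_act f A).
Proof.
by move=> a f g; apply: operator_eq => V h s /=; rewrite linearP sact_linl.
Qed.

Lemma operator_act_linr (U : opens M) (f : sO M U) :
  linear (@operator_act U f).
Proof.
move=> a A B; apply: operator_eq => V h s /=.
exact: (@sact_linr _ _ F V).
Qed.

Lemma operator_actA (U : opens M) (f g : sO M U) (A : operator_superpsh U) :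
  operator_act f (operator_act g A) = operator_act (smul f g) A.
Proof. by apply: operator_eq => V h s /=; rewrite sactA smul_res. Qed.

Lemma operator_act1 (U : opens M) (A : operator_superpsh U) :
  operator_act (sone U) A = A.
Proof. by apply: operator_eq => V h s /=; rewrite sone_res sact1. Qed.

Lemma operator_act_homog (U : opens M) (b c : bool) (f : sO M U)
    (A : operator_superpsh U) :
  homog b f -> homog c A -> homog (b (+) c) (operator_act f A).
Proof.
move=> hf hA; apply: operator_eq => V h s /=.
have {}hf : homog b (res (sO M) h f) by rewrite /homog hpart_res hf.
rewrite -[in RHS]hA /= /oppart sactDr !hpart_sact !(homog_neq _ hf).
by case: b hf => hf /=; rewrite !sact0l ?addr0 ?add0r ?addTb ?addFb ?negbK.
Qed.

Lemma operator_act_res (U V : opens M) (h : V `<=` U) (f : sO M U)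
    (A : operator_superpsh U) :
  res operator_superpsh h (operator_act f A) =
  operator_act (res (sO M) h f) (res operator_superpsh h A).
Proof.
by apply: operator_eq => W hW s /=; rewrite (res_comp h hW (subset_trans hW h)).
Qed.

Definition operator_smodule : smodule M :=
  @SModule R M operator_superpsh operator_act operator_act_linl
    operator_act_linr operator_actA operator_act1 operator_act_homog
    operator_act_res.

End OperatorModule.

(* Leibniz rule for an operator of parity [b]. *)
Definition leibniz (R : realType) (M : superspace R) (V : opens M) (b : bool)
    (A : sO M V -> sO M V) : Prop :=
  forall (c : bool) (f g : sO M V), homog c f ->
    A (smul f g) = smul (A f) g + ksign R (b && c) *: smul f (A g).

(* O-linearity of an operator of parity [b]. *)
Definition superlinear (R : realType) (M : superspace R) (E F : smodule M)
    (V : opens M) (b : bool) (A : E V -> F V) : Prop :=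
  forall (c : bool) (f : sO M V) (s : E V), homog c f ->
    A (sact f s) = ksign R (b && c) *: sact f (A s).

Section TangentHom.
Variables (R : realType) (M : superspace R).

Lemma smulZl (V : opens M) a (f g : sO M V) : smul (a *: f) g = a *: smul f g.
Proof. exact: (@sactZl _ _ (self_smodule M)). Qed.

Lemma smulZr (V : opens M) a (f g : sO M V) : smul f (a *: g) = a *: smul f g.
Proof. exact: (@sactZr _ _ (self_smodule M)). Qed.

Lemma smul0l (V : opens M) (g : sO M V) : smul 0 g = 0.
Proof. exact: (@sact0l _ _ (self_smodule M)). Qed.

Lemma smul0r (V : opens M) (g : sO M V) : smul g 0 = 0.
Proof. exact: (@sact0r _ _ (self_smodule M)). Qed.

Lemma ksignM (b c : bool) : ksign R b * ksign R c = ksign R (b (+) c).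
Proof. by rewrite /ksign signr_addb. Qed.

Lemma leibniz_lin (V : opens M) b (a : R) (A B : sO M V -> sO M V) :
  leibniz b A -> leibniz b B -> leibniz b (fun s => a *: A s + B s).
Proof.
move=> hA hB c f g hf; rewrite (hA c) // (hB c) // smulDl smulDr smulZl smulZr.
by rewrite !scalerDr !scalerA addrACA [a * _]mulrC.
Qed.

Lemma leibniz_zero (V : opens M) b :
  @leibniz R M V b (fun=> 0).
Proof. by move=> c f g _; rewrite smul0l smul0r scaler0 addr0. Qed.

Lemma leibniz_act (V : opens M) b c (f : sO M V) (A : sO M V -> sO M V) :
  homog c f -> leibniz b A -> leibniz (c (+) b) (fun s => smul f (A s)).
Proof.
move=> hf hA d g k hg; rewrite (hA d) // smulDr smulZr !smulA.
by rewrite (smulC hf hg) smulZl scalerA ksignM -andb_addl addbC.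
Qed.

Definition tangent : smodule M :=
  @operator_smodule R M (sO M) (self_smodule M) (@leibniz R M)
    leibniz_lin leibniz_zero leibniz_act.

Variables E F : smodule M.

Lemma superlinear_lin (V : opens M) b (a : R) (A B : E V -> F V) :
  superlinear b A -> superlinear b B ->
  superlinear b (fun s => a *: A s + B s).
Proof.
move=> hA hB c f s hf; rewrite (hA c) // (hB c) // sactDr sactZr.
by rewrite scalerDr !scalerA [a * _]mulrC.
Qed.

Lemma superlinear_zero (V : opens M) b :
  @superlinear R M E F V b (fun=> 0).
Proof. by move=> c f s _; rewrite sact0r scaler0. Qed.

Lemma superlinear_act (V : opens M) b c (f : sO M V) (A : E V -> F V) :
  homog c f -> superlinear b A ->
  superlinear (c (+) b) (fun s => sact f (A s)).
Proof.
move=> hf hA d g s hg; rewrite (hA d) // sactZr !sactA.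
by rewrite (smulC hf hg) sactZl scalerA ksignM -andb_addl addbC.
Qed.

Definition Hom : smodule M :=
  @operator_smodule R M E F (@superlinear R M E F)
    superlinear_lin superlinear_zero superlinear_act.

End TangentHom.

Definition Omega1 (R : realType) (M : superspace R) : smodule M :=
  Hom (Pi (tangent M)) (self_smodule M).

Definition apply_field (R : realType) (M : superspace R) (U : opens M)
    (X : tangent M U) (f : sO M U) : sO M U := val X U (@subset_refl _ U) f.

Definition pairing (R : realType) (M : superspace R) (U : opens M)
    (w : Omega1 M U) (X : Pi (tangent M) U) : sO M U :=
  val w U (@subset_refl _ U) X.

Record supersym_map (R : realType) (M : superspace R) (E : smodule M)
    (k : nat) (G : smodule M) := SupersymMap {
  ssmap :> forall U : opens M, ('I_k -> E U) -> G U;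
  ssmap_res : forall (U V : opens M) (h : V `<=` U) (e : 'I_k -> E U),
    res G h (ssmap e) = ssmap (fun j => res E h (e j));
  ssmap_linear : forall (U : opens M) (e : 'I_k -> E U) (i : 'I_k),
    linear (fun s : E U => ssmap [eta e with i |-> s]);
  ssmap_homog : forall (U : opens M) (e : 'I_k -> E U) (b : 'I_k -> bool),
    (forall j, homog (b j) (e j)) ->
    homog (\big[addb/false]_j b j) (ssmap e);
  ssmap_act : forall (U : opens M) (e : 'I_k -> E U) (b : 'I_k -> bool)
      (i : 'I_k) (c : bool) (f : sO M U),
    (forall j, homog (b j) (e j)) -> homog c f ->
    ssmap [eta e with i |-> sact f (e i)] =
    ksign R (c && \big[addb/false]_(j < k | (j < i)%N) b j)
      *: sact f (ssmap e);
  ssmap_sym : forall (U : opens M) (e : 'I_k -> E U) (b : 'I_k -> bool)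
      (i j : 'I_k),
    (forall l, homog (b l) (e l)) -> j = i.+1 :> nat ->
    ssmap (e \o tperm i j) = ksign R (b i && b j) *: ssmap e
}.

Arguments ssmap {R M E k G} s {U} e.

(* The sheaf [S], with the product [m], is the [k]-th supersymmetric power of
   [E] in the category of sheaves of O-supermodules. *)
Definition is_sym_power (R : realType) (M : superspace R) (E : smodule M)
    (k : nat) (S : smodule M) (m : supersym_map E k S) : Prop :=
  is_sheaf S /\
  forall (G : smodule M), is_sheaf G -> forall mu : supersym_map E k G,
    (exists h : smod_hom S G,
       forall (U : opens M) (e : 'I_k -> E U), h U (m U e) = mu U e) /\
    (forall h h' : smod_hom S G,
       (forall (U : opens M) (e : 'I_k -> E U), h U (m U e) = h' U (m U e)) ->
       forall (U : opens M) (s : S U), h U s = h' U s).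

(** The model: on [W] open in R^p, C^oo(W) (x) Lambda (R^q)^*, whose elements
    sum_I f_I theta^I are given by the family of their coefficients [f_I];
    [theta^I] is the product of the [theta_j], [j] in [I], in increasing
    order. *)

Fixpoint Cdiff (R : realType) (p n : nat) (W : set 'rV[R]_p)
    (f : 'rV[R]_p -> R) : Prop :=
  (forall x, W x -> {for x, continuous f}) /\
  match n with
  | 0%N => True
  | n'.+1 => forall i : 'I_p,
      (forall x, W x -> derivable f x (delta_mx 0 i)) /\
      Cdiff n' W (fun x => 'D_(delta_mx 0 i) f x)
  end.

Definition smooth_on (R : realType) (p : nat) (W : set 'rV[R]_p)
  (f : 'rV[R]_p -> R) : Prop := forall n, Cdiff n W f.

Definition coefs (R : realType) (p q : nat) : Type :=
  {set 'I_q} -> 'rV[R]_p -> R.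

(* theta^I theta^J = (-1)^(inversions I J) theta^(I :|: J) for disjoint I, J *)
Definition inversions (q : nat) (I J : {set 'I_q}) : nat :=
  #|[set ij : 'I_q * 'I_q | [&& ij.1 \in I, ij.2 \in J & (ij.2 < ij.1)%N]]|.

Definition coefs_mul (R : realType) (p q : nat) (F G : coefs R p q) :
    coefs R p q := fun K x =>
  \sum_(I : {set 'I_q} | I \subset K)
    (-1) ^+ inversions I (K :\: I) * F I x * G (K :\: I) x.

Definition coefs_one (R : realType) (p q : nat) : coefs R p q :=
  fun K _ => (K == finset.set0)%:R.

(* [inl i] is the even coordinate z_i and [inr j] the odd one theta_j. *)
Definition coord (p q : nat) : Type := ('I_p + 'I_q)%type.
HB.instance Definition _ (p q : nat) := Finite.on (coord p q).

Definition cpar (p q : nat) (a : coord p q) : bool :=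
  if a is inr _ then true else false.

Definition coefs_partial (R : realType) (p q : nat) (a : coord p q)
    (F : coefs R p q) : coefs R p q := fun I x =>
  match a with
  | inl i => 'D_(delta_mx 0 i) (F I) x
  | inr j =>
      if j \in I then 0
      else (-1) ^+ #|[set l in I | (l < j)%N]| * F (j |: I)%SET x
  end.

(* A system of local coordinates: an isomorphism of the restriction of [M] to
   the open subspace [cdom] with the model on the open set [ccod]. *)
Record chart (R : realType) (M : superspace R) (p q : nat) := Chart {
  cdom : opens M;
  ccod : opens 'rV[R]_p;
  cmap : M -> 'rV[R]_p;
  cinv : 'rV[R]_p -> M;
  cmapK : forall x, cdom x -> ccod (cmap x) /\ cinv (cmap x) = x;
  cinvK : forall y, ccod y -> cdom (cinv y) /\ cmap (cinv y) = y;
  cmap_continuous : forall x, cdom x -> {for x, continuous cmap};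
  cinv_continuous : forall y, ccod y -> {for y, continuous cinv};
  chcoef : forall V : opens M, V `<=` cdom -> sO M V -> coefs R p q;
  chcoef_smooth : forall (V : opens M) (h : V `<=` cdom) (s : sO M V) I,
    smooth_on (cmap @` V) (chcoef h s I);
  chcoef_inj : forall (V : opens M) (h : V `<=` cdom) (s t : sO M V),
    (forall I x, (cmap @` V) x -> chcoef h s I x = chcoef h t I x) -> s = t;
  chcoef_surj : forall (V : opens M) (h : V `<=` cdom) (F : coefs R p q),
    (forall I, smooth_on (cmap @` V) (F I)) ->
    exists s : sO M V, forall I x, (cmap @` V) x -> chcoef h s I x = F I x;
  chcoef_linear : forall (V : opens M) (h : V `<=` cdom) a (s t : sO M V) I x,
    (cmap @` V) x -> chcoef h (a *: s + t) I x =
    a * chcoef h s I x + chcoef h t I x;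
  chcoef_one : forall (V : opens M) (h : V `<=` cdom) I x,
    (cmap @` V) x -> chcoef h (sone V) I x = coefs_one I x;
  chcoef_mul : forall (V : opens M) (h : V `<=` cdom) (s t : sO M V) I x,
    (cmap @` V) x ->
    chcoef h (smul s t) I x = coefs_mul (chcoef h s) (chcoef h t) I x;
  chcoef_hpart : forall (V : opens M) (h : V `<=` cdom) b (s : sO M V) I x,
    (cmap @` V) x ->
    chcoef h (hpart (sO M) b s) I x =
    if odd #|I| == b then chcoef h s I x else 0;
  chcoef_res : forall (V W : opens M) (hV : V `<=` cdom) (hW : W `<=` cdom)
      (hWV : W `<=` V) (s : sO M V) I x,
    (cmap @` W) x -> chcoef hW (res (sO M) hWV s) I x = chcoef hV s I x
}.

Record supermanifold (R : realType) (p q : nat) := Supermanifold {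
  smspace :> superspace R;
  smspace_local : locally_ringed smspace;
  smspace_charts : forall x : smspace,
    exists c : chart smspace p q, cdom c x
}.

(* [D a] is the coordinate vector field d/dx_a. *)
Definition coordinate_fields (R : realType) (M : superspace R) (p q : nat)
    (c : chart M p q) (D : coord p q -> tangent M (cdom c)) : Prop :=
  forall a (V : opens M) (h : V `<=` cdom c) (f : sO M V) I x,
    (cmap c @` V) x ->
    chcoef h (val (D a) V h f) I x = coefs_partial a (chcoef h f) I x.

(* [dx] is the basis of one-forms dual to the basis [D] of [Pi T]. *)
Definition dual_forms (R : realType) (M : superspace R) (p q : nat)
    (U : opens M) (D : coord p q -> tangent M U)
    (dx : coord p q -> Omega1 M U) : Prop :=
  forall a b, pairing (dx a) (D b) = (a == b)%:R *: sone U.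

Definition consf (A : Type) (k : nat) (x : A) (e : 'I_k -> A) :
  'I_k.+1 -> A := fun j => oapp e x (unlift ord0 j).

(* Parity of the monomial dx_(I 0) ... dx_(I (k-1)). *)
Definition monomial_parity (p q k : nat) (I : 'I_k -> coord p q) : bool :=
  \big[addb/false]_j ~~ cpar (I j).

Record de_rham_complex (R : realType) (p q : nat) (M : supermanifold R p q) :=
  DeRhamComplex {
  Omega : nat -> smodule M;
  wedge : forall k, supersym_map (Omega1 M) k (Omega k);
  Omega_sym_power : forall k, is_sym_power (wedge k);
  dR : forall k, psh_hom (Omega k) (Omega k.+1);
  dR_coord : forall (c : chart M p q)
      (D : coord p q -> tangent M (cdom c))
      (dx : coord p q -> Omega1 M (cdom c)),
    coordinate_fields D -> dual_forms D dx ->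
    forall k (I : 'I_k -> coord p q) (f : sO M (cdom c)),
      dR k (cdom c) (ract (wedge k (cdom c) (dx \o I)) f) =
      \sum_(a : coord p q) ksign R (cpar a && monomial_parity I) *:
        ract (wedge k.+1 (cdom c) (consf (dx a) (dx \o I)))
          (apply_field (D a) f)
}.

Section Kernel.
Variables (R : realType) (X : topologicalType) (F G : presheaf R X).
Variable g : psh_hom F G.

Definition kernel_pred (U : opens X) : {pred F U} :=
  [pred s | `[< g U s = 0 >]].
Arguments kernel_pred : clear implicits.

Lemma kernel_submod (U : opens X) : submod_closed (kernel_pred U).
Proof.
split=> [|a s t /asboolP hs /asboolP ht]; apply/asboolP; first exact: linear0.
by rewrite linearP /= hs ht scaler0 addr0.
Qed.

HB.instance Definition _ (U : opens X) :=
  GRing.isSubmodClosed.Build R (F U) (kernel_pred U) (@kernel_submod U).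

Definition ker_sections (U : opens X) : Type := {s : F U | s \in kernel_pred U}.

HB.instance Definition _ (U : opens X) := SubType.on (ker_sections U).
HB.instance Definition _ (U : opens X) := [Choice of ker_sections U by <:].
HB.instance Definition _ (U : opens X) :=
  [SubChoice_isSubLmodule of ker_sections U by <:].

Lemma kernel_res_subproof (U V : opens X) (h : V `<=` U) (s : ker_sections U) :
  res F h (val s) \in kernel_pred V.
Proof.
by apply/asboolP; rewrite phom_res (asboolP _ (valP s)) linear0.
Qed.

Definition kernel_res (U V : opens X) (h : V `<=` U) (s : ker_sections U) :
  ker_sections V :=
  exist (fun t => t \in kernel_pred V) _ (kernel_res_subproof h s).

Lemma kernel_res_linear (U V : opens X) (h : V `<=` U) :
  linear (@kernel_res U V h).
Proof. by move=> a s t; apply: val_inj; rewrite /= linearP. Qed.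

HB.instance Definition _ (U V : opens X) (h : V `<=` U) :=
  GRing.isLinear.Build R (ker_sections U) (ker_sections V) *:%R
    (@kernel_res U V h) (@kernel_res_linear U V h).

Lemma kernel_res_id (U : opens X) (h : U `<=` U) (s : ker_sections U) :
  kernel_res h s = s.
Proof. by apply: val_inj; rewrite /= res_id. Qed.

Lemma kernel_res_comp (U V W : opens X) (hVU : V `<=` U) (hWV : W `<=` V)
    (hWU : W `<=` U) (s : ker_sections U) :
  kernel_res hWV (kernel_res hVU s) = kernel_res hWU s.
Proof. by apply: val_inj; rewrite /= (res_comp hVU hWV hWU). Qed.

Definition kernel_psh : presheaf R X :=
  @Presheaf R X (fun U => ker_sections U) (fun U V h => @kernel_res U V h)
    kernel_res_id kernel_res_comp.

End Kernel.

Section DeRhamCohomology.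
Variables (R : realType) (p q : nat) (M : supermanifold R p q).
Variable C : de_rham_complex M.

Definition closed_forms (k : nat) : presheaf R M := kernel_psh (dR C k).

Definition exact_form (k : nat) (U : opens M) : Omega C k U -> Prop :=
  match k with
  | 0%N => fun w => w = 0
  | k'.+1 => fun w => exists eta : Omega C k' U, dR C k' U eta = w
  end.

(* [H], with the class map [cl], is the quotient of the sheaf of closed
   [k]-forms by the exact ones, in the category of sheaves. *)
Definition is_cohomology_sheaf (k : nat) (H : presheaf R M)
    (cl : psh_hom (closed_forms k) H) : Prop :=
  [/\ is_sheaf H,
      (forall (U : opens M) (w : closed_forms k U),
         exact_form (val w) -> cl U w = 0) &
      forall (G : presheaf R M) (f : psh_hom (closed_forms k) G),
        is_sheaf G ->
        (forall (U : opens M) (w : closed_forms k U),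
           exact_form (val w) -> f U w = 0) ->
        (exists g : psh_hom H G, forall U w, g U (cl U w) = f U w) /\
        (forall g g' : psh_hom H G,
           (forall U w, g U (cl U w) = g' U (cl U w)) ->
           forall U s, g U s = g' U s)].

Definition cohomology_iso (k : nat) (F : presheaf R M) : Prop :=
  exists (H : presheaf R M) (cl : psh_hom (closed_forms k) H),
    is_cohomology_sheaf cl /\ psh_iso H F.

(* A locally constant function is sent to itself, seen as a section of
   [Omega C 0 = O_M], generated by the empty product. *)
Definition is_augmentation (eps : psh_hom (locconst_psh R M) (Omega C 0)) :
    Prop :=
  forall (U : opens M) (a : R) (e : 'I_0 -> Omega1 M U),
    eps U (locconst_cst U a) = a *: wedge C 0 U e.

Definition resolution : Prop :=
  exists eps : psh_hom (locconst_psh R M) (Omega C 0),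
    [/\ is_augmentation eps,
        (forall U : opens M, injective (eps U)),
        exact_at eps (dR C 0) &
        forall k, exact_at (dR C k) (dR C k.+1)].

Definition closed_locally_exact : Prop :=
  forall (k : nat) (U : opens M) (w : Omega C k.+1 U), dR C k.+1 U w = 0 ->
    forall x, U x -> exists (V : opens M) (h : V `<=` U) (eta : Omega C k V),
      V x /\ dR C k V eta = res (Omega C k.+1) h w.

End DeRhamCohomology.

(* Main.v *)
From HB Require Import structures.
From mathcomp Require Import all_boot all_order all_algebra perm.
From mathcomp Require Import all_classical all_reals all_analysis.
From mathcomp Require Import ring.
Require Import Defs.

(* On a chart whose image is star-shaped about a point, let E = sum_a x_a d/dx_a
   be the Euler field of the coordinates (even and odd) centred there. Cartan's
   formula d i_E + i_E d = L_E exhibits L_E as multiplication by the total weight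
   (in the theta's and the dx's) plus the radial derivative, and on forms of
   positive degree it is inverted by the operator T given on a coefficient of
   weight r + 1 by f |-> int_0^1 t^r f(o + t (x - o)) dt. Since T commutes with
   d, a closed form w equals d (i_E T w).

   The forms are only known through the universal property of the symmetric
   power, so the computation takes place in a Fock space: functions on words in
   the coordinates, with creation operators (products with dx_a) and annihilation
   operators (contractions with d/dx_a). Superderivations of the structure sheaf
   are determined by the coordinates (Hadamard's lemma), hence one-forms are
   freely generated by the dx_a; the universal property gives a morphism from
   k-forms to the Fock space, and its uniqueness clause shows that the obvious
   map back is a left inverse over the chart. *)

Set Implicit Arguments.
Unset Strict Implicit.
Unset Printing Implicit Defensive.

Import Order.TTheory GRing.Theory Num.Theory.
Import numFieldNormedType.Exports.
Local Open Scope classical_set_scope.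
Local Open Scope ring_scope.

(** * Smooth functions *)

(** The universal property speaks of sheaves on the whole of M, whereas coordinates exist only on
    the domain D of a chart. The Fock space is therefore made of sections over U meet D ([push]),
    which form a sheaf on M. Its elements are arbitrary functions on words, with no symmetry
    imposed: the sheaf and module axioms then hold word by word and no quotient is formed. The price
    is that [fock_form] is only a left inverse of the coefficient map; that summing over all words
    of length k reproduces a monomial k! times, whence the factor 1/k!; and that identities needing
    symmetry, such as [number_loc_coefs], are proved only for coefficients of actual forms. The
    coefficient of theta^K in a (k + 1)-form calls for the exponent |K| + k in the radial integral,
    which is never negative. In degree 0 it would be |K| - 1, which fails for K empty: constants
    have weight 0, and they are the cohomology that survives. *)

Section SmoothFunctions.
Variables (R : realType) (p : nat).
Local Notation V := 'rV[R]_p.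
Implicit Types (f g : V -> R) (W : set V) (x v : V) (i j : 'I_p).

Definition partial i f : V -> R := fun x => 'D_(delta_mx 0 i) f x.

(** Clearing the denominator of the difference quotient removes the exception at h = 0 and leaves an
    estimate that can be combined with others. *)
Lemma is_derive_epsP f x v (l : R) :
  is_derive x v f l <->
  forall e : R, 0 < e -> exists2 d : R, 0 < d &
    forall h, `|h| < d -> `|f (h *: v + x) - f x - h * l| <= e * `|h|.
Proof.
have E (h y e : R) : h != 0 ->
    (`|l - h^-1 * y| <= e) = (`|y - h * l| <= e * `|h|).
  move=> h0; have -> : l - h^-1 * y = - (h^-1 * (y - h * l)) by field.
  rewrite normrN normrM normfV ler_pdivrMl ?normr_gt0 //.
  by rewrite [_ * e]mulrC.
split=> [[dv lE] e e0|H].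
  have : h^-1 *: (f (h *: v + x) - f x) @[h --> (0:R)^'] --> 'D_v f x := dv.
  rewrite lE => /cvgrPdist_le/(_ _ e0).
  rewrite near_withinE => -[d /= d0 H]; exists d => // h hd.
  have [->|h0] := eqVneq h 0.
    by rewrite scale0r add0r mul0r !subrr normr0 mulr0.
  have := H h; rewrite /= sub0r normrN => /(_ hd h0) Hh.
  by rewrite -E.
have C : h^-1 *: (f (h *: v + x) - f x) @[h --> (0:R)^'] --> l.
  apply/cvgrPdist_le => e /H[d d0 Hd]; rewrite near_withinE.
  exists d => //= h; rewrite /= sub0r normrN => hd h0.
  by have := Hd h hd; rewrite -E.
split; first by apply/cvg_ex; exists l.
exact: (cvg_lim _ C).
Qed.

Lemma line_is_derive f x v (t : R) :
  derivable f (t *: v + x) v ->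
  is_derive t 1 (fun s : R => f (s *: v + x)) ('D_v f (t *: v + x)).
Proof.
move=> df.
have E : (fun h : R => h^-1 *: (f (h *: v + (t *: v + x)) - f (t *: v + x))) =
   (fun h => h^-1 *: ((fun s : R => f (s *: v + x)) (h *: 1 + t) - f (t *: v + x))).
  by apply/funext => h; rewrite scalerDl addrA scaler1.
by split; rewrite /derivable /derive -/(_ \o _) /= -E.
Qed.

Lemma mvt_line f x v (h : R) :
  (forall s : R, `|s| <= `|h| -> derivable f (s *: v + x) v) ->
  exists2 s : R, `|s| <= `|h| & f (h *: v + x) - f x = h * 'D_v f (s *: v + x).
Proof.
move=> df; pose g (s : R) := f (s *: v + x).
have dg s : `|s| <= `|h| -> is_derive s (1:R) g ('D_v f (s *: v + x)).
  by move=> /df; exact: line_is_derive.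
have cg (a b : R) : (forall s, s \in `[a, b] -> `|s| <= `|h|) ->
  {within `[a, b], continuous g}.
  move=> ab; apply: derivable_within_continuous => s /ab hs.
  by have [] := dg s hs.
have g0 : g 0 = f x by rewrite /g scale0r add0r.
case: (ltgtP h 0) => h0.
- have sub (s : R) : s \in `[h, 0] -> `|s| <= `|h|.
    by rewrite in_itv /= => /andP[a b]; rewrite !ler0_norm ?(ltW h0) // lerN2.
  have D s : s \in `]h, 0[ -> is_derive s (1:R) g ('D_v f (s *: v + x)).
    by move=> /subset_itv_oo_cc /sub; exact: dg.
  have [c ch E] := MVT_segment (ltW h0) D (cg _ _ sub).
  exists c; first exact: sub.
  by rewrite -[f (h *: v + x)]/(g h) -g0 -opprB E sub0r mulrN opprK mulrC.
- have sub (s : R) : s \in `[0, h] -> `|s| <= `|h|.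
    by rewrite in_itv /= => /andP[a b]; rewrite !ger0_norm ?(ltW h0).
  have D s : s \in `]0, h[ -> is_derive s (1:R) g ('D_v f (s *: v + x)).
    by move=> /subset_itv_oo_cc /sub; exact: dg.
  have [c ch E] := MVT_segment (ltW h0) D (cg _ _ sub).
  exists c; first exact: sub.
  by rewrite -[f (h *: v + x)]/(g h) -g0 E subr0 mulrC.
- exists 0; first by rewrite normr0.
  by rewrite h0 scale0r add0r subrr mul0r.
Qed.

Lemma continuous_epsP f x :
  {for x, continuous f} <-> forall e : R, 0 < e -> exists2 d : R, 0 < d &
    forall y, `|y - x| < d -> `|f y - f x| < e.
Proof.
split=> [/cvgrPdist_lt H e /H /nbhs_ballP [d /= d0 Hd]|H].
  exists d => // y yx; rewrite distrC; apply: Hd.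
  by rewrite -ball_normE /= distrC.
apply/(@cvgrPdist_lt _ _ _ _ (nbhs_filter x)) => e /H [d d0 Hd]; apply/nbhs_ballP;
  exists d => //= y.
by rewrite -ball_normE /= => yx; rewrite distrC Hd // distrC.
Qed.


(** The increment along v + c e_i is split into one along v, known by hypothesis, and one along e_i
    from the displaced base point h v + x. The mean value theorem evaluates the latter, and
    continuity of the partial derivative at x absorbs the displacement. *)
Lemma derive_add_partial W f x v (c : R) i :
  open W -> W x -> (forall y, W y -> derivable f y (delta_mx 0 i)) ->
  {for x, continuous (partial i f)} -> derivable f x v ->
  is_derive x (v + c *: delta_mx 0 i) f ('D_v f x + c * partial i f x).
Proof.
move=> oW Wx df cf dv; apply/is_derive_epsP => e e0.
have [d1 d10 H1] : exists2 d : R, 0 < d & forall h, `|h| < d ->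
    `|f (h *: v + x) - f x - h * 'D_v f x| <= e / 2 * `|h|.
  by apply: ((is_derive_epsP f x v _).1 (DeriveDef dv erefl)); exact: divr_gt0.
set ei : V := delta_mx 0 i.
(* The increment along e_i has length h c, so an error [e2] in the partial derivative costs at most
   |h| e / 2; the summand 1 covers c = 0. *)
pose e2 := e / 2 / (1 + `|c|).
have c1 : 0 < 1 + `|c| by rewrite ltr_wpDr.
have e20 : 0 < e2 by rewrite !divr_gt0.
have [d2 d20 H2] := (continuous_epsP _ _).1 cf _ e20.
have /nbhs_ballP[r /= r0 Hr] : nbhs x W by exact: open_nbhs_nbhs.
(* All points met below lie within |h| K of x; the summand 1 keeps K positive. *)
pose K := 1 + (`|c| * `|ei| + `|v|).
have K0 : 0 < K by rewrite ltr_wpDr // addr_ge0 // mulr_ge0.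
exists (Num.min d1 (Num.min d2 r / K)).
  by rewrite lt_min d10 divr_gt0 // lt_min d20.
move=> h; rewrite lt_min ltr_pdivlMr // => /andP[hd1].
rewrite lt_min => /andP[hd2 hr].
have near (s : R) : `|s| <= `|h * c| -> `|s *: ei + (h *: v + x) - x| <= `|h| * K.
  move=> hs; rewrite addrA addrK (le_trans (ler_normD _ _)) // !normrZ.
  rewrite /K !mulrDr mulr1 mulrA -normrM.
  apply: (@le_trans _ _ (`|h * c| * `|ei| + `|h| * `|v|)); last by rewrite lerDr.
  by rewrite lerD2r ler_wpM2r.
have nearW (s : R) : `|s| <= `|h * c| -> W (s *: ei + (h *: v + x)).
  move=> hs; apply: Hr; rewrite -ball_normE /= distrC.
  exact: le_lt_trans (near s hs) hr.
have [s hs Es] := mvt_line (fun s hs => df _ (nearW s hs)).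
have -> : h *: (v + c *: ei) + x = (h * c) *: ei + (h *: v + x).
  by rewrite scalerDr scalerA addrA [h *: v + _]addrC.
have -> : f ((h * c) *: ei + (h *: v + x)) - f x - h * ('D_v f x + c * partial i f x) =
   (h * c) * (partial i f (s *: ei + (h *: v + x)) - partial i f x) +
   (f (h *: v + x) - f x - h * 'D_v f x).
  rewrite -[X in X - f x - _](subrK (f (h *: v + x))) Es /partial -/ei; ring.
apply: le_trans (ler_normD _ _) _.
have -> : e * `|h| = e / 2 * `|h| + e / 2 * `|h| by field.
apply: lerD; last exact: H1.
rewrite normrM [`|h * c|]normrM -mulrA [e / 2 * _]mulrC ler_wpM2l //.
have {}near := H2 _ (le_lt_trans (near s hs) hd2).
apply: le_trans (_ : (1 + `|c|) * e2 <= _); last by rewrite /e2 mulrC divfK ?gt_eqF.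
by apply: ler_pM => //; [rewrite lerDr | exact: ltW].
Qed.

Lemma derive_partial W f x v :
  open W -> W x ->
  (forall i y, W y -> derivable f y (delta_mx 0 i)) ->
  (forall i, {for x, continuous (partial i f)}) ->
  is_derive x v f (\sum_i v 0 i * partial i f x).
Proof.
move=> oW Wx df cf; rewrite {1}[v]row_sum_delta.
elim: (index_enum _) => [|i r IHr].
  by rewrite !big_nil; exact: is_derive0.
rewrite !big_cons addrC [_ * _ + _]addrC -(@derive_val _ _ _ _ _ _ _ IHr).
exact: (derive_add_partial _ oW Wx (df i) (cf i)).
Qed.

Lemma near_continuous f g x : (\forall y \near x, f y = g y) ->
  {for x, continuous f} -> {for x, continuous g}.
Proof.
move=> fg cf; rewrite /prop_for /continuous_at -(nbhs_singleton fg).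
by apply: cvg_trans cf; apply: (@near_eq_cvg _ _ _ (nbhs_filter x)).
Qed.

Lemma Cdiff_eq n W f g : open W -> (forall x, W x -> f x = g x) ->
  Cdiff n W f -> Cdiff n W g.
Proof.
move=> oW; have N f1 g1 : (forall x, W x -> f1 x = g1 x) ->
    forall x, W x -> \forall y \near x, f1 y = g1 y.
  move=> fg x Wx.
  by apply: filterS (open_nbhs_nbhs (conj oW Wx)) => y; exact: fg.
elim: n f g => [|n IHn] f g /N fg [cf df].
  by split=> // x Wx; exact: near_continuous (fg x Wx) (cf x Wx).
split=> [x Wx|i]; first exact: near_continuous (fg x Wx) (cf x Wx).
have [d1 d2] := df i; split.
  by move=> x Wx; apply: near_eq_derivable (d1 x Wx); exact: fg.
by apply: IHn d2 => x Wx; apply: near_eq_derive; exact: fg.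
Qed.

Lemma CdiffS n W f : Cdiff n.+1 W f -> Cdiff n W f.
Proof.
elim: n f => [|n IHn] f [cf df]; split=> // i.
by have [d1 d2] := df i; split=> //; exact: IHn.
Qed.

(* A coinduction principle: it suffices to exhibit a class of continuous
   functions that is stable under taking partial derivatives. *)
Lemma smooth_coind (P : (V -> R) -> Prop) W f : open W ->
  (forall g, P g -> (forall x, W x -> {for x, continuous g}) /\
     forall i, (forall x, W x -> derivable g x (delta_mx 0 i)) /\
       exists2 h, P h & forall x, W x -> h x = partial i g x) ->
  P f -> smooth_on W f.
Proof.
move=> oW H Pf n; elim: n f Pf => [|n IHn] f Pf /=.
  by have [] := H _ Pf.
have [cf df] := H _ Pf; split=> // i.
have [d1 [h Ph hE]] := df i; split=> //.
by apply: Cdiff_eq (IHn _ Ph).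
Qed.

Section SmoothTheory.
Variable W : set V.
Hypothesis oW : open W.

Lemma smooth_continuous f x : smooth_on W f -> W x -> {for x, continuous f}.
Proof. by move=> /(_ 0%N)[H _]; exact: H. Qed.

Lemma smooth_derivable f i x : smooth_on W f -> W x ->
  derivable f x (delta_mx 0 i).
Proof. by move=> /(_ 1%N)[_ /(_ i)[H _]]; exact: H. Qed.

Arguments smooth_derivable {f} i {x}.

Lemma smooth_partial f i : smooth_on W f -> smooth_on W (partial i f).
Proof. by move=> sf n; have [_ /(_ i)[]] := sf n.+1. Qed.

Lemma smooth_eq f g : (forall x, W x -> f x = g x) ->
  smooth_on W f -> smooth_on W g.
Proof. by move=> fg sf n; apply: Cdiff_eq (sf n). Qed.

Lemma partial_eq f g i x : (forall y, W y -> f y = g y) -> W x ->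
  partial i f x = partial i g x.
Proof.
move=> fg Wx; apply: near_eq_derive.
by apply: filterS (open_nbhs_nbhs (conj oW Wx)) => y; exact: fg.
Qed.

Lemma partial_cst i (a : R) x : partial i (fun=> a) x = 0.
Proof. exact: derive_cst. Qed.

Lemma smooth_cst (a : R) : smooth_on W (fun=> a).
Proof.
pose P f := exists a : R, f = (fun=> a).
apply: (@smooth_coind P) => //; last by exists a.
move=> g [b ->]; split=> [x _|i]; first exact: cst_continuous.
split=> [x _|]; first exact: derivable_cst.
by exists (fun=> 0) => [|x _]; [exists 0 | rewrite partial_cst].
Qed.

Lemma partial_lin f g i (a : R) x : smooth_on W f -> smooth_on W g -> W x ->
  partial i (fun y => a * f y + g y) x = a * partial i f x + partial i g x.
Proof.
move=> sf sg Wx; have df := smooth_derivable i sf Wx.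
have dg := smooth_derivable i sg Wx.
have := deriveD (derivableZ (k := a) df) dg.
by rewrite deriveZ.
Qed.

Lemma partialM f g i x : smooth_on W f -> smooth_on W g -> W x ->
  partial i (fun y => f y * g y) x = partial i f x * g x + f x * partial i g x.
Proof.
move=> sf sg Wx; have df := smooth_derivable i sf Wx.
have dg := smooth_derivable i sg Wx.
have := deriveM df dg.
by rewrite addrC [_ *: 'D_ _ f x]mulrC.
Qed.

Lemma smooth_lin f g (a : R) : smooth_on W f -> smooth_on W g ->
  smooth_on W (fun x => a * f x + g x).
Proof.
move=> sf sg.
pose P k := exists f g, [/\ smooth_on W f, smooth_on W g &
  k = fun x => a * f x + g x].
apply: (@smooth_coind P) => //; last by exists f, g.
move=> _ [{sf sg}f [{}g [sf sg ->]]]; split=> [x Wx|i].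
  have cf := smooth_continuous sf Wx; have cg := smooth_continuous sg Wx.
  by apply: (continuousD (continuousM (@cst_continuous _ _ a x) cf) cg).
split=> [x Wx|].
  have df := smooth_derivable i sf Wx; have dg := smooth_derivable i sg Wx.
  exact: derivableD (derivableZ (k := a) df) dg.
exists (fun x => a * partial i f x + partial i g x).
  by exists (partial i f), (partial i g); split=> //; exact: smooth_partial.
by move=> x Wx; rewrite (partial_lin i a sf sg).
Qed.

(** The partial derivatives of a product are sums of products, so the class of products is not
    stable in the way [smooth_coind] asks; the induction is on the order of differentiability
    instead. *)
Lemma smoothM f g : smooth_on W f -> smooth_on W g ->
  smooth_on W (fun x => f x * g x).
Proof.
have lin n f1 g1 : Cdiff n W f1 -> Cdiff n W g1 ->
    Cdiff n W (fun x => f1 x + g1 x).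
  elim: n f1 g1 => [|n IHn] f1 g1 [cf df] [cg dg]; split=> //.
  1,2: by move=> x Wx; apply: continuousD (cf x Wx) (cg x Wx).
  move=> i; have [df1 df2] := df i; have [dg1 dg2] := dg i; split.
    by move=> x Wx; apply: derivableD (df1 x Wx) (dg1 x Wx).
  apply: Cdiff_eq (IHn _ _ df2 dg2) => // x Wx.
  by have := deriveD (df1 x Wx) (dg1 x Wx).
move=> sf sg n; have {sf sg} : Cdiff n W f /\ Cdiff n W g by [].
elim: n f g => [|n IHn] f g [F G]; have [cf df] := F; have [cg dg] := G; split=> //.
1,2: by move=> x Wx; apply: continuousM (cf x Wx) (cg x Wx).
move=> i; have [df1 df2] := df i; have [dg1 dg2] := dg i; split.
  by move=> x Wx; apply: derivableM (df1 x Wx) (dg1 x Wx).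
have H1 := IHn _ _ (conj df2 (CdiffS G)).
have H2 := IHn _ _ (conj (CdiffS F) dg2).
apply: Cdiff_eq (lin n _ _ H1 H2) => // x Wx.
have := deriveM (df1 x Wx) (dg1 x Wx).
by rewrite addrC [_ *: 'D_ _ f x]mulrC.
Qed.

Lemma smoothD f g : smooth_on W f -> smooth_on W g ->
  smooth_on W (fun x => f x + g x).
Proof.
by move=> sf sg; apply: smooth_eq (smooth_lin 1 sf sg) => x _; rewrite mul1r.
Qed.

Lemma smoothZ f (a : R) : smooth_on W f -> smooth_on W (fun x => a * f x).
Proof.
by move=> sf; apply: smooth_eq (smooth_lin a sf (smooth_cst 0)) => x _; rewrite addr0.
Qed.

Lemma smooth_sum (I : Type) (r : seq I) (P : pred I) (F : I -> V -> R) :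
  (forall k : I, P k -> smooth_on W (F k)) ->
    smooth_on W (fun x => \sum_(k <- r | P k) F k x).
Proof.
move=> sF; elim: r => [|i r IHr].
  by apply: smooth_eq (smooth_cst 0) => x _; rewrite big_nil.
case Pi: (P i); last by apply: smooth_eq IHr => x _; rewrite big_cons Pi.
by apply: smooth_eq (smoothD (sF i Pi) IHr) => x _; rewrite big_cons Pi.
Qed.

Lemma partial_sum (I : Type) (r : seq I) (P : pred I) (F : I -> V -> R) i x :
  (forall k : I, P k -> smooth_on W (F k)) -> W x ->
  partial i (fun x => \sum_(k <- r | P k) F k x) x = \sum_(j <- r | P j) partial i (F j)
    x.
Proof.
move=> sF Wx; elim: r => [|j r IHr].
  rewrite big_nil; rewrite (@partial_eq _ (fun=> 0)) ?partial_cst // => y _.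
  by rewrite big_nil.
rewrite big_cons; case Pj: (P j); last first.
  by rewrite -IHr; apply: partial_eq => // y _; rewrite big_cons Pj.
rewrite -IHr -[partial i (F j) x]mul1r -partial_lin //; [|exact: sF|exact: smooth_sum].
by apply: partial_eq => // y _; rewrite big_cons Pj mul1r.
Qed.

Lemma is_derive_coord i x v : is_derive x v (fun y : V => y 0 i) (v 0 i).
Proof.
apply/is_derive_epsP => e e0; exists 1 => // h _.
by rewrite !mxE addrK subrr normr0 mulr_ge0 // ltW.
Qed.

Lemma partial_coord i j (a : R) x :
  partial i (fun y : V => y 0 j - a) x = (i == j)%:R.
Proof.
have H : is_derive x (delta_mx 0 i) (fun y : V => y 0 j - a) ((i == j)%:R - 0).
  have -> : (i == j)%:R = (delta_mx 0 i : V) 0 j by rewrite mxE eqxx eq_sym.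
  have Hc := is_derive_coord j x (delta_mx 0 i).
  exact: (is_deriveB Hc (is_derive_cst a x _)).
by rewrite /partial (@derive_val _ _ _ _ _ _ _ H) subr0.
Qed.

Lemma smooth_coord j (a : R) : smooth_on W (fun y : V => y 0 j - a).
Proof.
pose P f := (f = fun y : V => y 0 j - a) \/ smooth_on W f.
apply: (@smooth_coind P) => //; last by left.
move=> g [->|sg]; split.
- move=> x _; apply: continuousB; first exact: coord_continuous.
  exact: cst_continuous.
- move=> i; split=> [x _|].
    by apply: derivableB; have [] := is_derive_coord j x (delta_mx 0 i).
  exists (fun=> (i == j)%:R); first by right; exact: smooth_cst.
  by move=> x _; rewrite partial_coord.
- by move=> x; exact: smooth_continuous.
- move=> i; split=> [x|]; first exact: smooth_derivable.
  by exists (partial i g) => //; right; exact: smooth_partial.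
Qed.

Lemma smooth_derive f x v : smooth_on W f -> W x ->
  is_derive x v f (\sum_i v 0 i * partial i f x).
Proof.
move=> sf Wx; apply: (derive_partial v oW Wx) => i.
  by move=> y; exact: smooth_derivable.
by apply: smooth_continuous => //; exact: smooth_partial.
Qed.

End SmoothTheory.

End SmoothFunctions.

Arguments smooth_derivable {R p W f} i {x}.
Arguments smooth_partial {R p W f} i.

(** * Integration along rays *)

Section UnitIntegral.
Variable R : realType.
Implicit Types g h G : R -> R.

Definition unit_integral g : R :=
  (\int[lebesgue_measure]_(t in `[0%R, 1%R]) g t)%R.

Let intI g : {within `[0, 1], continuous g} ->
  lebesgue_measure.-integrable `[0, 1] (EFin \o g).
Proof. by move=> cg; apply: continuous_compact_integrable => //; exact: segment_compact.
  Qed.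

Lemma eq_unit_integral g h : (forall t : R, 0 <= t <= 1 -> g t = h t) ->
  unit_integral g = unit_integral h.
Proof. by move=> gh; apply: eq_Rintegral => t; rewrite inE /= in_itv; exact: gh. Qed.

Lemma unit_integral_lin (a : R) g h :
  {within `[0, 1], continuous g} -> {within `[0, 1], continuous h} ->
  unit_integral (fun t => a * g t + h t) = a * unit_integral g + unit_integral h.
Proof.
move=> cg ch; rewrite /unit_integral RintegralD //; last exact: intI.
  by rewrite RintegralZl //; exact: intI.
by apply: intI => x; apply: (continuousM (@cst_continuous _ _ a x) (cg x)).
Qed.

Lemma unit_integral_le g (e : R) : {within `[0, 1], continuous g} ->
  (forall t : R, 0 <= t <= 1 -> `|g t| <= e) -> `|unit_integral g| <= e.
Proof.
move=> cg ge; rewrite /unit_integral.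
apply: (le_trans (le_normr_Rintegral _ (intI cg))) => //.
have -> : e = unit_integral (fun=> e).
  have E : lebesgue_measure (`[0%R, 1%R] : set R) = 1%:E.
    by rewrite lebesgue_measure_itv /= lte_fin ltr01 -EFinB subr0.
  by rewrite /unit_integral Rintegral_cst //= [X in fine X]E mulr1.
apply: le_Rintegral => //.
- by apply: intI => x; apply: continuous_comp (cg x) _; exact: norm_continuous.
- by apply: intI => x; exact: cst_continuous.
Qed.

Lemma unit_integral_FTC g G : {within `[0, 1], continuous g} ->
  (forall t : R, 0 <= t <= 1 -> is_derive t (1:R) G (g t)) ->
  unit_integral g = G 1 - G 0.
Proof.
move=> cg fock_diff.
have dG' (t : R) : 0 <= t <= 1 -> derivable G t 1 by move=> /fock_diff [].
have cG (t : R) : 0 <= t <= 1 -> {for t, continuous G}.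
  by move=> /dG' /derivable1_diffP /differentiable_continuous.
rewrite /unit_integral /Rintegral (@continuous_FTC2 _ g G 0 1) //.
- split.
  + by move=> t ht; apply: dG'; have := subset_itv_oo_cc ht; rewrite in_itv.
  + by apply: cvg_at_right_filter; apply: cG; rewrite lexx ler01.
  + by apply: cvg_at_left_filter; apply: cG; rewrite lexx ler01.
- move=> t ht; have /fock_diff [_ <-] : 0 <= t <= 1.
    by have := subset_itv_oo_cc ht; rewrite in_itv.
  by rewrite derive1E.
Qed.

End UnitIntegral.

(** * Symmetry of second derivatives and the radial integral operator *)

Section RadialIntegral.
Variables (R : realType) (p : nat).
Local Notation V := 'rV[R]_p.
Implicit Types (f g : V -> R) (x v y : V) (i j : 'I_p).

(** The second difference over the parallelogram with sides h e_i and h e_j is symmetric in i and j.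
    Two applications of the mean value theorem make it h^2 times either mixed derivative at a point
    near x, and these are continuous. *)
Lemma schwarz (W : set V) f i j x : open W -> smooth_on W f -> W x ->
  partial i (partial j f) x = partial j (partial i f) x.
Proof.
move=> oW sf Wx.
have [r r0 Hr] : exists2 r : R, 0 < r & forall y, `|y - x| < r -> W y.
  have /nbhs_ballP[r /= r0 Hr] : nbhs x W by exact: open_nbhs_nbhs.
  by exists r => // y yx; apply: Hr; rewrite -ball_normE /= distrC.
pose K i j := 1 + (`|delta_mx 0 i : V| + `|delta_mx 0 j : V|).
have near i' j' (h s t : R) : `|s| <= `|h| -> `|t| <= `|h| -> `|h| * K i' j' < r ->
    W (t *: delta_mx 0 j' + (s *: delta_mx 0 i' + x)) /\
    `|t *: delta_mx 0 j' + (s *: delta_mx 0 i' + x) - x| <= `|h| * K i' j'.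
  move=> sh th hr.
  have D : `|t *: delta_mx 0 j' + (s *: delta_mx 0 i' + x) - x| <= `|h| * K i' j'.
    rewrite addrA addrK (le_trans (ler_normD _ _)) // !normrZ /K !mulrDr mulr1.
    rewrite [X in X <= _]addrC -[X in X <= _]add0r lerD //.
    by rewrite lerD // ler_wpM2r.
  by split=> //; apply: Hr; exact: le_lt_trans D hr.
have step i' j' (h : R) : `|h| * K i' j' < r -> exists s t,
  [/\ `|s| <= `|h|, `|t| <= `|h| &
   f (h *: delta_mx 0 j' + (h *: delta_mx 0 i' + x)) - f (h *: delta_mx 0 i' + x)
     - (f (h *: delta_mx 0 j' + x) - f x) =
   h * (h * partial j' (partial i' f) (t *: delta_mx 0 j' + (s *: delta_mx 0 i' + x)))].
  move=> hr.
  have W1 s : `|s| <= `|h| -> W (s *: delta_mx 0 i' + x).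
    move=> sh; have [] := near i' j' h s 0 sh _ hr; first by rewrite normr0.
    by rewrite scale0r add0r.
  have W2 s : `|s| <= `|h| -> W (h *: delta_mx 0 j' + (s *: delta_mx 0 i' + x)).
    by move=> sh; have [] := near i' j' h s h sh (lexx _) hr.
  pose g y := f (h *: delta_mx 0 j' + y) - f y.
  have dshift y : W (h *: delta_mx 0 j' + y) ->
      is_derive y (delta_mx 0 i' : V) (fun y => f (h *: delta_mx 0 j' + y))
        (partial i' f (h *: delta_mx 0 j' + y)).
    move=> Wy; have := (@is_derive_epsP R p f _ _ _).1
      (DeriveDef (smooth_derivable i' sf Wy) erefl) => H.
    apply/is_derive_epsP => e /H[d d0 Hd]; exists d => // k /Hd.
    by rewrite addrCA.
  have dg s : `|s| <= `|h| -> is_derive (s *: delta_mx 0 i' + x) (delta_mx 0 i' : V) g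
     (partial i' f (h *: delta_mx 0 j' + (s *: delta_mx 0 i' + x))
      - partial i' f (s *: delta_mx 0 i' + x)).
    move=> sh; apply: is_deriveB; first exact/dshift/W2.
    exact: DeriveDef (smooth_derivable i' sf (W1 s sh)) erefl.
  have [s sh Es] := mvt_line (f := g) (fun s sh => @ex_derive _ _ _ _ _ _ _ (dg s sh)).
  have spf := smooth_partial i' sf.
  have [|t th Et] := @mvt_line _ _ (partial i' f) (s *: delta_mx 0 i' + x)
    (delta_mx 0 j') h.
    move=> t th; apply: (smooth_derivable j' spf).
    by have [] := near i' j' h s t sh th hr.
  exists s, t; split=> //; rewrite -[LHS]/(g (h *: delta_mx 0 i' + x) - g x) Es.
  by rewrite (@derive_val _ _ _ _ _ _ _ (dg s sh)) Et.
apply/eqP; rewrite -subr_eq0 -normr_le0; apply/ler_addgt0Pl => e e0; rewrite addr0.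
have e2 : 0 < e / 2 by rewrite divr_gt0.
have c1 := smooth_continuous (smooth_partial i (smooth_partial j sf)) Wx.
have c2 := smooth_continuous (smooth_partial j (smooth_partial i sf)) Wx.
have [d1 d10 H1] := (continuous_epsP _ _).1 c1 _ e2.
have [d2 d20 H2] := (continuous_epsP _ _).1 c2 _ e2.
pose m := Num.min r (Num.min d1 d2).
have m0 : 0 < m by rewrite !lt_min r0 d10.
have K0 i' j' : 0 < K i' j' by rewrite /K ltr_wpDr // addr_ge0.
have KC : K j i = K i j by rewrite /K [X in 1 + X]addrC.
have [h h0 hm] : exists2 h : R, h != 0 & `|h| * K i j < m.
  exists (m / 2 / K i j); first by rewrite gt_eqF // !divr_gt0.
  rewrite gtr0_norm ?divr_gt0 // divfK ?gt_eqF // ltr_pdivrMr //.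
  by rewrite ltr_pMr // ltr1n.
have hr : `|h| * K i j < r by apply: lt_le_trans hm _; rewrite ge_min lexx.
have hd1 : `|h| * K i j < d1 by apply: lt_le_trans hm _; rewrite !ge_min lexx orbT.
have hd2 : `|h| * K i j < d2 by apply: lt_le_trans hm _; rewrite !ge_min lexx !orbT.
have [s [t [sh th E1]]] := step i j h hr.
have [s' [t' [sh' th' E2]]] : exists s t, _ :=
  step j i h (eq_ind_r (fun k => `|h| * k < r) hr KC).
have [_ n1] := near i j h s t sh th hr.
have [_ n2] := near j i h s' t' sh' th' (eq_ind_r (fun k => `|h| * k < r) hr KC).
rewrite KC in n2.
have {}H2 := H2 _ (le_lt_trans n1 hd2).
have {}H1 := H1 _ (le_lt_trans n2 hd1).
(* Both sides, multiplied by h^2, are the same second difference; h is nonzero. *)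
have E : partial j (partial i f) (t *: delta_mx 0 j + (s *: delta_mx 0 i + x)) =
         partial i (partial j f) (t' *: delta_mx 0 i + (s' *: delta_mx 0 j + x)).
  apply/eqP; rewrite -(inj_eq (mulfI h0)) -(inj_eq (mulfI h0)); apply/eqP.
  apply: (etrans (esym E1)); apply: etrans E2.
  by rewrite [h *: delta_mx 0 j + (_ + _)]addrCA !opprB !addrA addrAC; ring.
rewrite E in H2.
set A := partial i _ x; set B := partial j _ x; set Z := partial i _ _ in H1 H2.
have -> : A - B = (A - Z) + (Z - B) by ring.
rewrite distrC in H1; have {}H1 := ltW H1; have {}H2 := ltW H2.
apply: (le_trans (ler_normD _ _)); rewrite [e]splitr.
exact: lerD H1 H2.
Qed.

Section Radial.
Variables (o : V) (W : set V).
Hypothesis oW : open W.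
Hypothesis starW : forall x (t : R), W x -> 0 <= t <= 1 -> W (t *: (x - o) + o).

(** The inverse of the operator [sum_i (x_i - o_i) d/dx_i + (m + 1)], by [radial_euler]. *)
Definition radial (m : nat) f : V -> R := fun x =>
  unit_integral (fun t => t ^+ m * f (t *: (x - o) + o)).

Lemma within_continuous (g : R -> R) :
  (forall t : R, 0 <= t <= 1 -> {for t, continuous g}) -> {within `[0, 1], continuous g}.
Proof.
move=> cg; apply: continuous_in_subspaceT => t; rewrite inE /= in_itv; exact: cg.
Qed.

Lemma within_continuous_sum (I : Type) (r : seq I) (a : I -> R) (F : I -> R -> R) :
  (forall k : I, {within `[0, 1], continuous (F k)}) ->
  {within `[0, 1], continuous (fun t => \sum_(k <- r) a k * F k t)}.
Proof.
move=> cF; elim: r => [|i r IHr].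
  rewrite (_ : (fun _ => _) = (fun=> 0 : R)).
    by move=> t; exact: cst_continuous.
  by apply/funext => t; rewrite big_nil.
rewrite (_ : (fun _ => _) = fun t => a i * F i t + \sum_(j <- r) a j * F j t).
  by move=> t; apply: continuousD (IHr t); apply: continuousM (cF i t);
    exact: cst_continuous.
by apply/funext => t; rewrite big_cons.
Qed.

Lemma ray_continuous f x (t : R) : (forall x, W x -> {for x, continuous f}) ->
  W x -> 0 <= t <= 1 -> {for t, continuous (fun s : R => f (s *: (x - o) + o))}.
Proof.
move=> cf Wx t01.
apply: (@continuous_comp _ _ _ (fun s : R => s *: (x - o) + o) f); last exact/cf/starW.
by apply: cvgD; [exact: scalel_continuous | exact: cvg_cst].
Qed.

Lemma radial_integrand_continuous m f x : (forall x, W x -> {for x, continuous f}) ->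
  W x -> {within `[0, 1], continuous (fun t : R => t ^+ m * f (t *: (x - o) + o))}.
Proof.
move=> cf Wx; apply: within_continuous => t t01.
by apply: continuousM; [exact: exprn_continuous | exact: ray_continuous].
Qed.

(** Continuity at each point of the segment from o to x becomes uniform in t by compactness of
    [0, 1]. This replaces dominated convergence in the two results that follow. *)
Lemma ray_uniform f x (e : R) : (forall x, W x -> {for x, continuous f}) -> W x ->
  0 < e ->
  exists2 d : R, 0 < d & forall y, `|y - x| < d -> W y /\
    forall t : R, 0 <= t <= 1 ->
      `|f (t *: (y - o) + o) - f (t *: (x - o) + o)| <= e.
Proof.
move=> cf Wx e0; have e2 : 0 < e / 2 by rewrite divr_gt0.
have K : compact (`[0, 1] : set R) := @segment_compact R 0 1.
pose P (y : V) (t : R) := `|f (t *: (y - o) + o) - f (t *: (x - o) + o)| <= e.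
have /compact_near_coveringP/(_ V (nbhs x) P (nbhs_filter x)) H := K.
have : \near x, `[0, 1] `<=` P x.
  apply: H => t; rewrite /= in_itv /= => t01.
  have ct := cf _ (starW Wx t01).
  have [d d0 Hd] := (continuous_epsP _ _).1 ct _ e2.
  have c1 : (z.1 *: (z.2 - o) + o) @[z --> (t, x)] --> t *: (x - o) + o.
    apply: cvgD; last exact: cvg_cst.
    apply: cvgZ; first exact: cvg_fst.
    by apply: cvgB; [exact: cvg_snd | exact: cvg_cst].
  have c2 : (z.1 *: (x - o) + o) @[z --> (t, x)] --> t *: (x - o) + o.
    apply: cvgD; last exact: cvg_cst.
    by apply: cvgZr_tmp; exact: cvg_fst.
  move/cvgrPdist_lt/(_ _ d0): c1; move/cvgrPdist_lt/(_ _ d0): c2.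
  rewrite /P; apply: filterS2 => -[s y] /=; rewrite distrC => /Hd h1; rewrite distrC =>
    /Hd h2.
  (* Both values are compared with the one at parameter t on the fixed ray, each at the cost e /
     2. *)
  have -> : f (s *: (y - o) + o) - f (s *: (x - o) + o) =
      (f (s *: (y - o) + o) - f (t *: (x - o) + o)) -
      (f (s *: (x - o) + o) - f (t *: (x - o) + o)) by ring.
  rewrite [e]splitr; apply: le_trans (ler_normB _ _) _.
  exact: lerD (ltW h2) (ltW h1).
move=> near1; have near2 : \near x, W x by exact: open_nbhs_nbhs.
have /nbhs_ballP[d /= d0 Hd] : nbhs x (W `&` [set y | `[0, 1] `<=` P y]).
  exact: (filterI near2 near1).
exists d => // y yx; have /Hd [Wy Py] : ball x d y by rewrite -ball_normE /= distrC.
by split=> // t t01; apply: Py; rewrite /= in_itv.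
Qed.

Lemma radial_continuous m f x : (forall x, W x -> {for x, continuous f}) -> W x ->
  {for x, continuous (radial m f)}.
Proof.
move=> cf Wx; apply/continuous_epsP => e e0; have e2 : 0 < e / 2 by rewrite divr_gt0.
have [d d0 Hd] := ray_uniform cf Wx e2; exists d => // y /Hd[Wy H].
apply: (@le_lt_trans _ _ (e / 2)); last by rewrite ltr_pdivrMr // ltr_pMr // ltr1n.
have cx := radial_integrand_continuous (m := m) cf Wx.
have cy := radial_integrand_continuous (m := m) cf Wy.
have -> : radial m f y - radial m f x = unit_integral (fun t : R =>
   -1 * (t ^+ m * f (t *: (x - o) + o)) + t ^+ m * f (t *: (y - o) + o)).
  by rewrite unit_integral_lin // mulN1r addrC.
apply: unit_integral_le.
  by move=> t; apply: continuousD (cy t); apply: continuousM (cx t);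
    exact: cst_continuous.
move=> t t01; rewrite mulN1r addrC -mulrBr normrM -[e / 2]mul1r.
have /andP[t0 t1] := t01.
by apply: ler_pM => //; [rewrite normrX ger0_norm // exprn_ile1 | exact: H].
Qed.

(** Differentiation under the integral sign. A displacement of x by h e_i moves the point at
    parameter t by t h e_i, and this factor t turns the exponent m into m + 1. The error of the
    integrand is controlled by the mean value theorem and [ray_uniform]. *)
Lemma radial_is_derive m f i x : smooth_on W f -> W x ->
  is_derive x (delta_mx 0 i : V) (radial m f) (radial m.+1 (partial i f) x).
Proof.
move=> sf Wx; set ei : V := delta_mx 0 i; apply/is_derive_epsP => e e0.
have cf y (Wy : W y) := smooth_continuous sf Wy.
have cdf y (Wy : W y) := smooth_continuous (smooth_partial i sf) Wy.
have [d d0 Hd] := ray_uniform cdf Wx e0.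
have K0 : 0 < 1 + `|ei| by rewrite ltr_wpDr.
exists (d / (1 + `|ei|)) => [|h]; first by rewrite divr_gt0.
rewrite ltr_pdivlMr // mulrDr mulr1 => hd.
have near (s : R) : `|s| <= `|h| -> `|(s *: ei + x) - x| < d.
  move=> sh; rewrite addrK normrZ; apply: le_lt_trans hd.
  by rewrite -[X in X <= _]add0r lerD // ler_wpM2r.
have Wh : W (h *: ei + x) by have [] := Hd _ (near h (lexx _)).
have c1 := radial_integrand_continuous (m := m) cf Wh.
have c2 := radial_integrand_continuous (m := m) cf Wx.
have c3 := radial_integrand_continuous (m := m.+1) cdf Wx.
pose g (t : R) := -h * (t ^+ m.+1 * partial i f (t *: (x - o) + o)) +
  (-1 * (t ^+ m * f (t *: (x - o) + o)) + t ^+ m * f (t *: (h *: ei + x - o) + o)).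
have lc (a : R) (u v : R -> R) : {within `[0, 1], continuous u} ->
    {within `[0, 1], continuous v} ->
    {within `[0, 1], continuous (fun t => a * u t + v t)}.
  by move=> cu cv t; apply: continuousD (cv t); apply: continuousM (cu t);
    exact: cst_continuous.
have -> : radial m f (h *: ei + x) - radial m f x - h * radial m.+1 (partial i f) x =
    unit_integral g.
  rewrite unit_integral_lin //; last exact: lc.
  rewrite unit_integral_lin // /radial mulN1r mulNr; ring.
apply: unit_integral_le; first exact: (lc _ _ _ c3 (lc _ _ _ c2 c1)).
move=> t t01; have /andP[t0 t1] := t01.
have E (s : R) : t *: (s *: ei + x - o) + o = (t * s) *: ei + (t *: (x - o) + o).
  by rewrite -addrA scalerDr scalerA addrA.
have [|s sh Es] := @mvt_line _ _ f (t *: (x - o) + o) ei (t * h).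
  move=> s sh; apply: (smooth_derivable i sf).
  have [t00|tn0] := eqVneq t 0.
    move: sh; rewrite t00 mul0r normr0 normr_le0 => /eqP ->.
    by rewrite scale0r add0r; apply: starW => //; rewrite lexx ler01.
  have -> : s = t * (s / t) by rewrite mulrC divfK.
  rewrite -E; apply: starW => //; have [] // := Hd (s / t *: ei + x) _.
  apply: near; rewrite normrM normfV ler_pdivrMr ?normr_gt0 //.
  by move: sh; rewrite normrM mulrC.
(* Writing s = t s' places the intermediate point on the ray to s' e_i + x, which is where
   [ray_uniform] applies. At t = 0 the bound forces s = 0. *)
have [s' sh' Es'] : exists2 s' : R, `|s'| <= `|h| & s = t * s'.
  have [t00|tn0] := eqVneq t 0.
    exists 0; first by rewrite normr0.
    by move: sh; rewrite t00 mul0r normr0 normr_le0 => /eqP ->; rewrite mul0r.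
  exists (s / t); last by rewrite mulrC divfK.
  by rewrite normrM normfV ler_pdivrMr ?normr_gt0 // [`|h| * _]mulrC -normrM.
have -> : g t = h * (t ^+ m.+1 * (partial i f (t *: (s' *: ei + x - o) + o) -
    partial i f (t *: (x - o) + o))).
  rewrite /g (E h) (E s') -Es'.
  have -> : f ((t * h) *: ei + (t *: (x - o) + o)) =
     f (t *: (x - o) + o) + t * h * partial i f (s *: ei + (t *: (x - o) + o)).
    by apply/eqP; rewrite [X in _ == X]addrC -subr_eq; apply/eqP; exact: Es.
  rewrite exprS; ring.
have [_ /(_ t t01) {}Hd] := Hd _ (near s' sh').
rewrite normrM mulrC ler_wpM2r // normrM -[e]mul1r.
by apply: ler_pM => //; rewrite normrX ger0_norm // exprn_ile1.
Qed.

Lemma partial_radial m f i x : smooth_on W f -> W x ->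
  partial i (radial m f) x = radial m.+1 (partial i f) x.
Proof. by move=> sf Wx; have [] := radial_is_derive m i sf Wx. Qed.

Lemma smooth_radial m f : smooth_on W f -> smooth_on W (radial m f).
Proof.
move=> sf; pose P g := exists m f, smooth_on W f /\ g = radial m f.
apply: (@smooth_coind _ _ P) => //; last by exists m, f.
move=> _ [{sf}n [g [sg ->]]]; split=> [x Wx|i].
  by apply: radial_continuous => // y; exact: smooth_continuous.
split=> [x Wx|]; first by have [] := radial_is_derive n i sg Wx.
exists (radial n.+1 (partial i g)); last by move=> x Wx; rewrite partial_radial.
by exists n.+1, (partial i g); split=> //; exact: smooth_partial.
Qed.

Lemma radial_eq m f g x : (forall y, W y -> f y = g y) -> W x ->
  radial m f x = radial m g x.
Proof.
move=> fg Wx; apply: eq_unit_integral => t t01; congr (_ * _); apply: fg; exact: starW.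
Qed.

Lemma radial_lin m (a : R) f g x : smooth_on W f -> smooth_on W g -> W x ->
  radial m (fun y => a * f y + g y) x = a * radial m f x + radial m g x.
Proof.
move=> sf sg Wx; rewrite /radial -unit_integral_lin.
- by apply: eq_unit_integral => t _; ring.
- by apply: radial_integrand_continuous => // y; exact: smooth_continuous.
- by apply: radial_integrand_continuous => // y; exact: smooth_continuous.
Qed.

Lemma ray_is_derive f x (t : R) : smooth_on W f -> W x -> 0 <= t <= 1 ->
  is_derive t (1 : R) (fun s : R => f (s *: (x - o) + o))
   (\sum_i (x 0 i - o 0 i) * partial i f (t *: (x - o) + o)).
Proof.
move=> sf Wx t01; have Wt := starW Wx t01.
have [d1 d2] := smooth_derive oW (x - o) sf Wt.
have := line_is_derive d1; rewrite d2.
by under eq_bigr do rewrite !mxE.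
Qed.

Lemma sum_radial_continuous f x : smooth_on W f -> W x ->
  {within `[0, 1], continuous (fun t : R =>
    \sum_i (x 0 i - o 0 i) * partial i f (t *: (x - o) + o))}.
Proof.
move=> sf Wx; apply: within_continuous_sum => i.
apply: within_continuous => s s01; apply: ray_continuous => // y.
by apply: smooth_continuous; exact: smooth_partial.
Qed.

Lemma unit_integral_sum (I : Type) (r : seq I) (a : I -> R) (F : I -> R -> R) :
  (forall k : I, {within `[0, 1], continuous (F k)}) ->
  unit_integral (fun t => \sum_(k <- r) a k * F k t) =
  \sum_(k <- r) a k * unit_integral (F k).
Proof.
move=> cF; elim: r => [|i r IHr].
  under eq_fun do rewrite big_nil; rewrite big_nil.
  rewrite (unit_integral_FTC (G := fun=> 0)) ?subrr //.
  by move=> t; exact: cst_continuous.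
rewrite (_ : (fun _ => _) = fun t => a i * F i t + \sum_(j <- r) a j * F j t).
  rewrite unit_integral_lin // ?IHr ?big_cons //; exact: within_continuous_sum.
by apply/funext => t; rewrite big_cons.
Qed.

(** The fundamental theorem of calculus along the ray from o to x. *)
Lemma hadamard f x : smooth_on W f -> W x ->
  f x = f o + \sum_i (x 0 i - o 0 i) * radial 0 (partial i f) x.
Proof.
move=> sf Wx; have := unit_integral_FTC (sum_radial_continuous sf Wx)
  (fun t t01 => ray_is_derive sf Wx t01).
rewrite scale1r subrK scale0r add0r => E.
rewrite -[f x](subrK (f o)) -E addrC; congr (_ + _).
rewrite unit_integral_sum => [|i].
  by apply: eq_bigr => i _; congr (_ * _); apply: eq_unit_integral => t _;
    rewrite expr0 mul1r.
apply: within_continuous => s s01; apply: ray_continuous => // y.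
by apply: smooth_continuous; exact: smooth_partial.
Qed.

(** Integrate the derivative of t^(m + 1) f(o + t (x - o)) over [0, 1]; the boundary term at 0
    vanishes because the exponent is positive. *)
Lemma radial_euler m f x : smooth_on W f -> W x ->
  \sum_i (x 0 i - o 0 i) * partial i (radial m f) x + m.+1%:R * radial m f x = f x.
Proof.
move=> sf Wx; under eq_bigr do rewrite partial_radial //.
have cf y (Wy : W y) := smooth_continuous sf Wy.
have cdf i y (Wy : W y) := smooth_continuous (smooth_partial i sf) Wy.
pose G (t : R) := t ^+ m.+1 * f (t *: (x - o) + o).
pose g (t : R) := m.+1%:R * (t ^+ m * f (t *: (x - o) + o)) +
  \sum_i (x 0 i - o 0 i) * (t ^+ m.+1 * partial i f (t *: (x - o) + o)).
have c1 := radial_integrand_continuous (m := m) cf Wx.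
have c2 i := radial_integrand_continuous (m := m.+1) (cdf i) Wx.
have c3 : {within `[0, 1], continuous (fun t : R =>
    \sum_i (x 0 i - o 0 i) * (t ^+ m.+1 * partial i f (t *: (x - o) + o)))}.
  exact: within_continuous_sum.
have cg : {within `[0, 1], continuous g}.
  by move=> t; apply: continuousD (c3 t); apply: continuousM (c1 t);
    exact: cst_continuous.
have derG (t : R) : 0 <= t <= 1 -> is_derive t (1 : R) G (g t).
  move=> t01; have H := ray_is_derive sf Wx t01.
  have HX : is_derive t (1 : R) (fun s : R => s ^+ m.+1) (m.+1%:R * t ^+ m).
    have -> : (fun s : R => s ^+ m.+1) = (id : R -> R) ^+ m.+1.
      by apply/funext => s; rewrite exprfctE.
    by apply: is_derive_eq; rewrite scaler1.
  apply: (is_derive_eq (is_deriveM HX H)).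
  rewrite /g addrC /GRing.scale /= mulr_sumr; congr (_ + _); first by ring.
  by apply: eq_bigr => i _; ring.
have <- : unit_integral g = f x.
  by rewrite (unit_integral_FTC cg derG) /G expr1n mul1r scale1r subrK expr0n mul0r subr0.
rewrite unit_integral_lin // unit_integral_sum // addrC.
by [].
Qed.

End Radial.
End RadialIntegral.

(** * Coefficients in the Grassmann algebra *)

Section CoefsAlgebra.
Import mathcomp.boot.finset.
Local Close Scope classical_set_scope.
Variables (R : realType) (p q : nat).
Local Notation V := 'rV[R]_p.
Implicit Types (F G : coefs R p q) (I J K : {set 'I_q}) (j : 'I_q) (x : V).

(** The number of factors that theta_j crosses when it is sorted into theta^I from the left; [above]
    counts those crossed from the right. The signs of the Grassmann algebra are expressed through
    these two. *)
Definition below j I : nat := #|[set l in I | (l < j)%N]|.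
Definition above j I : nat := #|[set l in I | (j < l)%N]|.

Lemma partialZ (W : set V) (f : V -> R) i (a : R) x : open W -> smooth_on W f -> W x ->
  partial i (fun y => a * f y) x = a * partial i f x.
Proof.
move=> oW sf Wx; rewrite -[RHS]addr0 -(partial_cst i 0 x).
rewrite -(partial_lin _ _ sf (smooth_cst oW 0) Wx).
by apply: (partial_eq oW) => // y _; rewrite addr0.
Qed.

Lemma signr_cases (n : nat) : (-1) ^+ n = 1 :> R \/ (-1) ^+ n = -1 :> R.
Proof. by rewrite -signr_odd; case: odd; [right|left]. Qed.

Lemma cards_filter_sum I (P : pred 'I_q) : #|[set l in I | P l]| = (\sum_(l in I) P l)%N.
Proof.
rewrite -sum1_card big_mkcond [RHS]big_mkcond /=.
by apply: eq_bigr => l _; rewrite inE; case: (l \in I); case: (P l).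
Qed.

Lemma inversionsE I J : inversions I J = (\sum_(i in I) \sum_(j in J) (j < i))%N.
Proof.
rewrite /inversions -sum1_card pair_big big_mkcond [RHS]big_mkcond /=.
apply: eq_bigr => -[a b] _; rewrite (_ : (_ \in _) = [&& a \in I, b \in J & (b < a)%N]).
  by case: (a \in I); case: (b \in J); case: ltnP.
by apply/idP/idP; rewrite in_setE.
Qed.

Lemma inversions0l J : inversions set0 J = 0%N.
Proof. by rewrite inversionsE big_set0. Qed.

Lemma inversionsU1l j I J : j \notin I ->
  inversions (j |: I) J = (below j J + inversions I J)%N.
Proof. by move=> jI; rewrite !inversionsE big_setU1 //= /below cards_filter_sum. Qed.

Lemma inversionsU1r j I J : j \notin J ->
  inversions I (j |: J) = (above j I + inversions I J)%N.
Proof.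
move=> jJ; rewrite !inversionsE /above cards_filter_sum -big_split /=.
by apply: eq_bigr => i _; rewrite big_setU1.
Qed.

Lemma belowU1 i j I : i \notin I -> below j (i |: I) = ((i < j) + below j I)%N.
Proof. by move=> iI; rewrite /below !cards_filter_sum big_setU1. Qed.

Lemma below_above j I : j \notin I -> (below j I + above j I)%N = #|I|.
Proof.
move=> jI; rewrite /below /above !cards_filter_sum -big_split /= -sum1_card.
apply: eq_bigr => i iI; case: ltngtP => // ij.
by rewrite -(ord_inj ij) iI in jI.
Qed.

Lemma below_disjointU j I J : [disjoint I & J] ->
  below j (I :|: J) = (below j I + below j J)%N.
Proof.
move=> dIJ; rewrite /below !cards_filter_sum.
by rewrite (eq_bigl _ _ (fun l => in_setU l I J)) bigU.
Qed.

Lemma big_subsetU1 (T : {set 'I_q} -> R) j K : j \notin K ->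
  \sum_(I : {set 'I_q} | I \subset j |: K) T I =
  \sum_(I : {set 'I_q} | I \subset K) T (j |: I) + \sum_(I : {set 'I_q} | I \subset K) T
    I.
Proof.
move=> jK; rewrite (bigID (fun I : {set 'I_q} => j \in I)) /=; congr (_ + _).
  rewrite (reindex_onto (fun I => j |: I) (fun I => I :\ j)) /=; last first.
    by move=> I /andP[_ jI]; rewrite setD1K.
  apply: eq_bigl => I; rewrite setU11 andbT.
  apply/andP/idP => [[IK /eqP <-]|IK].
    by rewrite subDset.
  split; first exact: setUS.
  rewrite setU1K //; apply: contra jK; exact: (fintype.subsetP IK).
apply: eq_bigl => I; apply/andP/idP => [[IK jI]|IK].
  by apply/fintype.subsetP => l lI; have := fintype.subsetP IK l lI; rewrite !inE =>
    /predU1P[lj|//]; rewrite -lj lI in jI.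
split; first by apply: fintype.subset_trans IK _; exact: subsetUr.
by apply: contra jK; exact: (fintype.subsetP IK).
Qed.

(** The Koszul sign of an operator of parity b moving past the section F. *)
Definition twist_coefs (b : bool) F : coefs R p q :=
  fun I x => (-1) ^+ (b && odd #|I|) * F I x.

Lemma setU1D j I K : j \notin K -> I \subset K -> (j |: K) :\: (j |: I) = K :\: I.
Proof.
move=> jK IK; apply/setP => l; rewrite !inE; case: eqVneq => //= ->.
by rewrite (negbTE jK) andbF.
Qed.

Lemma setU1D' j I K : j \notin K -> I \subset K -> (j |: K) :\: I = j |: (K :\: I).
Proof.
move=> jK IK; apply/setP => l; rewrite !inE; case: eqVneq => //= ->.
by rewrite andbT; apply: contra jK; exact: (fintype.subsetP IK).
Qed.

(** If j lies in K the left side is 0, and on the right the subsets I without j in the first sum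
    cancel against those with j in the second. If not, the subsets of [j |: K] with and without j
    give the two sums on the right. [below_above] and the additivity of [below] reconcile the
    signs. *)
Lemma coefs_partial_mul_odd j F G K x :
  coefs_partial (inr j) (coefs_mul F G) K x =
  coefs_mul (coefs_partial (inr j) F) G K x +
  coefs_mul (twist_coefs true F) (coefs_partial (inr j) G) K x.
Proof.
have D K' I : j \notin K' -> I \subset K' -> j \notin I /\ j \notin K' :\: I.
  move=> jK IK; split; first by apply: contra jK; exact: (fintype.subsetP IK).
  by rewrite inE negb_and jK orbT.
have [jK|jK] := boolP (j \in K); rewrite /coefs_mul /=.
  rewrite jK -(setD1K jK); set K' := K :\ j.
  have jK' : j \notin K' by rewrite !inE eqxx.
  rewrite !big_subsetU1 // -!big_split /= big1 // => I IK.
  have [jI jD] := D K' I jK' IK.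
  rewrite !setU1D // !setU1D' // setU11 (negbTE jI) (negbTE jD) setU11.
  rewrite inversionsU1l // inversionsU1r // -!/(below _ _) /twist_coefs /= cardsU1 jI /=.
  rewrite -/(above _ _) signrN -(below_above jI) signr_odd !exprD.
  move: (F _ _) (G _ _) ((-1) ^+ inversions _ _) => u v w.
  have [->|->] := signr_cases (below j I); have [->|->] := signr_cases (above j I);
  have [->|->] := signr_cases (below j (K' :\: I)); ring.
rewrite (negbTE jK) big_subsetU1 // mulrDr !mulr_sumr -!big_split /=.
apply: eq_bigr => I IK; have [jI jD] := D K I jK IK.
rewrite !setU1D // !setU1D' // (negbTE jI) (negbTE jD).
rewrite inversionsU1l // inversionsU1r // -!/(below _ _) /twist_coefs /=.
have -> : below j K = (below j I + below j (K :\: I))%N.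
  rewrite -below_disjointU; last by rewrite -setI_eq0 setIDA setIC -setIDA setDv setI0.
  congr (below j _); apply/setP => l; rewrite !inE; have [lI|] //= := boolP (l \in I).
  exact: (fintype.subsetP IK).
rewrite signr_odd -(below_above jI) !exprD.
move: (F _ _) (G _ _) (F _ _) (G _ _) ((-1) ^+ inversions _ _) => u v u' v' w.
have [->|->] := signr_cases (below j I); have [->|->] := signr_cases (above j I);
have [->|->] := signr_cases (below j (K :\: I)); ring.
Qed.

Lemma coefs_partialC_odd i j F K x :
  coefs_partial (inr i) (coefs_partial (inr j) F) K x =
  - coefs_partial (inr j) (coefs_partial (inr i) F) K x.
Proof.
rewrite /= -!/(below _ _) !in_setU1.
have [->|ij] := eqVneq i j; first by rewrite /=; case: ifP; rewrite ?mulr0 oppr0.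
rewrite /=.
case: (boolP (i \in K)) => iK; case: (boolP (j \in K)) => jK; rewrite ?mulr0 ?oppr0 //.
rewrite !belowU1 // setUCA !exprD.
case: ltngtP => h /=; [ring | ring | ].
by rewrite (ord_inj h) eqxx in ij.
Qed.

(** The coordinates centred at o. A point has no odd components, so only the even ones are
    shifted. *)
Definition coefs_coord (o : V) (a : coord p q) : coefs R p q := fun I x =>
  match a with
  | inl i => (I == set0)%:R * (x 0 i - o 0 i)
  | inr j => (I == [set j])%:R
  end.

Lemma coefs_mul_coord_even o i G K x :
  coefs_mul (coefs_coord o (inl i)) G K x = (x 0 i - o 0 i) * G K x.
Proof.
rewrite /coefs_mul (bigD1 set0) ?sub0set //= big1 => [|I /andP[_ /negbTE ->]].
  by rewrite inversions0l expr0 eqxx setD0 !mul1r addr0.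
by rewrite mul0r mulr0 mul0r.
Qed.

Lemma coefs_mul_coord_odd o j G K x :
  coefs_mul (coefs_coord o (inr j)) G K x =
  if j \in K then (-1) ^+ below j (K :\ j) * G (K :\ j) x else 0.
Proof.
rewrite /coefs_mul; case: ifP => jK; last first.
  rewrite big1 // => I IK /=; case: eqVneq => [E|]; last by rewrite mulr0 mul0r.
  by move: IK; rewrite E sub1set jK.
rewrite (bigD1 [set j]) ?sub1set //= big1 => [|I /andP[_ /negbTE ->]].
  rewrite addr0 eqxx mulr1 -[X in inversions X _]setU0.
  by rewrite inversionsU1l ?inE // inversions0l addn0.
by rewrite mulr0 mul0r.
Qed.

Lemma coefs_partial_odd_coord o j a K x :
  coefs_partial (inr j) (coefs_coord o a) K x = (inr j == a)%:R * coefs_one K x.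
Proof.
rewrite /= /coefs_one -/(below _ _); case: a => [i|l] /=.
  rewrite mul0r; case: ifP => // jK.
  rewrite (_ : (j |: K == set0) = false) ?mul0r ?mulr0 //.
  by apply/negbTE/set0Pn; exists j; rewrite setU11.
rewrite (inj_eq inr_inj).
case: ifP => jK; last first.
  have -> : (j |: K == [set l]) = (j == l) && (K == set0).
    apply/eqP/andP => [E|[/eqP <- /eqP ->]]; last by rewrite setU0.
    have : j \in [set l] by rewrite -E setU11.
    rewrite inE => /eqP jl; split; first by rewrite jl.
    by rewrite -(setU1K (negbT jK)) E jl setDv.
  case: eqVneq => //= _; rewrite ?mul0r ?mulr0 // mul1r.
  case: eqVneq => //= [->|]; last by rewrite mulr0.
  rewrite mulr1 (_ : below j _ = 0%N) ?expr0 //.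
  by rewrite /below cards_filter_sum big_set0.
by rewrite (_ : (K == set0) = false) ?mulr0 //; apply/negbTE/set0Pn; exists j.
Qed.

Definition smooth_coefs (W : set V) F := forall I, smooth_on W (F I).

Section OnOpen.
Variable W : set V.
Hypothesis oW : open W.

Lemma coefs_partial_smooth a F : smooth_coefs W F -> smooth_coefs W (coefs_partial a F).
Proof.
move=> sF I; case: a => [i|j]; first exact: smooth_partial.
rewrite /coefs_partial; case: (j \in I); first exact: smooth_cst.
by apply: smoothZ.
Qed.

Lemma coefs_partial_eq a F G : (forall I x, W x -> F I x = G I x) ->
  forall I x, W x -> coefs_partial a F I x = coefs_partial a G I x.
Proof.
move=> FG I x Wx; case: a => [i|j] /=; last by rewrite FG.
by apply: (partial_eq oW) => // y; exact: FG.
Qed.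

Lemma coefs_partial_lin a (c : R) F G : smooth_coefs W F -> smooth_coefs W G ->
  forall I x, W x ->
  coefs_partial a (fun I x => c * F I x + G I x) I x =
  c * coefs_partial a F I x + coefs_partial a G I x.
Proof.
move=> sF sG I x Wx; case: a => [i|j] /=; first exact: (partial_lin i c (sF I) (sG I) Wx).
by case: ifP => _; rewrite ?mulr0 ?addr0 // mulrDr mulrCA.
Qed.

Lemma coefs_coord_smooth o a : smooth_coefs W (coefs_coord o a).
Proof.
by case: a => [i|j] I; [apply: smoothZ => //; exact: smooth_coord | exact: smooth_cst].
Qed.

Lemma coefs_partial_mul a F G : smooth_coefs W F -> smooth_coefs W G ->
  forall K x, W x ->
  coefs_partial a (coefs_mul F G) K x =
  coefs_mul (coefs_partial a F) G K x +
  coefs_mul (twist_coefs (cpar a) F) (coefs_partial a G) K x.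
Proof.
move=> sF sG K x Wx; case: a => [i|j]; last exact: coefs_partial_mul_odd.
rewrite /= -/(partial i _ x) [coefs_mul F G K]/(coefs_mul _ _ _) /coefs_mul.
rewrite (partial_sum oW) //; last by move=> I _; apply: smoothM => //; exact: smoothZ.
rewrite -big_split /=; apply: eq_bigr => I _.
rewrite (partialM (W := W)) //; last exact: smoothZ.
have -> : partial i (fun x => (-1) ^+ inversions I (K :\: I) * F I x) x =
    (-1) ^+ inversions I (K :\: I) * partial i (F I) x.
  exact: (partialZ _ _ oW).
by rewrite /twist_coefs /= expr0 mul1r.
Qed.

Lemma coefs_partialC a b F : smooth_coefs W F -> forall K x, W x ->
  coefs_partial a (coefs_partial b F) K x =
  (-1) ^+ (cpar a && cpar b) * coefs_partial b (coefs_partial a F) K x.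
Proof.
move=> sF K x Wx.
have C i j : coefs_partial (inl i) (coefs_partial (inr j) F) K x =
    coefs_partial (inr j) (coefs_partial (inl i) F) K x.
  rewrite /coefs_partial; case: (j \in K); first exact: derive_cst.
  exact: (partialZ _ _ oW).
case: a b => [i|i] [j|j].
- by rewrite expr0 mul1r; exact: (schwarz _ _ oW).
- by rewrite expr0 mul1r C.
- by rewrite expr0 mul1r C.
- by rewrite expr1 mulN1r; exact: coefs_partialC_odd.
Qed.

Lemma coefs_partial_one a K x : W x -> coefs_partial a (@coefs_one R p q) K x = 0 :> R.
Proof.
move=> Wx; case: a => [i|j] /=; first exact: partial_cst.
case: ifP => // jK; rewrite /coefs_one (_ : (j |: K == set0) = false) ?mulr0 //.
by apply/negbTE/set0Pn; exists j; rewrite setU11.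
Qed.

Lemma coefs_partial_coord o a b K x : W x ->
  coefs_partial a (coefs_coord o b) K x = (a == b)%:R * coefs_one K x.
Proof.
move=> Wx; case: a => [i|j]; last exact: coefs_partial_odd_coord.
case: b => [l|l]; last by rewrite mul0r; exact: partial_cst.
rewrite (inj_eq inl_inj) /= -/(partial _ _ _) /coefs_one.
rewrite -(partial_coord i l (o 0 l) x) mulrC.
exact: (partialZ _ _ oW (smooth_coord oW l (o 0 l)) Wx).
Qed.

(** Each theta_j d/dtheta_j multiplies theta^K by 1 or 0 according to whether j lies in K; the two
    sorting signs are equal and cancel. *)
Lemma coefs_odd_euler o F K x :
  \sum_(j : 'I_q) coefs_mul (coefs_coord o (inr j)) (coefs_partial (inr j) F) K x =
  #|K|%:R * F K x.
Proof.
rewrite -sum1_card natr_sum mulr_suml [RHS]big_mkcond /=; apply: eq_bigr => j _.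
rewrite coefs_mul_coord_odd; case: ifP => // jK.
rewrite /= !inE eqxx /= -/(below _ _) setD1K // mulrA -expr2 sqrr_sign.
by [].
Qed.

Section Radial.
Variable o : V.
Hypothesis starW : forall x (t : R), W x -> 0 <= t <= 1 -> W (t *: (x - o) + o).

Lemma radial0 m x : radial o m (fun=> 0) x = 0.
Proof.
rewrite /radial (eq_unit_integral (h := fun=> 0)) => [|t _]; last by rewrite mulr0.
rewrite (unit_integral_FTC (G := fun=> 0)) ?subrr //.
by move=> t; exact: cst_continuous.
Qed.

Lemma radialZ m (a : R) (f : V -> R) x : smooth_on W f -> W x ->
  radial o m (fun y => a * f y) x = a * radial o m f x.
Proof.
move=> sf Wx; rewrite -[RHS]addr0 -(radial0 m x).
rewrite -(radial_lin starW _ _ sf (smooth_cst oW 0) Wx).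
by apply: (radial_eq starW) => // y _; rewrite addr0.
Qed.

(* For the coefficient of [theta^K] in a (k + 1)-form, whose weight under the
   Euler field is [#|K| + k + 1]. *)
Definition coefs_radial (k : nat) F : coefs R p q :=
  fun K => radial o (#|K| + k) (F K).

Lemma coefs_radial_smooth k F : smooth_coefs W F -> smooth_coefs W (coefs_radial k F).
Proof. by move=> sF K; exact: smooth_radial. Qed.

(** An even derivative costs a factor t by the chain rule; an odd one moves the coefficient of
    [j |: K], whose exponent is larger by one, to K. Either way the exponent at K becomes |K| + k +
    1, which is why the radial operator commutes with d up to the shift of k. *)
Lemma coefs_partial_radial a k F : smooth_coefs W F -> forall K x, W x ->
  coefs_partial a (coefs_radial k F) K x = coefs_radial k.+1 (coefs_partial a F) K x.
Proof.
move=> sF K x Wx; case: a => [i|j]; rewrite /coefs_radial /coefs_partial.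
  by rewrite addnS; exact: (partial_radial oW starW).
case: (boolP (j \in K)) => jK.
  by rewrite radial0.
rewrite cardsU1 jK add1n addSnnS.
exact/esym/radialZ.
Qed.

Lemma coefs_radial_euler k F : smooth_coefs W F -> forall K x, W x ->
  \sum_a coefs_mul (coefs_coord o a) (coefs_partial a (coefs_radial k F)) K x +
  k.+1%:R * coefs_radial k F K x = F K x.
Proof.
move=> sF K x Wx; rewrite big_sumType /= coefs_odd_euler.
under eq_bigr do rewrite coefs_mul_coord_even.
rewrite -addrA -mulrDl -natrD addnS.
exact: (radial_euler oW starW).
Qed.

End Radial.
End OnOpen.
End CoefsAlgebra.

(** * Charts *)

Section Twist.
Variables (R : realType) (X : topologicalType) (F : superpsh R X).
Implicit Types (U V : opens X).

Fact twist_key : unit. Proof. by []. Qed.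

(** For b true this is the parity automorphism, otherwise the identity. It expresses Koszul signs
    for sections that need not be homogeneous. The lock keeps simplification from exposing the two
    components. *)
Definition twist (b : bool) U (s : F U) : F U :=
  locked_with twist_key (hpart F false s + ksign R b *: hpart F true s).

Lemma twistE b U (s : F U) : twist b s = hpart F false s + ksign R b *: hpart F true s.
Proof. by rewrite /twist unlock. Qed.

Lemma twist_linear b U : linear (@twist b U).
Proof.
by move=> a s t; rewrite !twistE !linearP /= !scalerDr !scalerA addrACA.
Qed.

HB.instance Definition _ b U :=
  GRing.isLinear.Build R (F U) (F U) *:%R (@twist b U) (@twist_linear b U).

Lemma twistD b U (s t : F U) : twist b (s + t) = twist b s + twist b t.
Proof. exact: linearD. Qed.

Lemma twistZ b U (a : R) (s : F U) : twist b (a *: s) = a *: twist b s.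
Proof. exact: linearZ. Qed.


Lemma homog_hpart_eq b c U (s : F U) : homog c s -> hpart F b s = if b == c then s else 0.
Proof. by move=> hs; rewrite -[in LHS]hs hpart_hpart hs. Qed.

Lemma hpart_is_homog b U (s : F U) : homog b (hpart F b s).
Proof. by rewrite /homog hpart_hpart eqxx. Qed.

Lemma twist_homog b c U (s : F U) : homog c s -> twist b s = ksign R (b && c) *: s.
Proof.
move=> hs; rewrite twistE !(homog_hpart_eq _ hs).
by case: c hs; case: b => hs /=; rewrite /ksign ?scaler0 ?add0r ?addr0 // ?expr0 ?scale1r.
Qed.

Lemma homog_ind U (P : F U -> Prop) (s : F U) :
  (forall s t, P s -> P t -> P (s + t)) -> (forall b s, homog b s -> P s) -> P s.
Proof. by move=> PD Ph; rewrite -(hpart_sum s); apply: PD; apply: Ph;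
  exact: hpart_is_homog. Qed.

Lemma homogD b U (s t : F U) : homog b s -> homog b t -> homog b (s + t).
Proof. by rewrite /homog linearD => -> ->. Qed.

Lemma homogZ b U (a : R) (s : F U) : homog b s -> homog b (a *: s).
Proof. by rewrite /homog linearZ /= => ->. Qed.

Lemma homog0 b U : homog b (0 : F U).
Proof. by rewrite /homog linear0. Qed.

Lemma homog_sum b U (I : Type) (r : seq I) (P : pred I) (s : I -> F U) :
  (forall i, P i -> homog b (s i)) -> homog b (\sum_(i <- r | P i) s i).
Proof. by move=> h; rewrite /homog linear_sum; apply: eq_bigr => i /h. Qed.

Lemma homog_res b U V (h : V `<=` U) (s : F U) : homog b s -> homog b (res F h s).
Proof. by rewrite /homog hpart_res => ->. Qed.

Lemma twistM b c U (s : F U) : twist b (twist c s) = twist (b (+) c) s.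
Proof.
apply: (homog_ind (P := fun s => twist b (twist c s) = twist (b (+) c) s)).
  by move=> s1 t1 E1 E2; rewrite (twistD c) (twistD b) (twistD _ s1) E1 E2.
move=> d t ht; rewrite !(twist_homog _ ht) twistZ (twist_homog _ ht) scalerA.
by rewrite ksignM; congr (ksign _ _ *: _); case: b; case: c; case: d {ht}.
Qed.

Lemma twist0 U (s : F U) : twist false s = s.
Proof. by rewrite twistE /ksign scale1r hpart_sum. Qed.

Lemma twistK b U (s : F U) : twist b (twist b s) = s.
Proof. by rewrite twistM addbb twist0. Qed.

Lemma twist_res b U V (h : V `<=` U) (s : F U) : twist b (res F h s) = res F h
  (twist b s).
Proof. by rewrite !twistE !hpart_res linearD linearZ. Qed.

Lemma twist_homogP b c U (s : F U) : homog c s -> homog c (twist b s).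
Proof. by move=> hs; rewrite (twist_homog _ hs); exact: homogZ. Qed.

End Twist.

(** Converts the right-hand coefficients of [dR_coord] into left-hand ones, with which all the later
    computations are done. *)
Lemma ract_homog (R : realType) (M : superspace R) (E : smodule M) (U : opens M)
    c (s : E U) (f : sO M U) : homog c s -> ract s f = sact (twist c f) s.
Proof.
move=> hs; rewrite /ract.
have B (T : zmodType) (G : bool -> T) : \sum_b G b = G false + G true.
  by rewrite big_bool addrC.
rewrite !B !(homog_hpart_eq _ hs) twistE sactDl sactZl.
by case: c hs => hs /=; rewrite !sact0r !scaler0 ?add0r ?addr0 /ksign !expr0 ?scale1r.
Qed.

(** * Separation in a sheaf and intersections of opens *)

Section SheafTheory.
Variables (R : realType) (X : topologicalType).

Lemma res_irr (F : presheaf R X) (U V : opens X) (h h' : V `<=` U) (s : F U) :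
  res F h s = res F h' s.
Proof. by congr (res F _ s); exact: Prop_irrelevance. Qed.

Lemma sheaf_sep (F : presheaf R X) (U : opens X) (s t : F U) : is_sheaf F ->
  (forall x, U x -> exists (V : opens X) (h : V `<=` U), V x /\ res F h s = res F h t) ->
  s = t.
Proof.
move=> [sep _] H; pose I := points U.
have H' (i : I) : { Vh : {V : opens X | V `<=` U} |
     sval Vh (sval i) /\ res F (svalP Vh) s = res F (svalP Vh) t}.
  apply: cid; have [V [h [Vx E]]] := H _ (svalP i).
  exists (exist (fun V : opens X => V `<=` U) V h); split; first exact: Vx.
  exact: (etrans (@res_irr F U V _ h s) (etrans E (@res_irr F U V h _ t))).
apply: (sep U I (fun i => sval (sval (H' i))) (fun i => svalP (sval (H' i)))).
- by move=> x Ux; exists (exist _ x Ux); have [] := svalP (H' (exist _ x Ux)).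
- by move=> i; have [] := svalP (H' i).
Qed.

Definition cap_open (U V : opens X) : opens X :=
  Opens (openI (open_oset U) (open_oset V)).

Lemma cap_openl (U V : opens X) : cap_open U V `<=` U. Proof. by move=> x []. Qed.
Lemma cap_openr (U V : opens X) : cap_open U V `<=` V. Proof. by move=> x []. Qed.
Lemma cap_openS (U U' V : opens X) : U' `<=` U -> cap_open U' V `<=` cap_open U V.
Proof. by move=> h x [/h]. Qed.

End SheafTheory.

Section Charts.
Variables (R : realType) (M : superspace R) (p q : nat).
Implicit Types (c : chart M p q) (V W : opens M).

Lemma chart_image_open c V : V `<=` cdom c -> open (cmap c @` V).
Proof.
move=> h; rewrite openE => _ [x Vx <-]; rewrite /interior.
have [cx ix] := cmapK (h x Vx).
have n1 : \forall y \near cmap c x, ccod c y.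
  by apply: open_nbhs_nbhs; split=> //; exact: open_oset.
have n2 : \forall y \near cmap c x, V (cinv c y).
  have ci := cinv_continuous cx; apply: ci; rewrite ix.
  by apply: open_nbhs_nbhs; split=> //; exact: open_oset.
apply: filterS2 n1 n2 => y cy Vy.
by exists (cinv c y) => //; have [] := cinvK cy.
Qed.

Lemma chart_preimage_open c (B : set 'rV[R]_p) : open B ->
  open [set x | cdom c x /\ B (cmap c x)].
Proof.
move=> oB; rewrite openE => x [cx Bx]; rewrite /interior.
have n1 : \forall y \near x, cdom c y.
  by apply: open_nbhs_nbhs; split=> //; exact: open_oset.
have n2 : \forall y \near x, B (cmap c y).
  by apply: (cmap_continuous cx); exact: open_nbhs_nbhs.
exact: filterI n1 n2.
Qed.

(** [dR_coord] describes d only on the full domain of a chart, so computing d over a smaller V needs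
    a chart whose domain is V. The definition is transparent because the domain of the restricted
    chart has to reduce to V. *)
Definition chart_restrict c V (h : V `<=` cdom c) : chart M p q.
Proof.
pose T (W : opens M) (hW : W `<=` V) : W `<=` cdom c := subset_trans hW h.
refine (@Chart R M p q V (Opens (chart_image_open h)) (cmap c) (cinv c) _ _ _ _
  (fun W hW => chcoef (T W hW)) _ _ _ _ _ _ _ _).
- move=> x Vx; have [cx ix] := cmapK (h x Vx); split=> //.
  by exists x.
- by move=> _ [x Vx <-]; have [cx ix] := cmapK (h x Vx); rewrite ix.
- by move=> x Vx; exact: cmap_continuous (h x Vx).
- move=> _ [x Vx <-]; apply: cinv_continuous; have [] := cmapK (h x Vx); by [].
- by move=> W hW s I; exact: chcoef_smooth.
- by move=> W hW s t; exact: chcoef_inj.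
- by move=> W hW F; exact: chcoef_surj.
- by move=> W hW a s t I x; exact: chcoef_linear.
- by move=> W hW I x; exact: chcoef_one.
- by move=> W hW s t I x; exact: chcoef_mul.
- by move=> W hW b s I x; exact: chcoef_hpart.
- by move=> W W' hW hW' hWW s I x; exact: chcoef_res.
Defined.

End Charts.

Section Sections.
Variables (R : realType) (M : superspace R) (p q : nat) (c : chart M p q).
Local Notation cpt V := (cmap c @` V).
Implicit Types (V W : opens M) (I K : {set 'I_q}) (a : coord p q) (b : bool).

Lemma chcoef_smooth_coefs V (h : V `<=` cdom c) (s : sO M V) :
  smooth_coefs (cpt V) (chcoef h s).
Proof. by move=> I; exact: chcoef_smooth. Qed.

(** The inverse of [chcoef]: a family that is smooth on the image of V comes from some section by
    [chcoef_surj], and from only one by [chcoef_inj]. The default 0 is taken when no section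
    fits. *)
Definition section_of V (h : V `<=` cdom c) (F : coefs R p q) : sO M V :=
  xget 0 [set s : sO M V | forall I x, cpt V x -> chcoef h s I x = F I x].

Lemma section_ofP V (h : V `<=` cdom c) (F : coefs R p q) : smooth_coefs (cpt V) F ->
  forall I x, cpt V x -> chcoef h (section_of h F) I x = F I x.
Proof. by move=> sF; have [s hs] := chcoef_surj h sF;
  exact: (@xgetI _ (0 : sO M V) [set s | forall I x, cpt V x -> chcoef h s I x = F I x]
  s hs). Qed.

Lemma chcoefZ V (h : V `<=` cdom c) (a : R) (s : sO M V) I x : cpt V x ->
  chcoef h (a *: s) I x = a * chcoef h s I x.
Proof.
move=> Vx; have c0 : chcoef h 0 I x = 0.
  have := @chcoef_linear _ _ _ _ c V h (-1) 0 0 I x Vx.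
  by rewrite scaler0 addr0 mulN1r addNr.
by rewrite -[a *: s]addr0 chcoef_linear // c0 addr0.
Qed.

Lemma chcoefD V (h : V `<=` cdom c) (s t : sO M V) I x : cpt V x ->
  chcoef h (s + t) I x = chcoef h s I x + chcoef h t I x.
Proof. by move=> Vx; rewrite -[s]scale1r chcoef_linear // scale1r mul1r. Qed.

Lemma chcoef0 V (h : V `<=` cdom c) I x : cpt V x -> chcoef h 0 I x = 0.
Proof. by move=> Vx; rewrite -(scale0r 0) chcoefZ // mul0r. Qed.

Lemma chcoef_sum V (h : V `<=` cdom c) (J : Type) (r : seq J) (s : J -> sO M V) I x :
  cpt V x -> chcoef h (\sum_(j <- r) s j) I x = \sum_(j <- r) chcoef h (s j) I x.
Proof.
move=> Vx; elim: r => [|j r IHr]; first by rewrite !big_nil chcoef0.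
by rewrite !big_cons chcoefD // IHr.
Qed.

Lemma chcoef_twist V (h : V `<=` cdom c) b (s : sO M V) I x : cpt V x ->
  chcoef h (twist b s) I x = twist_coefs b (chcoef h s) I x.
Proof.
move=> Vx; rewrite twistE chcoefD // chcoefZ // !chcoef_hpart // /twist_coefs /ksign.
by case: odd; case: b => /=; rewrite ?mulr0 ?addr0 ?add0r // ?expr0 ?mul1r.
Qed.

Lemma homog_chcoef V (h : V `<=` cdom c) b (s : sO M V) :
  (forall I x, cpt V x -> odd #|I| != b -> chcoef h s I x = 0) -> homog b s.
Proof.
move=> H; apply: (chcoef_inj (h := h)) => I x Vx; rewrite chcoef_hpart //.
by case: eqP => // /eqP /H ->.
Qed.

Lemma chcoef_homog V (h : V `<=` cdom c) b (s : sO M V) : homog b s ->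
  forall I x, cpt V x -> odd #|I| != b -> chcoef h s I x = 0.
Proof. by move=> hs I x Vx nb; rewrite -hs chcoef_hpart // (negbTE nb). Qed.

Definition partial_sec a V (h : V `<=` cdom c) (s : sO M V) : sO M V :=
  section_of h (coefs_partial a (chcoef h s)).

Lemma chcoef_partial_sec a V (h : V `<=` cdom c) (s : sO M V) I x : cpt V x ->
  chcoef h (partial_sec a h s) I x = coefs_partial a (chcoef h s) I x.
Proof.
move=> Vx; apply: section_ofP => //; apply: coefs_partial_smooth;
  first exact: chart_image_open.
exact: chcoef_smooth_coefs.
Qed.

Lemma partial_sec_linear a V (h : V `<=` cdom c) : linear (partial_sec a h).
Proof.
move=> k s t; have oV := chart_image_open h.
apply: (chcoef_inj (h := h)) => I x Vx.
rewrite chcoef_linear // !chcoef_partial_sec //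
  -(coefs_partial_lin a k (chcoef_smooth_coefs h s) (chcoef_smooth_coefs h t) I Vx).
by apply: (coefs_partial_eq oV) => // J y Vy; rewrite chcoef_linear.
Qed.

HB.instance Definition _ a V (h : V `<=` cdom c) :=
  GRing.isLinear.Build R (sO M V) (sO M V) *:%R (partial_sec a h)
    (partial_sec_linear a h).

Lemma partial_secD a V (h : V `<=` cdom c) (s t : sO M V) : partial_sec a h (s + t) =
  partial_sec a h s + partial_sec a h t.
Proof. exact: linearD. Qed.

Lemma partial_secZ a V (h : V `<=` cdom c) (k : R) (s : sO M V) : partial_sec a h
  (k *: s) = k *: partial_sec a h s.
Proof. exact: linearZ. Qed.

Lemma partial_sec_res a V W (hV : V `<=` cdom c) (hW : W `<=` cdom c) (hWV : W `<=` V)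
  (s : sO M V) :
  partial_sec a hW (res (sO M) hWV s) = res (sO M) hWV (partial_sec a hV s).
Proof.
have oW := chart_image_open hW.
have sub x : cpt W x -> cpt V x by move=> [y Wy <-]; exists y => //; exact: hWV.
apply: (chcoef_inj (h := hW)) => I x Wx.
rewrite (chcoef_res hV) // !chcoef_partial_sec //; last exact: sub.
by apply: (coefs_partial_eq oW) => // J y Wy; rewrite (chcoef_res hV).
Qed.

Lemma partial_sec_mul a V (h : V `<=` cdom c) (f g : sO M V) :
  partial_sec a h (smul f g) = smul (partial_sec a h f) g + smul (twist (cpar a) f)
    (partial_sec a h g).
Proof.
have oV := chart_image_open h.
apply: (chcoef_inj (h := h)) => I x Vx.
rewrite chcoefD // !chcoef_mul // chcoef_partial_sec //.
rewrite (coefs_partial_eq oV _ (G := coefs_mul (chcoef h f) (chcoef h g))) //; last first.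
  by move=> J y Vy; rewrite chcoef_mul.
rewrite (coefs_partial_mul oV _ (chcoef_smooth_coefs h f) (chcoef_smooth_coefs h g) I Vx).
rewrite /coefs_mul; congr (_ + _); apply: eq_bigr => J _.
  by rewrite chcoef_partial_sec.
by rewrite chcoef_partial_sec // chcoef_twist.
Qed.

Lemma partial_sec_homog a b V (h : V `<=` cdom c) (s : sO M V) :
  homog b s -> homog (cpar a (+) b) (partial_sec a h s).
Proof.
move=> hs; have oV := chart_image_open h; apply: (homog_chcoef (h := h)) => I x Vx nb.
rewrite chcoef_partial_sec //; case: a nb => [i|j] nb /=.
  rewrite -(partial_cst i 0 x); apply: (partial_eq oV) => // y Vy.
  exact: (chcoef_homog h hs Vy nb).
case: ifP => // jI; rewrite (chcoef_homog h hs) ?mulr0 //.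
by move: nb; rewrite cardsU1 jI oddD /=; case: odd; case: b {hs}.
Qed.

Lemma partial_secC a (b : coord p q) V (h : V `<=` cdom c) (s : sO M V) :
  partial_sec a h (partial_sec b h s) = ksign R (cpar a && cpar b) *: partial_sec b h
    (partial_sec a h s).
Proof.
have oV := chart_image_open h.
apply: (chcoef_inj (h := h)) => I x Vx.
rewrite chcoefZ // !chcoef_partial_sec //.
rewrite (coefs_partial_eq oV _ (G := coefs_partial b (chcoef h s))) //; last first.
  by move=> J y Vy; rewrite chcoef_partial_sec.
rewrite [in RHS](coefs_partial_eq oV _ (G := coefs_partial a (chcoef h s))) //;
  last first.
  by move=> J y Vy; rewrite chcoef_partial_sec.
by apply: (coefs_partialC oV) => //; exact: chcoef_smooth_coefs.
Qed.

Lemma partial_sec_twist a b V (h : V `<=` cdom c) (s : sO M V) :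
  partial_sec a h (twist b s) = ksign R (b && cpar a) *: twist b (partial_sec a h s).
Proof.
apply: (homog_ind (P := fun s =>
   partial_sec a h (twist b s) = ksign R (b && cpar a) *: twist b (partial_sec a h s)))
     => {s}.
  by move=> s t Hs Ht; rewrite twistD !partial_secD Hs Ht twistD scalerDr.
move=> d s hs; rewrite (twist_homog _ hs) (twist_homog _ (partial_sec_homog _ h hs)).
rewrite partial_secZ scalerA ksignM; congr (ksign _ _ *: _).
by case: b; case: d {hs}; case: (cpar a).
Qed.

Definition coordsec (o : 'rV[R]_p) a V (h : V `<=` cdom c) : sO M V :=
  section_of h (coefs_coord o a).

Lemma chcoef_coordsec o a V (h : V `<=` cdom c) I x : cpt V x ->
  chcoef h (coordsec o a h) I x = coefs_coord o a I x.
Proof.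
move=> Vx; apply: section_ofP => //; apply: coefs_coord_smooth; exact: chart_image_open.
Qed.

Lemma coordsec_homog o a V (h : V `<=` cdom c) : homog (cpar a) (coordsec o a h).
Proof.
apply: (homog_chcoef (h := h)) => I x Vx; rewrite chcoef_coordsec //.
case: a => [i|j] /=; case: (eqVneq I) => [E|_ _]; rewrite ?mul0r //.
  by rewrite E finset.cards0.
by rewrite E finset.cards1.
Qed.

Lemma coordsec_res o a V W (hV : V `<=` cdom c) (hW : W `<=` cdom c) (hWV : W `<=` V) :
  res (sO M) hWV (coordsec o a hV) = coordsec o a hW.
Proof.
have sub x : cpt W x -> cpt V x by move=> [y Wy <-]; exists y => //; exact: hWV.
apply: (chcoef_inj (h := hW)) => I x Wx.
by rewrite (chcoef_res hV) // !chcoef_coordsec //; exact: sub.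
Qed.

Lemma partial_sec_one a V (h : V `<=` cdom c) : partial_sec a h (sone V) = 0.
Proof.
have oV := chart_image_open h.
apply: (chcoef_inj (h := h)) => I x Vx.
rewrite chcoef_partial_sec // chcoef0 // (coefs_partial_eq oV _ (G := @coefs_one R p q))
  //.
  exact: coefs_partial_one Vx.
by move=> J y Vy; rewrite chcoef_one.
Qed.

Lemma partial_sec_coordsec o a (b : coord p q) V (h : V `<=` cdom c) :
  partial_sec a h (coordsec o b h) = (a == b)%:R *: sone V.
Proof.
have oV := chart_image_open h.
apply: (chcoef_inj (h := h)) => I x Vx.
rewrite chcoef_partial_sec // chcoefZ // chcoef_one //.
rewrite (coefs_partial_eq oV _ (G := coefs_coord o b)) //; last first.
  by move=> J y Vy; rewrite chcoef_coordsec.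
exact: (coefs_partial_coord oV).
Qed.

Lemma coordsec_shift o o' a V (h : V `<=` cdom c) :
  exists k : R, coordsec o a h = k *: sone V + coordsec o' a h.
Proof.
exists (if a is inl i then o' 0 i - o 0 i else 0).
apply: (chcoef_inj (h := h)) => I x Vx.
rewrite chcoef_linear // !chcoef_coordsec // chcoef_one // /coefs_one.
case: a => [i|j] /=; last by rewrite mul0r add0r.
by case: eqP => _; ring.
Qed.

End Sections.

(** * Vector fields and one-forms on a chart *)

Section SuperHadamard.
Import mathcomp.boot.finset.
Local Close Scope classical_set_scope.
Variables (R : realType) (p q : nat).
Local Notation V := 'rV[R]_p.
Variable W : set V.
Hypothesis oW : open W.
Variable o : V.
Hypothesis starW : forall x (t : R), W x -> 0 <= t <= 1 -> W (t *: (x - o) + o).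

(** For K empty this is [hadamard]. Otherwise the constant term vanishes, the odd coordinates
    contribute |K| times the radial integral of F K with exponent |K| - 1, and the even ones
    complete it to F K by [radial_euler]. *)
Lemma super_hadamard (F : coefs R p q) : smooth_coefs W F -> forall K x, W x ->
  F K x = F set0 o * coefs_one K x +
    \sum_a coefs_mul (coefs_coord o a) (coefs_radial o 0 (coefs_partial a F)) K x.
Proof.
move=> sF K x Wx; rewrite big_sumType /=.
under eq_bigr do rewrite coefs_mul_coord_even /coefs_radial addn0.
have -> : \sum_(j : 'I_q) coefs_mul (coefs_coord o (inr j))
     (coefs_radial o 0 (coefs_partial (inr j) F)) K x =
   #|K|%:R * radial o #|K|.-1 (F K) x.
  rewrite -[X in X%:R * _]sum1_card natr_sum mulr_suml [RHS]big_mkcond /=;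
    apply: eq_bigr => j _.
  rewrite coefs_mul_coord_odd; case: ifP => // jK.
  have E : #|K| = #|K :\ j|.+1 by rewrite (cardsD1 j K) jK.
  have jD : (j \in K :\ j) = false by rewrite !inE eqxx.
  rewrite /coefs_radial /coefs_partial addn0 jD (radialZ oW starW) ?setD1K //.
  by rewrite mulrA -expr2 sqrr_sign E.
rewrite /coefs_one; case: (eqVneq K set0) => [->|K0].
  by rewrite cards0 mul0r addr0 mulr1; exact: (hadamard oW starW).
rewrite mulr0 add0r; have [m E] : exists m, #|K| = m.+1.
  by case: #|K| (card_gt0 K) => [|m _]; [rewrite K0 | exists m].
rewrite E /=; rewrite -[LHS](radial_euler oW starW m (sF K) Wx); congr (_ + _).
by apply: eq_bigr => i _; rewrite (partial_radial oW starW).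
Qed.

End SuperHadamard.

Section BallCharts.
Variables (R : realType) (M : superspace R) (p q : nat) (c : chart M p q).
Local Notation cpt V := (cmap c @` V).
Implicit Types (V W : opens M) (I K : {set 'I_q}) (a : coord p q) (b : bool).

Definition starred (o : 'rV[R]_p) (B : set 'rV[R]_p) : Prop :=
  B o /\ forall x (t : R), B x -> 0 <= t <= 1 -> B (t *: (x - o) + o).

Lemma ball_chart V (h : V `<=` cdom c) x : V x ->
  exists (W : opens M) (hW : W `<=` V), W x /\ starred (cmap c x) (cpt W).
Proof.
move=> Vx; set o := cmap c x.
have oV := chart_image_open h.
have /nbhs_ballP[r /= r0 Hr] : nbhs o (cpt V).
  by apply: open_nbhs_nbhs; split=> //; exists x.
pose W := Opens (chart_preimage_open c (ball_open o r)).
have WV : W `<=` V.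
  move=> z [cz /Hr [z' Vz' E]]; have [_ <-] := cmapK cz.
  by rewrite -E; have [_ ->] := cmapK (h _ Vz').
exists W, WV; split; first by split; [exact: h | exact: ballxx].
have cptW z : cpt W z <-> ball o r z.
  split=> [[z' [_ ?] <-] //|Bz].
  have [z' Vz' E] := Hr _ Bz; exists z' => //; split; first exact: h.
  by rewrite E.
split=> [|z t /cptW Bz /andP[t0 t1]]; apply/cptW; first exact: ballxx.
move: Bz; rewrite -!ball_normE /= opprD addrCA subrr addr0 normrN normrZ (ger0_norm t0).
rewrite distrC => Bz; apply: le_lt_trans Bz.
by rewrite -[X in _ <= X]mul1r ler_wpM2r.
Qed.

Lemma section_hadamard V (h : V `<=` cdom c) o : starred o (cpt V) ->
  forall s : sO M V, s = chcoef h s finset.set0 o *: sone V +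
    \sum_a smul (coordsec o a h) (section_of h
      (coefs_radial o 0 (coefs_partial a (chcoef h s)))).
Proof.
move=> [Vo starV] s; have oV := chart_image_open h.
apply: (chcoef_inj (h := h)) => K x Vx.
rewrite chcoef_linear // chcoef_one // chcoef_sum //.
rewrite [LHS](super_hadamard oV starV (chcoef_smooth_coefs h s) K Vx); congr (_ + _).
apply: eq_bigr => a _; rewrite chcoef_mul // /coefs_mul; apply: eq_bigr => J _.
rewrite chcoef_coordsec // section_ofP //; apply: (coefs_radial_smooth oV starV).
by apply: (coefs_partial_smooth oV); exact: chcoef_smooth_coefs.
Qed.

(* At the centre of a star-shaped chart, [section_hadamard] exhibits [f] as a
   constant plus a combination of the coordinates; the latter have no
   coefficient of weight zero there, hence the induction on the degree. *)
Lemma leibniz_eq0_at V (h : V `<=` cdom c) o b (A : sO M V -> sO M V) :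
  starred o (cpt V) -> linear A -> leibniz b A ->
  (forall a, A (coordsec 0 a h) = 0) ->
  forall f K, chcoef h (A f) K o = 0.
Proof.
move=> st lA lbA A0; have [Vo starV] := st.
have AD s t : A (s + t) = A s + A t by have := lA 1 s t; rewrite !scale1r.
have A00 : A 0 = 0 by apply: (addrI (A 0)); rewrite -AD !addr0.
have AZ k s : A (k *: s) = k *: A s by have := lA k s 0; rewrite A00 !addr0.
have Asum (J : Type) (r : seq J) (s : J -> sO M V) : A (\sum_(j <- r) s j) =
  \sum_(j <- r) A (s j).
  by elim: r => [|j r IHr]; rewrite ?big_nil ?A00 // !big_cons AD IHr.
have A1 : A (sone V) = 0.
  have := lbA false (sone V) (sone V) (sone_even V).
  rewrite smul1l smul1r smul1l andbF /ksign expr0 scale1r.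
  by move=> E; apply: (addrI (A (sone V))); rewrite addr0 -E.
(* The hypothesis concerns the coordinates centred at 0, the expansion those centred at o; they
   differ by constants, which A kills. *)
have A0o a : A (coordsec o a h) = 0.
  by have [k ->] := coordsec_shift o 0 a h; rewrite AD AZ A1 A0 scaler0 addr0.
move=> f K; elim: {K}_.+1 {-2}K (ltnSn #|K|) f => // n IHn K Kn f.
rewrite [f](section_hadamard h st) AD AZ A1 scaler0 add0r Asum chcoef_sum //.
apply: big1 => a _; rewrite (lbA (cpar a)); last exact: coordsec_homog.
rewrite A0o smul0l add0r chcoefZ // chcoef_mul //.
set g := A _; rewrite /coefs_mul.
have E J : chcoef h (coordsec o a h) J o = coefs_coord o a J o by rewrite chcoef_coordsec.
under eq_bigr do rewrite E.
rewrite -/(coefs_mul (coefs_coord o a) (chcoef h g) K o).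
case: a {E} @g => [i|j] g; first by rewrite coefs_mul_coord_even subrr mul0r mulr0.
rewrite coefs_mul_coord_odd; case: ifP => [jK|]; last by rewrite mulr0.
rewrite IHn ?mulr0 //; move: Kn; rewrite (finset.cardsD1 j K) jK.
by rewrite ltnS.
Qed.

End BallCharts.

Section OperatorParity.
Variables (R : realType) (M : superspace R) (E F : superpsh R M).

Lemma oppart_parity (V : opens M) (b d : bool) (A : E V -> F V) :
  (forall e s, homog e s -> homog (d (+) e) (A s)) ->
  (forall s t, A (s + t) = A s + A t) ->
  oppart b A = if b == d then A else fun=> 0.
Proof.
move=> hA AD; apply/funext => s; rewrite /oppart.
rewrite (homog_hpart_eq b (hA _ _ (hpart_is_homog false s))).
rewrite (homog_hpart_eq (~~ b) (hA _ _ (hpart_is_homog true s))).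
have As : A s = A (hpart E false s) + A (hpart E true s) by rewrite -AD hpart_sum.
by case: b; case: d {hA} => /=; rewrite ?As ?addr0 ?add0r.
Qed.

End OperatorParity.
Arguments oppart_parity {R M E F V} b d {A}.

Section Fields.
Variables (R : realType) (M : superspace R) (p q : nat) (c : chart M p q).
Local Notation cpt V := (cmap c @` V).
Implicit Types (V W U : opens M) (I K : {set 'I_q}) (a : coord p q) (b : bool).

Lemma Dfield_subproof U (h : U `<=` cdom c) a :
  is_operator (E := sO M) (F := self_smodule M) (@leibniz R M)
   (fun V (hV : V `<=` U) s => partial_sec a (subset_trans hV h) s).
Proof.
split; first split.
- by move=> V hV k s t; exact: (partial_sec_linear a).
- by move=> V W hV hW hWV s; exact: partial_sec_res.
move=> V hV b; rewrite (oppart_parity b (cpar a)); last 2 first.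
- by move=> e s; exact: partial_sec_homog.
- by move=> s t; exact: partial_secD.
case: eqP => [-> e f g hf|_]; last exact: leibniz_zero.
by rewrite partial_sec_mul (twist_homog _ hf) smulZl.
Qed.

Definition Dfield U (h : U `<=` cdom c) a : tangent M U :=
  mk_operator (Dfield_subproof h a).

Lemma DfieldE U (h : U `<=` cdom c) a V (hV : V `<=` U) (hVc : V `<=` cdom c) s :
  val (Dfield h a) V hV s = partial_sec a hVc s.
Proof. by rewrite /= (Prop_irrelevance (subset_trans hV h) hVc). Qed.

Lemma Dfield_res U V (hU : U `<=` cdom c) (hV : V `<=` cdom c) (h : V `<=` U) a :
  res (tangent M) h (Dfield hU a) = Dfield hV a.
Proof.
apply: operator_eq => W hW s; have hWc := subset_trans hW hV.
rewrite [RHS](DfieldE hV a hW hWc); exact: (DfieldE hU a (subset_trans hW h) hWc).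
Qed.

Lemma Dfield_homog U (h : U `<=` cdom c) a : homog (cpar a) (Dfield h a).
Proof.
apply: operator_eq => W hW s.
have := oppart_parity (cpar a) (cpar a) (A := val (Dfield h a) W hW).
move=> H; rewrite -[LHS]/(oppart (cpar a) (val (Dfield h a) W hW) s) H ?eqxx //.
- by move=> e t; exact: partial_sec_homog.
- by move=> t u; exact: operatorD.
Qed.

Lemma tangent_homog U b (Y : tangent M U) : homog b Y ->
  forall V (hV : V `<=` U) e (s : sO M V), homog e s -> homog (b (+) e) (val Y V hV s).
Proof.
move=> hY V hV e s hs; rewrite -hY /= /oppart !(homog_hpart_eq _ hs).
have A0 : val Y V hV (0 : sO M V) = 0 by exact: operator0.
case: b hY => hY; case: e hs => hs /=; rewrite A0 ?linear0 ?addr0 ?add0r;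
  exact: hpart_is_homog.
Qed.

(** A vector field vanishes when it kills all functions on all smaller opens, which is checked
    coefficient by coefficient at each point. The point is made the centre of a star-shaped W, where
    [leibniz_eq0_at] applies to the two homogeneous parts of Y. *)
Lemma tangent_eq0 U (h : U `<=` cdom c) (Y : tangent M U) :
  (forall a, val Y U (@subset_refl _ U) (coordsec 0 a h) = 0) -> Y = 0.
Proof.
move=> Y0; have [[lY nY] pY] := operatorP Y.
apply: operator_eq => V hV f; rewrite [RHS]/(0 : sO M V).
have hVc := subset_trans hV h.
apply: (chcoef_inj (h := hVc)) => K _ [x Vx <-].
have [W [hWV [Wx st]]] := ball_chart hVc Vx.
have hW := subset_trans hWV hV; have hWc := subset_trans hW h.
have cx : (cmap c @` W) (cmap c x) by exists x.
rewrite chcoef0; last by exists x.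
rewrite -(chcoef_res hVc hWc hWV) // -(nY V W hV hW hWV).
set g := res _ _ _.
have YW0 a : val Y W hW (coordsec 0 a hWc) = 0.
  by rewrite -(coordsec_res 0 a h hWc hW) (nY U W (@subset_refl _ U)) Y0 linear0.
have -> : val Y W hW g = oppart false (val Y W hW) g + oppart true (val Y W hW) g.
  exact: esym (congr1 (fun Z : tangent M U => val Z W hW g) (hpart_sum Y)).
have part0 b : chcoef hWc (oppart b (val Y W hW) g) K (cmap c x) = 0.
  apply: (leibniz_eq0_at st (b := b) (A := oppart b (val Y W hW))).
  - exact: (operator_lin hW (hpart (tangent M) b Y)).
  - exact: pY.
  move=> a; have A0 : val Y W hW (0 : sO M W) = 0 by exact: operator0.
  rewrite /oppart !(homog_hpart_eq _ (coordsec_homog _ _ _)).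
  by case: (cpar a); rewrite /= YW0 A0 !linear0 addr0.
by rewrite chcoefD // !part0 addr0.
Qed.

Lemma tangent_expand U (h : U `<=` cdom c) (Y : tangent M U) :
  Y = \sum_a sact (val Y U (@subset_refl _ U) (coordsec 0 a h)) (Dfield h a).
Proof.
apply/eqP; rewrite -subr_eq0; apply/eqP; apply: (tangent_eq0 (h := h)) => b.
pose ev (Z : tangent M U) := val Z U (@subset_refl _ U) (coordsec 0 b h).
have evD Z1 Z2 : ev (Z1 + Z2) = ev Z1 + ev Z2 by [].
have ev0 : ev 0 = 0 by [].
rewrite -[LHS]/(ev Y - ev (\sum_a sact (val Y U (@subset_refl _ U) (coordsec 0 a h))
  (Dfield h a))).
rewrite (big_morph ev evD ev0) (bigD1 b) //= big1 => [|a ab].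
  rewrite addr0 -[X in _ - X]/(smul (res (sO M) (@subset_refl _ U) (ev Y))
    (val (Dfield h b) U (@subset_refl _ U) (coordsec 0 b h))).
  by rewrite (DfieldE h b _ h) partial_sec_coordsec eqxx scale1r smul1r res_id subrr.
rewrite -[LHS]/(smul (res (sO M) (@subset_refl _ U) _)
  (val (Dfield h a) U (@subset_refl _ U) (coordsec 0 b h))).
by rewrite (DfieldE h a _ h) partial_sec_coordsec (negbTE ab) scale0r smul0r.
Qed.

(* [dx_a (X) = (-1)^(|x_a||X|) X(x_a)], the parity of [X] being that in
   [Pi T]; the sign makes [dx_a] left O-linear. *)
Definition dxmap U (h : U `<=` cdom c) a V (hV : V `<=` U) (Y : Pi (tangent M) V) : sO M
  V :=
  let ev (Z : tangent M V) := val Z V (@subset_refl _ V)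
    (coordsec 0 a (subset_trans hV h)) in
  ev (twist (F := Pi (tangent M)) (cpar a) Y).

Lemma dxmap_linear U (h : U `<=` cdom c) a V (hV : V `<=` U) : linear (dxmap h a hV).
Proof. by move=> k Y Z; rewrite /dxmap linearP. Qed.

Lemma dxmap_homogE U (h : U `<=` cdom c) a V (hV : V `<=` U) b (Y : Pi (tangent M) V) :
  homog b Y -> dxmap h a hV Y = ksign R (cpar a && b) *:
      val (Y : tangent M V) V (@subset_refl _ V) (coordsec 0 a (subset_trans hV h)).
Proof. by move=> hY; rewrite /dxmap (twist_homog _ hY). Qed.

Lemma dxmap_parity U (h : U `<=` cdom c) a V (hV : V `<=` U) b (Y : Pi (tangent M) V) :
  homog b Y -> homog (~~ cpar a (+) b) (dxmap h a hV Y).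
Proof.
move=> hY; rewrite (dxmap_homogE h a hV hY); apply: homogZ.
have := @tangent_homog V (~~ b) Y hY V (@subset_refl _ V) _ _
  (coordsec_homog 0 a (subset_trans hV h)).
by case: b {hY}; case: (cpar a).
Qed.

Lemma dxform_subproof U (h : U `<=` cdom c) a :
  is_operator (E := Pi (tangent M)) (F := self_smodule M)
    (@superlinear R M (Pi (tangent M)) (self_smodule M)) (dxmap h a).
Proof.
have dxl V (hV : V `<=` U) := dxmap_linear h a hV.
have dxD V (hV : V `<=` U) (s t : Pi (tangent M) V) :
    dxmap h a hV (s + t) = dxmap h a hV s + dxmap h a hV t.
  by have := dxl V hV 1 s t; rewrite !scale1r.
split; first split=> //.
  move=> V W hV hW hWV Y; rewrite /dxmap twist_res.
  set Z := twist _ _; rewrite -(coordsec_res 0 a (subset_trans hV h) (subset_trans hW h)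
    hWV).
  have [[_ nZ] _] := operatorP (Z : tangent M V).
  rewrite -(nZ V W (@subset_refl _ V) hWV hWV) /=.
  by congr (val Z _ _ _); exact: Prop_irrelevance.
move=> V hV b; rewrite (oppart_parity b (~~ cpar a)) //; last first.
  by move=> e Y; exact: dxmap_parity.
case: eqP => [->|_]; last exact: superlinear_zero.
move=> e f Y hf.
apply: (homog_ind (F := Pi (tangent M)) (P := fun Y =>
   dxmap h a hV (sact f Y) = ksign R (~~ cpar a && e) *: smul f (dxmap h a hV Y))) => {Y}.
  by move=> Y Z IY IZ; rewrite sactDr (dxD _ _ (sact f Y)) (dxD _ _ Y) IY IZ smulDr
    scalerDr.
move=> d Y hY; rewrite (dxmap_homogE h a hV hY) (dxmap_homogE h a hV (sact_homog hf hY)).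
set cs := coordsec _ _ _.
have E : val (sact f Y : tangent M V) V (@subset_refl _ V) cs =
    ksign R e *: smul f (val (Y : tangent M V) V (@subset_refl _ V) cs).
  have -> : sact f Y = ksign R e *: (sact f (Y : tangent M V) : tangent M V).
    exact: Pi_act_homogE.
  by rewrite -[LHS]/(ksign R e *: smul (res (sO M) (@subset_refl _ V) f)
        (val (Y : tangent M V) V (@subset_refl _ V) cs)) res_id.
rewrite [X in _ *: X]E smulZr !scalerA !ksignM; congr (ksign _ _ *: _).
by case: (cpar a); case: e {hf E}; case: d {hY}.
Qed.

Definition dxform U (h : U `<=` cdom c) a : Omega1 M U :=
  mk_operator (dxform_subproof h a).

Lemma dxform_res U V (hU : U `<=` cdom c) (hV : V `<=` cdom c) (h : V `<=` U) a :
  res (Omega1 M) h (dxform hU a) = dxform hV a.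
Proof.
apply: operator_eq => W hW Y; rewrite /= /dxmap.
by rewrite (Prop_irrelevance (subset_trans _ hU) (subset_trans hW hV)).
Qed.

Lemma pairing_dx U (h : U `<=` cdom c) a (b : coord p q) :
  pairing (dxform h a) (Dfield h b) = (a == b)%:R *: sone U.
Proof.
have hD : @homog R M (Pi (tangent M)) (~~ cpar b) U (Dfield h b).
  by rewrite /homog /= negbK; exact: Dfield_homog.
rewrite /pairing /= /dxmap (twist_homog _ hD).
rewrite -[LHS]/(ksign R (cpar a && ~~ cpar b) *:
   val (Dfield h b) U (@subset_refl _ U)
     (coordsec 0 a (subset_trans (@subset_refl _ U) h))).
rewrite (DfieldE h b _ h) (Prop_irrelevance (subset_trans _ h) h) partial_sec_coordsec
  eq_sym.
by case: eqP => [->|_]; rewrite ?scale0r ?scaler0 // andbN /ksign expr0 scale1r.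
Qed.

Lemma dxform_homog U (h : U `<=` cdom c) a : homog (~~ cpar a) (dxform h a).
Proof.
apply: operator_eq => V hV Y.
rewrite -[LHS]/(oppart (~~ cpar a) (dxmap h a hV) Y) (oppart_parity _ (~~ cpar a)) ?eqxx
  //.
- by move=> e Z; exact: dxmap_parity.
- by move=> s t; have := dxmap_linear h a hV 1 s t; rewrite !scale1r.
Qed.

Lemma form_eq0 U (h : U `<=` cdom c) (e : Omega1 M U) :
  (forall a, pairing e (Dfield h a) = 0) -> e = 0.
Proof.
move=> e0; have [[le ne] pe] := operatorP e.
apply: operator_eq => V hV Y; rewrite [RHS]/(0 : sO M V).
have hVc := subset_trans hV h.
have eD (s t : Pi (tangent M) V) : val e V hV (s + t) = val e V hV s + val e V hV t.
  exact: operatorD.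
have ez : val e V hV (0 : Pi (tangent M) V) = 0 by exact: operator0.
have eDf a : val e V hV (Dfield hVc a : Pi (tangent M) V) = 0.
  rewrite -(Dfield_res h hVc hV); have := ne U V (@subset_refl _ U) hV hV (Dfield h a).
  by move=> /= ->; rewrite -/(pairing e (Dfield h a)) e0 linear0.
have hD a : @homog R M (Pi (tangent M)) (~~ cpar a) V (Dfield hVc a).
  by rewrite /homog /= negbK; exact: Dfield_homog.
have e_act a b (f : sO M V) : homog b f ->
  val e V hV (sact f (Dfield hVc a : Pi (tangent M) V)) = 0.
  move=> hf.
  have E := congr1 (fun Z : Omega1 M U =>
    val Z V hV (sact f (Dfield hVc a : Pi (tangent M) V))) (hpart_sum e).
  rewrite -E -[LHS]/(oppart false (val e V hV)
    (sact f (Dfield hVc a : Pi (tangent M) V)) +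
     oppart true (val e V hV) (sact f (Dfield hVc a : Pi (tangent M) V))).
  have z d : oppart d (val e V hV) (Dfield hVc a : Pi (tangent M) V) = 0.
    rewrite /oppart !(homog_hpart_eq _ (hD a)).
    by case: (~~ cpar a); rewrite /= eDf ez !linear0 addr0.
  by rewrite !(pe _ _ _ b) // !z !sact0r !scaler0 addr0.
rewrite (tangent_expand hVc Y) (big_morph _ eD ez) big1 // => a _.
set f := val Y _ _ _.
(* The expansion uses the module structure of the tangent sheaf, whereas e is linear for that of its
   parity shift; the two differ by the sign built into [Pi_act], that is by a twist of f. *)
have -> : sact f (Dfield hVc a) = sact (twist true f) (Dfield hVc a : Pi (tangent M) V).
  rewrite -[RHS]/(Pi_act (twist true f) (Dfield hVc a : Pi_superpsh (tangent M) V)).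
  rewrite -[in LHS](twistK true f).
  apply: (homog_ind (F := sO M) (P := fun g =>
    sact (twist true g) (Dfield hVc a) = Pi_act g
      (Dfield hVc a : Pi_superpsh (tangent M) V))).
    by move=> s t Hs Ht; rewrite twistD sactDl Hs Ht Pi_actDl.
  by move=> b s hs; rewrite (twist_homog _ hs) (Pi_act_homogE _ hs) sactZl.
rewrite -(hpart_sum (twist true f)) sactDl eD.
by rewrite (e_act _ false) ?(e_act _ true) ?addr0 //; exact: hpart_is_homog.
Qed.

Lemma form_expand U (h : U `<=` cdom c) (e : Omega1 M U) :
  e = \sum_a sact (pairing e (Dfield h a)) (dxform h a).
Proof.
apply/eqP; rewrite -subr_eq0; apply/eqP; apply: (form_eq0 (h := h)) => b.
pose ev (Z : Omega1 M U) := pairing Z (Dfield h b).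
have evD Z1 Z2 : ev (Z1 + Z2) = ev Z1 + ev Z2 by [].
have ev0 : ev 0 = 0 by [].
have evA f Z : ev (sact f Z) = smul f (ev Z).
  by rewrite -[LHS]/(smul (res (sO M) (@subset_refl _ U) f) (ev Z)) res_id.
rewrite -[LHS]/(ev e - ev (\sum_a sact (pairing e (Dfield h a)) (dxform h a))).
rewrite (big_morph ev evD ev0) (bigD1 b) //= big1 => [|a ab].
  by rewrite addr0 evA /ev pairing_dx eqxx scale1r smul1r subrr.
by rewrite evA /ev pairing_dx (negbTE ab) scale0r smul0r.
Qed.

End Fields.

(** * Words *)

Section Words.
Variables (R : realType) (p q : nat).
Local Notation crd := (coord p q).
Local Notation word := (seq crd).

Definition dpar (a : crd) : bool := ~~ cpar a.

Definition wpar (w : word) : bool := \big[addb/false]_(a <- w) dpar a.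

(** The sign in dx_a dx_b = [swap_sign a b] dx_b dx_a. *)
Definition swap_sign (a b : crd) : R := ksign R (dpar a && dpar b).

Lemma swap_signC a b : swap_sign a b = swap_sign b a.
Proof. by rewrite /swap_sign andbC. Qed.

Lemma swap_signK a b : swap_sign a b * swap_sign a b = 1.
Proof. by rewrite ksignM addbb. Qed.

Lemma wpar_cons a w : wpar (a :: w) = dpar a (+) wpar w.
Proof. by rewrite /wpar big_cons. Qed.

Lemma wpar_nil : wpar [::] = false.
Proof. by rewrite /wpar big_nil. Qed.

Section Creation.
Variable A : lmodType R.
Implicit Types (f g : word -> A) (a b : crd) (u v w : word).

(* The value of [f] at [b_1 ... b_k] stands for the evaluation of a k-form at
   d/dx_(b_1), ..., d/dx_(b_k): multiplication by [dx_a] inserts [a] in all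
   possible positions, with the sign of the permutation of the factors. *)
Fixpoint creat a f w : A :=
  if w is b :: v then
    (if a == b then f v else 0) + swap_sign a b *: creat a (fun u => f (b :: u)) v
  else 0.

Definition annih a f : word -> A := fun w => f (a :: w).

Lemma eq_creat a f g : f =1 g -> creat a f =1 creat a g.
Proof. by move=> fg w; have -> : f = g by apply/funext. Qed.

Lemma creat_lin a (k : R) f g w :
  creat a (fun u => k *: f u + g u) w = k *: creat a f w + creat a g w.
Proof.
elim: w f g => [|b v IHv] f g /=; first by rewrite scaler0 addr0.
rewrite IHv !scalerDr !scalerA [swap_sign a b * k]mulrC !addrA; congr (_ + _).
rewrite [RHS]addrAC; congr (_ + _).
by case: ifP => _; rewrite ?scaler0 ?addr0.
Qed.

Lemma creatD a f g w : creat a (fun u => f u + g u) w = creat a f w + creat a g w.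
Proof.
by rewrite -[creat a f w]scale1r -creat_lin; apply: eq_creat => u; rewrite scale1r.
Qed.

Lemma creat0 a w : creat a (fun=> 0) w = 0.
Proof.
by apply: (addrI (creat a (fun=> 0) w)); rewrite addr0 -creatD; apply: eq_creat => u;
  rewrite addr0.
Qed.

Lemma creatZ a (k : R) f w : creat a (fun u => k *: f u) w = k *: creat a f w.
Proof.
rewrite -[RHS]addr0 -(creat0 a w) -creat_lin.
by apply: eq_creat => u; rewrite addr0.
Qed.

Lemma creat_sum a (I : Type) (r : seq I) (F : I -> word -> A) w :
  creat a (fun u => \sum_(i <- r) F i u) w = \sum_(i <- r) creat a (F i) w.
Proof.
elim: r => [|i r IHr].
  by rewrite big_nil -[RHS](creat0 a w); apply: eq_creat => u; rewrite big_nil.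
by rewrite big_cons -IHr -creatD; apply: eq_creat => u; rewrite big_cons.
Qed.

Lemma creatC a b f w : creat a (creat b f) w = swap_sign a b *: creat b (creat a f) w.
Proof.
elim: w f => [|c v IHv] f /=; first by rewrite scaler0.
rewrite !creatD !creatZ IHv.
have E a' b' : creat a' (fun x => if b' == c then f x else 0) v =
     if b' == c then creat a' f v else 0 by case: eqP => // _; rewrite creat0.
rewrite !E !scalerDr !scalerA !addrA; congr (_ + _ *: _); last first.
  by ring.
rewrite addrC; congr (_ + _).
  by case: eqP => [->|_]; rewrite ?scaler0.
case: eqP => [->|_]; rewrite ?scaler0 //.
by rewrite [swap_sign b c]swap_signC swap_signK scale1r.
Qed.

(** The canonical commutation relation of the Fock space, here the recursive clause of [creat]. *)
Lemma annih_creat a b f w :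
  annih a (creat b f) w = (if b == a then f w else 0) + swap_sign b a *: creat b
    (annih a f) w.
Proof. by []. Qed.

(** The number operator: it multiplies the coefficients of a k-form by k. *)
Definition number f w : A := \sum_a creat a (annih a f) w.

(** Each creation operator raises the number by one: in the commutator of [number] with [creat b]
    only the diagonal term of [annih_creat] is left. *)
Lemma number_creat b f w : number (creat b f) w = creat b f w + creat b (number f) w.
Proof.
rewrite /number creat_sum; under eq_bigr => a _.
  rewrite (eq_creat a (annih_creat a b f)) creatD creatZ creatC scalerA.
  rewrite swap_signC swap_signK scale1r; over.
rewrite big_split /=; congr (_ + _).
rewrite (bigD1 b) //= eqxx big1 ?addr0 // => a ab.
by rewrite eq_sym (negbTE ab) creat0.
Qed.

Fixpoint creats v f : word -> A := if v is a :: v' then creat a (creats v' f) else f.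

Lemma number_creats v f w : (forall u, number f u = 0) ->
  number (creats v f) w = (size v)%:R *: creats v f w.
Proof.
move=> f0; elim: v w => [|a v IHv] w /=; first by rewrite f0 scale0r.
rewrite number_creat (eq_creat _ IHv) creatZ -addn1 natrD scalerDl scale1r addrC.
by [].
Qed.

Fixpoint wsum (k : nat) f : A :=
  if k is k'.+1 then \sum_a wsum k' (annih a f) else f [::].

Lemma wsumS k f : wsum k.+1 f = \sum_a wsum k (annih a f).
Proof. by []. Qed.

Lemma eq_wsum k f g : (forall w, size w = k -> f w = g w) -> wsum k f = wsum k g.
Proof.
elim: k f g => [|k IHk] f g fg /=; first exact: fg.
by apply: eq_bigr => a _; apply: IHk => w wk; apply: fg; rewrite /= wk.
Qed.

Lemma wsum_lin k (c : R) f g : wsum k (fun u => c *: f u + g u) = c *: wsum k f + wsum k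
  g.
Proof.
elim: k f g => [|k IHk] f g //=; rewrite scaler_sumr -big_split /=.
by apply: eq_bigr => a _; exact: IHk.
Qed.

Lemma wsumD k f g : wsum k (fun u => f u + g u) = wsum k f + wsum k g.
Proof.
by rewrite -[wsum k f]scale1r -wsum_lin; apply: eq_wsum => w _; rewrite scale1r.
Qed.

Lemma wsum0 k : wsum k (fun=> 0) = 0.
Proof.
by apply: (addrI (wsum k (fun=> 0))); rewrite addr0 -wsumD; apply: eq_wsum => w _;
  rewrite addr0.
Qed.

Lemma wsumZ k (c : R) f : wsum k (fun u => c *: f u) = c *: wsum k f.
Proof.
by rewrite -[RHS]addr0 -(wsum0 k) -wsum_lin; apply: eq_wsum => w _; rewrite addr0.
Qed.

Lemma wsum_sum k (I : Type) (r : seq I) (F : I -> word -> A) :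
  wsum k (fun u => \sum_(i <- r) F i u) = \sum_(i <- r) wsum k (F i).
Proof.
elim: r => [|i r IHr].
  by rewrite big_nil -[RHS](wsum0 k); apply: eq_wsum => w _; rewrite big_nil.
by rewrite big_cons -IHr -wsumD; apply: eq_wsum => w _; rewrite big_cons.
Qed.

End Creation.

(* Summing a creation operator against symmetric weights: each of the [k + 1]
   insertion positions contributes the same amount. *)
Lemma wsum_creat (A B : lmodType R) (k : nat) (a : crd) (f : word -> A)
    (Q : word -> A -> B) :
  (forall w, linear (Q w)) ->
  (forall u v b x, (size (u ++ v)).+1 = k ->
     Q (u ++ b :: a :: v) x = swap_sign a b *: Q (u ++ a :: b :: v) x) ->
  wsum k.+1 (fun w => Q w (creat a f w)) = k.+1%:R *: wsum k (fun w => Q (a :: w) (f w)).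
Proof.
move=> Ql.
have QD w x y : Q w (x + y) = Q w x + Q w y by have := Ql w 1 x y; rewrite !scale1r.
have Q0 w : Q w 0 = 0 by apply: (addrI (Q w 0)); rewrite -QD !addr0.
have QZ w c x : Q w (c *: x) = c *: Q w x by have := Ql w c x 0; rewrite Q0 !addr0.
elim: k f Q Ql QD Q0 QZ => [|k IHk] f Q Ql QD Q0 QZ Qs.
  rewrite /= scale1r (bigD1 a) //= big1 => [|b ba].
    by rewrite addr0 /annih /= eqxx scaler0 addr0.
  by rewrite /annih /= eq_sym (negbTE ba) scaler0 addr0 Q0.
rewrite [LHS]wsumS.
under eq_bigr => b _.
  rewrite [wsum _ _](_ : _ = (if a == b then wsum k.+1 (fun w => Q (b :: w) (f w)) else
    0) +
     swap_sign a b *: (k.+1%:R *: wsum k (fun w => Q (b :: a :: w) (f (b :: w)))));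
       last first.
    rewrite -(IHk (fun u => f (b :: u)) (fun w => Q (b :: w))) //; last first.
      by move=> u v b' x E; apply: (Qs (b :: u)); rewrite /= E.
    rewrite -wsumZ; case: (eqVneq a b) => [ab|ab].
      by rewrite -wsumD; apply: eq_wsum => w _; rewrite /annih /= ab eqxx QD QZ.
    by rewrite add0r; apply: eq_wsum => w _; rewrite /annih /= (negbTE ab) add0r QZ.
  over.
rewrite big_split /= -big_mkcond /= (eq_bigl (pred1 a)) ?big_pred1_eq; last first.
  by move=> b; rewrite eq_sym.
(* Insertion in front of the word accounts for one copy; the other k + 1 come from insertion further
   on, once the symmetry of Q has moved a in front of b. *)
rewrite [k.+2%:R]mulrS scalerDl scale1r; congr (_ + _).
rewrite [RHS]scaler_sumr; apply: eq_bigr => b _.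
rewrite scalerA mulrC -scalerA -wsumZ; congr (_ *: _); apply: eq_wsum => w wk.
have /= -> := Qs [::] w b (f (b :: w)) (congr1 S wk).
by rewrite scalerA swap_signK scale1r.
Qed.

Lemma wsum_map (A B : lmodType R) (k : nat) (h : {linear A -> B}) (f : word -> A) :
  h (wsum k f) = wsum k (h \o f).
Proof.
elim: k f => [|k IHk] f //=; rewrite linear_sum; apply: eq_bigr => a _; exact: IHk.
Qed.

Lemma creat_map (A B : lmodType R) (h : {linear A -> B}) (a : crd) (f : word -> A) w :
  h (creat a f w) = creat a (h \o f) w.
Proof.
elim: w f => [|b v IHv] f /=; first exact: linear0.
rewrite linearD linearZ /= IHv; congr (_ + _).
by case: ifP => //; rewrite linear0.
Qed.

Lemma creat_homog (X : topologicalType) (F : superpsh R X) (U : opens X) (x : bool)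
    (a : crd) (f : word -> F U) :
  (forall w, homog (x (+) wpar w) (f w)) ->
  forall w, homog (x (+) dpar a (+) wpar w) (creat a f w).
Proof.
move=> hf w; elim: w x f hf => [|b v IHv] x f hf /=; first exact: homog0.
apply: homogD.
  case: eqP => [->|_]; last exact: homog0.
  by have := hf v; rewrite wpar_cons addbA -[x (+) _ (+) _]addbA addbb addbF.
apply: homogZ; have /(IHv (x (+) dpar b)) : forall w,
  homog (x (+) dpar b (+) wpar w) (f (b :: w)).
  by move=> w; have := hf (b :: w); rewrite wpar_cons addbA.
by rewrite wpar_cons addbA -[x (+) _ (+) dpar a]addbA [dpar b (+) _]addbC addbA.
Qed.

End Words.

(** * The Fock space *)

Arguments cap_openS {X U U'} V _ _ _.

Section Push.
Variables (R : realType) (M : superspace R) (D : opens M) (E : smodule M).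
Implicit Types U V W : opens M.

Lemma res_cap_open_id U (h : U `<=` U) (s : E (cap_open U D)) : res E (cap_openS D h)
  s = s.
Proof. exact: res_id. Qed.

Lemma res_cap_open_comp U V W (hVU : V `<=` U) (hWV : W `<=` V) (hWU : W `<=` U)
  (s : E (cap_open U D)) :
  res E (cap_openS D hWV) (res E (cap_openS D hVU) s) = res E (cap_openS D hWU) s.
Proof. exact: res_comp. Qed.

(** The direct image, along the inclusion of D in M, of the restriction of E to D. *)
Definition push_psh : presheaf R M :=
  @Presheaf R M (fun U => E (cap_open U D)) (fun U V h => res E (cap_openS D h))
    res_cap_open_id res_cap_open_comp.

Definition push_superpsh : superpsh R M :=
  @SuperPsh R M push_psh (fun b U => @hpart R M E b (cap_open U D))
    (fun b c U => @hpart_hpart R M E b c (cap_open U D))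
    (fun U => @hpart_sum R M E (cap_open U D))
    (fun b U V h => @hpart_res R M E b _ _ (cap_openS D h)).

Definition push_act U (f : sO M U) (s : push_superpsh U) : push_superpsh U :=
  sact (res (sO M) (@cap_openl _ U D) f) (s : E (cap_open U D)).

Lemma push_act_linl U (s : push_superpsh U) : linear (fun f : sO M U => push_act f s).
Proof. by move=> a f g; rewrite /push_act linearP sact_linl. Qed.

Lemma push_act_linr U (f : sO M U) : linear (@push_act U f).
Proof. by move=> a s t; rewrite /push_act sact_linr. Qed.

Lemma push_actA U (f g : sO M U) (s : push_superpsh U) :
  push_act f (push_act g s) = push_act (smul f g) s.
Proof. by rewrite /push_act sactA smul_res. Qed.

Lemma push_act1 U (s : push_superpsh U) : push_act (sone U) s = s.
Proof. by rewrite /push_act sone_res sact1. Qed.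

Lemma push_act_homog U (b d : bool) (f : sO M U) (s : push_superpsh U) :
  homog b f -> homog d s -> homog (b (+) d) (push_act f s).
Proof. by move=> hf hs; exact: (sact_homog (homog_res _ hf) (hs : @homog R M E d _ s)).
  Qed.

Lemma push_act_res U V (h : V `<=` U) (f : sO M U) (s : push_superpsh U) :
  res push_superpsh h (push_act f s) = push_act (res (sO M) h f) (res push_superpsh h s).
Proof.
rewrite /push_act /= sact_res; congr (sact _ _).
by rewrite (res_comp _ _ (subset_trans (@cap_openl _ V D) h))
  (res_comp _ _ (subset_trans (@cap_openl _ V D) h)).
Qed.

Definition push : smodule M :=
  @SModule R M push_superpsh push_act push_act_linl push_act_linr push_actA push_act1
    push_act_homog push_act_res.

Lemma push_sheaf : is_sheaf E -> is_sheaf push.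
Proof.
move=> [sep glue]; split.
  move=> U I V hV s t cov st.
  apply: (sep (cap_open U D) I (fun i => cap_open (V i) D)
    (fun i => cap_openS D (hV i))) => //.
  by move=> x [Ux Dx]; have [i Vx] := cov x Ux; exists i.
move=> U I V hV s cov comp.
have [||t ht] := glue (cap_open U D) I (fun i => cap_open (V i) D)
  (fun i => cap_openS D (hV i)) s.
- by move=> x [Ux Dx]; have [i Vx] := cov x Ux; exists i.
- move=> i j W hi hj.
  have hWD : W `<=` D by move=> x /hi [].
  have hWi : W `<=` V i by move=> x /hi [].
  have hWj : W `<=` V j by move=> x /hj [].
  have hW : W `<=` cap_open W D by move=> x Wx; split=> //; exact: hWD.
  have := comp i j W hWi hWj => /(congr1 (res E hW)) /=.
  by rewrite (res_comp _ _ hi) (res_comp _ _ hj).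
by exists t.
Qed.

End Push.

Section Fock.
Variables (R : realType) (M : superspace R) (p q : nat) (F : smodule M).
Local Notation word := (seq (coord p q)).
Implicit Types U V W : opens M.

Definition fock_sec U : lmodType R := word -> F U.

Definition fock_res U V (h : V `<=` U) (f : fock_sec U) : fock_sec V := fun w =>
  res F h (f w).

Lemma fock_res_linear U V (h : V `<=` U) : linear (fock_res h).
Proof. by move=> a f g; apply/funext => w; exact: linearP. Qed.

HB.instance Definition _ U V (h : V `<=` U) :=
  GRing.isLinear.Build R (fock_sec U) (fock_sec V) *:%R (fock_res h) (fock_res_linear h).

Lemma fock_res_id U (h : U `<=` U) (f : fock_sec U) : fock_res h f = f.
Proof. by apply/funext => w; exact: res_id. Qed.

Lemma fock_res_comp U V W (hVU : V `<=` U) (hWV : W `<=` V) (hWU : W `<=` U)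
  (f : fock_sec U) :
  fock_res hWV (fock_res hVU f) = fock_res hWU f.
Proof. by apply/funext => w; exact: res_comp. Qed.

Definition fock_psh : presheaf R M :=
  @Presheaf R M fock_sec (fun U V h => @fock_res U V h) fock_res_id fock_res_comp.

(** The monomial belonging to w has parity [wpar w], so a form of parity b has coefficients of
    parity [b (+) wpar w]. *)
Definition fock_part (b : bool) U (f : fock_psh U) : fock_psh U :=
  fun w => hpart F (b (+) wpar w) (f w).

Lemma fock_part_linear b U : linear (@fock_part b U).
Proof. by move=> a f g; apply/funext => w; exact: linearP. Qed.

HB.instance Definition _ b U :=
  GRing.isLinear.Build R (fock_psh U) (fock_psh U) *:%R (@fock_part b U)
    (@fock_part_linear b U).

Lemma fock_part_part b d U (f : fock_psh U) :
  fock_part b (fock_part d f) = if b == d then fock_part d f else 0.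
Proof.
apply/funext => w; rewrite /fock_part hpart_hpart.
by case: b; case: d => /=; rewrite /fock_part; case: (wpar w).
Qed.

Lemma fock_part_sum U (f : fock_psh U) : fock_part false f + fock_part true f = f.
Proof.
apply/funext => w; rewrite -[RHS](hpart_sum (f w)).
rewrite -[LHS]/(hpart F (false (+) wpar w) (f w) + hpart F (true (+) wpar w) (f w)).
by case: (wpar w) => //=; rewrite addrC.
Qed.

Lemma fock_part_res b U V (h : V `<=` U) (f : fock_psh U) :
  fock_part b (res fock_psh h f) = res fock_psh h (fock_part b f).
Proof. by apply/funext => w; exact: hpart_res. Qed.

Definition fock_superpsh : superpsh R M :=
  @SuperPsh R M fock_psh (fun b U => @fock_part b U) fock_part_part fock_part_sum
    fock_part_res.

Definition fock_act U (f : sO M U) (s : fock_superpsh U) : fock_superpsh U :=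
  fun w => sact f (s w).

Lemma fock_act_linl U (s : fock_superpsh U) : linear (fun f : sO M U => fock_act f s).
Proof. by move=> a f g; apply/funext => w; exact: (sact_linl (s w)). Qed.

Lemma fock_act_linr U (f : sO M U) : linear (@fock_act U f).
Proof. by move=> a s t; apply/funext => w; exact: (sact_linr f). Qed.

Lemma fock_actA U (f g : sO M U) (s : fock_superpsh U) :
  fock_act f (fock_act g s) = fock_act (smul f g) s.
Proof. by apply/funext => w; exact: sactA. Qed.

Lemma fock_act1 U (s : fock_superpsh U) : fock_act (sone U) s = s.
Proof. by apply/funext => w; exact: sact1. Qed.

Lemma fock_homogP b U (s : fock_superpsh U) :
  homog b s <-> forall w, homog (b (+) wpar w) (s w).
Proof.
split=> [hs w|hs]; first by rewrite /homog -[in RHS]hs.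
by apply/funext => w; exact: hs.
Qed.

Lemma fock_act_homog U (b d : bool) (f : sO M U) (s : fock_superpsh U) :
  homog b f -> homog d s -> homog (b (+) d) (fock_act f s).
Proof.
move=> hf /fock_homogP hs; apply/fock_homogP => w; rewrite -addbA.
exact: sact_homog.
Qed.

Lemma fock_act_res U V (h : V `<=` U) (f : sO M U) (s : fock_superpsh U) :
  res fock_superpsh h (fock_act f s) = fock_act (res (sO M) h f) (res fock_superpsh h s).
Proof. by apply/funext => w; exact: sact_res. Qed.

Definition fock : smodule M :=
  @SModule R M fock_superpsh fock_act fock_act_linl fock_act_linr fock_actA fock_act1
    fock_act_homog fock_act_res.

Lemma fock_sheaf : is_sheaf F -> is_sheaf fock.
Proof.
move=> [sep glue]; split.
  move=> U I V hV s t cov st; apply/funext => w.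
  apply: (sep U I V hV) => // i; have := st i; move=> /(congr1 (fun f => f w)).
  by [].
move=> U I V hV s cov comp.
have H w : {t : F U | forall i, res F (hV i) t = s i w}.
  apply: cid; apply: (glue U I V hV (fun i => s i w)) => // i j W hi hj.
  by have := comp i j W hi hj => /(congr1 (fun f => f w)).
exists (fun w => sval (H w)) => i; apply/funext => w; exact: (svalP (H w)).
Qed.

End Fock.

(** * Products of one-forms in the Fock space *)

Section ChartForms.
Variables (R : realType) (M : superspace R) (p q : nat) (c : chart M p q).
Local Notation word := (seq (coord p q)).
Implicit Types (U V W : opens M) (a : coord p q) (b : bool) (w : word).

Definition form_coef V (h : V `<=` cdom c) a (e : Omega1 M V) : sO M V :=
  pairing e (Dfield h a).

Lemma form_coefD V (h : V `<=` cdom c) a (e e' : Omega1 M V) : form_coef h a (e + e') =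
  form_coef h a e + form_coef h a e'.
Proof. by []. Qed.

Lemma form_coefZ V (h : V `<=` cdom c) a (k : R) (e : Omega1 M V) : form_coef h a
  (k *: e) = k *: form_coef h a e.
Proof. by []. Qed.

Lemma form_coef_act V (h : V `<=` cdom c) a (f : sO M V) (e : Omega1 M V) :
  form_coef h a (sact f e) = smul f (form_coef h a e).
Proof. by rewrite -[LHS]/(smul (res (sO M) (@subset_refl _ V) f) (form_coef h a e))
  res_id. Qed.

Lemma form_coef_res V W (hV : V `<=` cdom c) (hW : W `<=` cdom c) (h : W `<=` V) a
  (e : Omega1 M V) :
  form_coef hW a (res (Omega1 M) h e) = res (sO M) h (form_coef hV a e).
Proof.
have [[_ ne] _] := operatorP e.
rewrite /form_coef /pairing -(ne V W (@subset_refl _ V) h h) -(Dfield_res hV hW h) /=.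
by congr (val e _ _ _); exact: Prop_irrelevance.
Qed.

Lemma form_coef_homog V (h : V `<=` cdom c) a b (e : Omega1 M V) :
  homog b e -> homog (b (+) dpar a) (form_coef h a e).
Proof.
move=> he; rewrite -he /form_coef /pairing /= /oppart.
have hD : @homog R M (Pi (tangent M)) (dpar a) V (Dfield h a).
  by rewrite /homog /= negbK; exact: Dfield_homog.
have E0 : val e V (@subset_refl _ V) (0 : Pi (tangent M) V) = 0 by exact: operator0.
rewrite !(homog_hpart_eq _ hD).
by case: b {he}; case: (dpar a); rewrite /= E0 linear0 ?addr0 ?add0r;
  exact: hpart_is_homog.
Qed.

Lemma form_coef_dx V (h : V `<=` cdom c) a (b : coord p q) :
  form_coef h a (dxform h b) = (b == a)%:R *: sone V.
Proof. exact: pairing_dx. Qed.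

(* Left multiplication by [e = sum_a e_a dx_a]; moving [dx_a] past the
   coefficient accounts for the twist. *)
Definition form_mul V (h : V `<=` cdom c) (e : Omega1 M V)
  (f : word -> sO M V) : word -> sO M V :=
  fun w => \sum_a smul (form_coef h a e) (creat a (fun u => twist (dpar a) (f u)) w).

Lemma smul_sumr V (I : Type) (r : seq I) (F : I -> sO M V) g :
  smul g (\sum_(i <- r) F i) = \sum_(i <- r) smul g (F i).
Proof. by apply: (big_morph (smul g)) => [x y|]; [exact: smulDr | exact: smul0r]. Qed.

HB.instance Definition _ V (f : sO M V) :=
  GRing.isLinear.Build R (sO M V) (sO M V) *:%R (smul f) (smul_linr f).

Lemma creat_smul V a (g : sO M V) (f : word -> sO M V) w :
  creat a (fun u => smul g (f u)) w = smul g (creat a f w).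
Proof. by rewrite (creat_map (smul g)). Qed.

Lemma twist_creat V a b (f : word -> sO M V) w :
  twist b (creat a f w) = creat a (fun u => twist b (f u)) w.
Proof. by rewrite (creat_map (@twist _ _ (sO M) b V)). Qed.

Lemma twist_smul V b (f g : sO M V) : twist b (smul f g) = smul (twist b f) (twist b g).
Proof.
rewrite -(hpart_sum f) -(hpart_sum g) smulDl !smulDr !twistD smulDl !smulDr.
have H d e : twist b (smul (hpart (sO M) d f) (hpart (sO M) e g)) =
    smul (twist b (hpart (sO M) d f)) (twist b (hpart (sO M) e g)).
  rewrite (twist_homog _ (hpart_is_homog d f)) (twist_homog _ (hpart_is_homog e g)).
  rewrite (twist_homog _ (smul_homog (hpart_is_homog d f) (hpart_is_homog e g))).
  rewrite smulZl smulZr scalerA ksignM; congr (ksign _ _ *: _).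
  by case: b; case: d; case: e.
by rewrite !H.
Qed.

Lemma form_mul_linl V (h : V `<=` cdom c) (f : word -> sO M V) (k : R)
  (e e' : Omega1 M V) w :
  form_mul h (k *: e + e') f w = k *: form_mul h e f w + form_mul h e' f w.
Proof.
rewrite /form_mul scaler_sumr -big_split /=; apply: eq_bigr => a _.
by rewrite form_coefD form_coefZ smulDl smulZl.
Qed.

Lemma form_mul_linr V (h : V `<=` cdom c) (e : Omega1 M V) (k : R)
  (f g : word -> sO M V) w :
  form_mul h e (fun u => k *: f u + g u) w = k *: form_mul h e f w + form_mul h e g w.
Proof.
rewrite /form_mul scaler_sumr -big_split /=; apply: eq_bigr => a _.
rewrite -smulZr -smulDr -creat_lin; congr (smul _ _); apply: eq_creat => u.
by rewrite twistD twistZ.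
Qed.

Lemma form_mul0r V (h : V `<=` cdom c) (e : Omega1 M V) w : form_mul h e (fun=> 0) w = 0.
Proof.
rewrite /form_mul big1 // => a _; rewrite (eq_creat _ (g := fun=> 0)) ?creat0 ?smul0r //.
by move=> u; rewrite linear0.
Qed.

Lemma form_mulZr V (h : V `<=` cdom c) (e : Omega1 M V) (k : R) (f : word -> sO M V) w :
  form_mul h e (fun u => k *: f u) w = k *: form_mul h e f w.
Proof.
rewrite -[RHS]addr0 -(form_mul0r h e w) -form_mul_linr /form_mul; apply: eq_bigr => a _.
by congr (smul _ _); apply: eq_creat => u; rewrite addr0.
Qed.

Lemma form_mul_actl V (h : V `<=` cdom c) (g : sO M V) (e : Omega1 M V)
  (f : word -> sO M V) w :
  form_mul h (sact g e) f w = smul g (form_mul h e f w).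
Proof.
rewrite /form_mul smul_sumr; apply: eq_bigr => a _.
by rewrite form_coef_act smulA.
Qed.

Lemma form_mul_actr V (h : V `<=` cdom c) b d (g : sO M V) (e : Omega1 M V)
  (f : word -> sO M V) w :
  homog b e -> homog d g ->
  form_mul h e (fun u => smul g (f u)) w = ksign R (d && b) *: smul g (form_mul h e f w).
Proof.
move=> he hg; rewrite /form_mul smul_sumr scaler_sumr; apply: eq_bigr => a _.
rewrite (_ : creat a _ w = ksign R (dpar a && d) *: smul g
  (creat a (fun u => twist (dpar a) (f u)) w)).
  rewrite smulZr !smulA (smulC (form_coef_homog h a he) hg) smulZl scalerA ksignM.
  by congr (ksign _ _ *: _); case: b {he}; case: d {hg}; case: (dpar a).
rewrite -creat_smul -creatZ; apply: eq_creat => u.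
by rewrite twist_smul (twist_homog _ hg) smulZl.
Qed.

Lemma form_mul_homog V (h : V `<=` cdom c) b d (e : Omega1 M V) (f : word -> sO M V) :
  homog b e -> (forall w, homog (d (+) wpar w) (f w)) ->
  forall w, homog (b (+) d (+) wpar w) (form_mul h e f w).
Proof.
move=> he hf w; apply: homog_sum => a _.
have H : forall u, homog (d (+) wpar u) (twist (dpar a) (f u)).
  by move=> u; apply: twist_homogP; exact: hf.
rewrite (_ : b (+) d (+) wpar w = b (+) dpar a (+) (d (+) dpar a (+) wpar w)).
  exact: smul_homog (form_coef_homog h a he) (creat_homog a H w).
by case: b {he}; case: d {hf H}; case: (dpar a); case: (wpar w).
Qed.

(** Both sides are expanded over pairs of coordinates. The coefficients are exchanged by [smulC] and
    the creation operators by [creatC]; together with the twists these signs combine to that of e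
    and e'. *)
Lemma form_mul_swap V (h : V `<=` cdom c) b d (e e' : Omega1 M V) (f : word -> sO M V) w :
  homog b e -> homog d e' ->
  form_mul h e (form_mul h e' f) w = ksign R (b && d) *: form_mul h e' (form_mul h e f) w.
Proof.
have X b' d' (e1 e2 : Omega1 M V) : homog b' e1 -> homog d' e2 ->
    form_mul h e1 (form_mul h e2 f) w = \sum_a \sum_a' ksign R
      (dpar a && (d' (+) dpar a')) *:
     smul (smul (form_coef h a e1) (form_coef h a' e2))
       (creat a (creat a' (fun u => twist (dpar a (+) dpar a') (f u))) w).
  move=> h1 h2; apply: eq_bigr => a _.
  rewrite (eq_creat _ (g := fun u => \sum_a' smul
    (ksign R (dpar a && (d' (+) dpar a')) *: form_coef h a' e2)
      (creat a' (fun u => twist (dpar a (+) dpar a') (f u)) u))); last first.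
    move=> u; rewrite /form_mul linear_sum; apply: eq_bigr => a' _ /=.
    rewrite twist_smul (twist_homog _ (form_coef_homog h a' h2)) twist_creat.
    by congr (smul _ _); apply: eq_creat => v; rewrite twistM.
  rewrite creat_sum smul_sumr; apply: eq_bigr => a' _.
  by rewrite creat_smul smulA smulZr smulZl.
move=> he he'; rewrite (X _ _ _ _ he he') (X _ _ _ _ he' he) scaler_sumr exchange_big /=.
apply: eq_bigr => a' _; rewrite scaler_sumr; apply: eq_bigr => a _.
rewrite creatC (smulC (form_coef_homog h a he) (form_coef_homog h a' he')) smulZl smulZr
  !scalerA !ksignM.
rewrite (eq_creat _ (g := creat a (fun u => twist (dpar a' (+) dpar a) (f u))));
  last first.
  by move=> u; apply: eq_creat => v; rewrite addbC.
congr (ksign _ _ *: _).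
by case: b {he}; case: d {he'}; case: (dpar a); case: (dpar a').
Qed.

Lemma form_mul_res V W (hV : V `<=` cdom c) (hW : W `<=` cdom c) (h : W `<=` V)
  (e : Omega1 M V)
    (f : word -> sO M V) w :
  res (sO M) h (form_mul hV e f w) = form_mul hW (res (Omega1 M) h e)
    (fun u => res (sO M) h (f u)) w.
Proof.
rewrite linear_sum; apply: eq_bigr => a _ /=.
rewrite smul_res (form_coef_res hV) (creat_map (res (sO M) h)); congr (smul _ _).
by apply: eq_creat => u /=; rewrite twist_res.
Qed.

(** The vacuum: the function 1 regarded as a 0-form. *)
Definition vac V : word -> sO M V := fun w => if w is [::] then sone V else 0.

Fixpoint form_prod V (h : V `<=` cdom c) k : ('I_k -> Omega1 M V) -> word -> sO M V :=
  match k with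
  | 0 => fun _ => vac V
  | k'.+1 => fun e => form_mul h (e ord0) (form_prod h (fun j => e (lift ord0 j)))
  end.

Lemma eta_with_lift (A : Type) k (e : 'I_k.+1 -> A) (i : 'I_k) (x : A) :
  (fun j => [eta e with lift ord0 i |-> x] (lift ord0 j)) =
  [eta (fun j => e (lift ord0 j)) with i |-> x].
Proof. by apply/funext => j /=; rewrite (inj_eq lift_inj). Qed.

Lemma eq_form_mul V (h : V `<=` cdom c) e f g : f =1 g ->
  form_mul h e f =1 form_mul h e g.
Proof. by move=> fg w; have -> : f = g by apply/funext. Qed.

Lemma form_prod_linear V (h : V `<=` cdom c) k (e : 'I_k -> Omega1 M V) i w (r : R) x y :
  form_prod h [eta e with i |-> r *: x + y] w =
  r *: form_prod h [eta e with i |-> x] w + form_prod h [eta e with i |-> y] w.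
Proof.
elim: k e i w => [|k IHk] e i w; first by case: i.
rewrite /=; case: (unliftP ord0 i) => [j ->|->].
  rewrite !eta_with_lift /= -form_mul_linr; apply: eq_form_mul => u; exact: IHk.
by rewrite form_mul_linl.
Qed.

Lemma form_prod_homog V (h : V `<=` cdom c) k (e : 'I_k -> Omega1 M V)
  (b : 'I_k -> bool) :
  (forall j, homog (b j) (e j)) ->
  forall w, homog (\big[addb/false]_j b j (+) wpar w) (form_prod h e w).
Proof.
elim: k e b => [|k IHk] e b hb w.
  rewrite big_ord0 /=; case: w => [|a w]; last exact: homog0.
  by rewrite wpar_nil; exact: sone_even.
by rewrite big_ord_recl; apply: form_mul_homog => //; apply: IHk => j.
Qed.

Lemma form_prod_act V (h : V `<=` cdom c) k (e : 'I_k -> Omega1 M V) (b : 'I_k -> bool)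
  i d (f : sO M V) w :
  (forall j, homog (b j) (e j)) -> homog d f ->
  form_prod h [eta e with i |-> sact f (e i)] w =
  ksign R (d && \big[addb/false]_(j < k | (j < i)%N) b j) *: smul f (form_prod h e w).
Proof.
elim: k e b i w => [|k IHk] e b i w hb hf; first by case: i.
rewrite /=; case: (unliftP ord0 i) => [j ->|->].
  rewrite eta_with_lift /=.
  rewrite (eq_form_mul _ _ (g := fun u =>
    ksign R (d && \big[addb/false]_(l < k | (l < j)%N) b (lift ord0 l))
     *: smul f (form_prod h (fun j => e (lift ord0 j)) u))); last first.
    move=> u.
    by apply: (IHk (fun j => e (lift ord0 j)) (fun j => b (lift ord0 j)) j u) => // l;
      exact: hb.
  rewrite form_mulZr (form_mul_actr h _ _ (hb ord0) hf) scalerA ksignM.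
  congr (ksign _ _ *: _).
  have -> : \big[addb/false]_(l < k.+1 | (l < lift ord0 j)%N) b l =
      b ord0 (+) \big[addb/false]_(l < k | (l < j)%N) b (lift ord0 l).
    by rewrite big_mkcond big_ord_recl /= -big_mkcond.
  by rewrite -andb_addr addbC.
rewrite form_mul_actl big_pred0 ?andbF /ksign ?expr0 ?scale1r //.
Qed.

Lemma form_prod_sym V (h : V `<=` cdom c) k (e : 'I_k -> Omega1 M V) (b : 'I_k -> bool)
  (i j : 'I_k) w :
  (forall l, homog (b l) (e l)) -> j = i.+1 :> nat ->
  form_prod h (e \o tperm i j) w = ksign R (b i && b j) *: form_prod h e w.
Proof.
elim: k e b i j w => [|k IHk] e b i j w hb ij; first by case: i ij.
case: (unliftP ord0 i) ij => [i' ->|->] ij.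
  case: (unliftP ord0 j) ij => [j' ->|->] // /eq_add_S ij.
  rewrite /= tpermD //.
  have -> : (fun l => e (tperm (lift ord0 i') (lift ord0 j') (lift ord0 l))) =
     (fun l => e (lift ord0 l)) \o tperm i' j'.
    by apply/funext => l /=; rewrite inj_tperm //; exact: lift_inj.
  rewrite (eq_form_mul _ _ (g := fun u =>
    ksign R (b (lift ord0 i') && b (lift ord0 j')) *:
      form_prod h (fun l => e (lift ord0 l)) u)); last first.
    move=> u.
    by apply: (IHk _ (fun j => b (lift ord0 j))) => // l; exact: hb.
  by rewrite form_mulZr.
clear i.
case: k IHk e b j w hb ij => [|k] _ e b j w hb ij; first by case: j ij => [[]].
have -> : j = lift ord0 ord0 by apply: val_inj; rewrite /= ij.
rewrite /= tpermL tpermR (form_mul_swap h _ _ (hb (lift ord0 ord0)) (hb ord0)) andbC.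
congr (_ *: _); apply: eq_form_mul => u; apply: eq_form_mul => v.
by congr (form_prod h _ v); apply/funext => l /=; rewrite tpermD.
Qed.

Lemma form_prod_res V W (hV : V `<=` cdom c) (hW : W `<=` cdom c) (h : W `<=` V) k
    (e : 'I_k -> Omega1 M V) w :
  res (sO M) h (form_prod hV e w) = form_prod hW (fun j => res (Omega1 M) h (e j)) w.
Proof.
elim: k e w => [|k IHk] e w /=.
  by case: w => [|a w] /=; [exact: sone_res | exact: linear0].
by rewrite (form_mul_res hV hW); apply: eq_form_mul => u; exact: IHk.
Qed.

End ChartForms.

(** * Multilinear maps on one-forms are determined by the coordinate forms *)

Section MultilinearExtension.
Variables (R : realType) (M : superspace R) (p q : nat) (c : chart M p q).
Variables (E : smodule M) (V : opens M) (h : V `<=` cdom c) (k : nat).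
Implicit Types (m : ('I_k -> Omega1 M V) -> E V).

Definition superlinear_in_each m : Prop :=
  (forall (e : 'I_k -> Omega1 M V) (i : 'I_k), linear (fun s => m [eta e with i |-> s]))
    /\
  (forall (e : 'I_k -> Omega1 M V) (b : 'I_k -> bool) (i : 'I_k) d (f : sO M V),
    (forall j, homog (b j) (e j)) -> homog d f ->
    m [eta e with i |-> sact f (e i)] =
    ksign R (d && \big[addb/false]_(j < k | (j < i)%N) b j) *: sact f (m e)).

(** One-forms are spanned by the dx_a ([form_expand]), but the rule for extracting a coefficient
    supposes all the arguments homogeneous. Hence two passes: additivity reduces to arguments f dx_a
    with f homogeneous, and then the coefficients are extracted one at a time. *)
Lemma multilinear_ext m m' : superlinear_in_each m -> superlinear_in_each m' ->
  (forall a : 'I_k -> coord p q, m (fun j => dxform h (a j)) = m'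
    (fun j => dxform h (a j))) ->
  m =1 m'.
Proof.
move=> [lm am] [lm' am'] mm'.
pose gen (e : Omega1 M V) := exists b d a (f : sO M V),
  [/\ homog b e, homog d f & e = sact f (dxform h a)].
have set_id (A : Type) (e : 'I_k -> A) (i : 'I_k) : ([eta e with i |-> e i] : 'I_k -> A)
  = e.
  by apply/funext => j /=; case: eqP => [->|].
have gen_eq e : (forall j, gen (e j)) -> m e = m' e.
  move=> ge.
  have {ge}[b Hb] := choice ge; have {Hb}[d Hd] := choice Hb; have {Hd}[a Ha] :=
    choice Hd.
  have {Ha}[f Hf] := choice Ha.
  (* The families [en n] lead from the coordinate forms, at n = 0, to e, at n = k, changing one
     argument at each step. *)
  pose en (n : nat) (j : 'I_k) := if (j < n)%N then e j else dxform h (a j).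
  pose bn (n : nat) (j : 'I_k) := if (j < n)%N then b j else dpar (a j).
  have hn n j : homog (bn n j) (en n j).
    rewrite /bn /en; case: ifP => _; first by have [] := Hf j.
    exact: dxform_homog.
  have step n : m (en n) = m' (en n).
    elim: n => [|n IHn]; first exact: mm'.
    have [nk|nk] := ltnP n k; last first.
      have -> // : en n.+1 = en n.
      by apply/funext => j; rewrite /en !ltnS (leq_trans (ltnW (ltn_ord j)) nk)
        (leq_trans (ltn_ord j) nk).
    pose i := Ordinal nk; have [_ hf Ee] := Hf i.
    have -> : en n.+1 = ([eta en n with i |-> sact (f i) (en n i)] : 'I_k -> Omega1 M V).
      apply/funext => j /=; have [->|ji] := eqVneq j i.
        by rewrite /en /= leqnn ltnn.
      rewrite /en ltnS leq_eqVlt; case: eqP => // jn.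
      by case/eqP: ji; apply: val_inj.
    by rewrite (am _ _ _ _ _ (hn n) hf) (am' _ _ _ _ _ (hn n) hf) IHn.
  have := step k; have -> // : en k = e.
  by apply/funext => j; rewrite /en ltn_ord.
have dec (s : Omega1 M V) : exists (r : seq (bool * coord p q))
  (F : bool * coord p q -> Omega1 M V),
    (forall x, gen (F x)) /\ s = \sum_(x <- r) F x.
  exists ([seq (false, a) | a <- index_enum (coord p q)] ++
    [seq (true, a) | a <- index_enum (coord p q)]).
  exists (fun x => sact (hpart (sO M) x.1 (pairing s (Dfield h x.2))) (dxform h x.2)).
  split.
    move=> [b a] /=; exists (b (+) dpar a), b, a,
      (hpart (sO M) b (pairing s (Dfield h a))).
    split=> //; [|exact: hpart_is_homog].
    by apply: sact_homog; [exact: hpart_is_homog | exact: dxform_homog].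
  rewrite big_cat /= !big_map -big_split /=.
  rewrite [LHS](form_expand h); apply: eq_bigr => a _.
  rewrite -[LHS]/(sact (pairing s (Dfield h a)) (dxform h a))
    -[pairing s _ in LHS]hpart_sum.
  exact: (@sactDl R M (Omega1 M) V _ _ _).
have lsum m1 (l1 : forall (e : 'I_k -> Omega1 M V) (i : 'I_k),
  linear (fun s => m1 [eta e with i |-> s])) e i
    (I : Type) (r : seq I) (F : I -> Omega1 M V) :
    m1 [eta e with i |-> \sum_(x <- r) F x] = \sum_(x <- r) m1 [eta e with i |-> F x] :>
      E V.
  have l0 : m1 [eta e with i |-> 0] = 0.
    have := l1 e i (-1) 0 0; rewrite scaler0 addr0 scaleN1r addNr.
    by [].
  elim: r => [|x r IHr]; first by rewrite !big_nil.
  by rewrite !big_cons -IHr -[F x]scale1r l1 !scale1r.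
move=> e.
(* Here n bounds the positions whose argument is still arbitrary; each step expands the last of
   these into homogeneous multiples of the dx_a. *)
have {}gen_eq n : forall e, (forall j : 'I_k, (n <= j)%N -> gen (e j)) -> m e = m' e.
  elim: n => [|n IHn] e1 he1; first by apply: gen_eq => j; exact: he1.
  have [nk|nk] := ltnP n k; last first.
    by apply: IHn => j nj; have := leq_trans (ltn_ord j) nk; rewrite ltnNge nj.
  pose i := Ordinal nk; have [r [F [gF Fe]]] := dec (e1 i).
  rewrite -(set_id _ e1 i) Fe !lsum //; apply: eq_bigr => x _; apply: IHn => j nj /=.
  case: (eqVneq j i) => [_|ji]; first exact: gF.
  apply: he1; rewrite ltn_neqAle nj andbT.
  by apply: contra ji => /eqP nj'; apply/eqP/val_inj.
by apply: (gen_eq k) => j; rewrite leqNgt ltn_ord.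
Qed.

End MultilinearExtension.

(** * Forms on a chart *)

Arguments wsum_creat {R p q A B k a f} Q _ _.
Arguments eq_wsum {R p q A k f g} _.

Section LocalForms.
Variables (R : realType) (p q : nat) (M : supermanifold R p q) (C : de_rham_complex M).
Variable c : chart M p q.
Local Notation D := (cdom c).
Local Notation word := (seq (coord p q)).
Implicit Types (U V W : opens M) (a : coord p q) (b : bool) (w v u : word) (k : nat).

Definition fockO : smodule M := fock p q (push D (self_smodule M)).

Lemma fockO_sheaf : is_sheaf fockO.
Proof. by apply: fock_sheaf; apply: push_sheaf; exact: sO_sheaf. Qed.

Definition fock_prod_fun k U (e : 'I_k -> Omega1 M U) : fockO U :=
  form_prod (@cap_openr _ U D) (fun j => res (Omega1 M) (@cap_openl _ U D) (e j)).

Lemma fock_prod_res k U V (h : V `<=` U) (e : 'I_k -> Omega1 M U) :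
  res fockO h (fock_prod_fun e) = fock_prod_fun (fun j => res (Omega1 M) h (e j)).
Proof.
apply/funext => w.
rewrite -[LHS]/(res (sO M) (cap_openS D h)
  (form_prod (@cap_openr _ U D) (fun j => res (Omega1 M) (@cap_openl _ U D) (e j)) w)).
rewrite (form_prod_res _ (@cap_openr _ V D)); congr (form_prod _ _ w); apply/funext => j.
by rewrite !(res_comp _ _ (subset_trans (@cap_openl _ V D) h)).
Qed.

Lemma res_eta_with k U V (h : V `<=` U) (e : 'I_k -> Omega1 M U) (i : 'I_k) s :
  (fun j => res (Omega1 M) h ([eta e with i |-> s] j)) =
  [eta (fun j => res (Omega1 M) h (e j)) with i |-> res (Omega1 M) h s].
Proof. by apply/funext => j /=; case: ifP. Qed.

Lemma fock_prod_linear k U (e : 'I_k -> Omega1 M U) (i : 'I_k) :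
  linear (fun s : Omega1 M U => fock_prod_fun [eta e with i |-> s]).
Proof.
move=> r s t; apply/funext => w.
rewrite /fock_prod_fun !res_eta_with linearP form_prod_linear.
by [].
Qed.

Lemma fock_prod_homog k U (e : 'I_k -> Omega1 M U) (b : 'I_k -> bool) :
  (forall j, homog (b j) (e j)) -> homog (\big[addb/false]_j b j) (fock_prod_fun e).
Proof.
move=> hb; apply/fock_homogP => w.
apply: (form_prod_homog (@cap_openr _ U D) (b := b)) => j; exact: homog_res.
Qed.

Lemma fock_prod_act k U (e : 'I_k -> Omega1 M U) (b : 'I_k -> bool) (i : 'I_k) d
  (f : sO M U) :
  (forall j, homog (b j) (e j)) -> homog d f ->
  fock_prod_fun [eta e with i |-> sact f (e i)] =
  ksign R (d && \big[addb/false]_(j < k | (j < i)%N) b j) *: sact f (fock_prod_fun e).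
Proof.
move=> hb hf; apply/funext => w; rewrite /fock_prod_fun res_eta_with sact_res.
apply: (form_prod_act _ i w _ (homog_res _ hf)) => j; exact: homog_res.
Qed.

Lemma fock_prod_sym k U (e : 'I_k -> Omega1 M U) (b : 'I_k -> bool) (i j : 'I_k) :
  (forall l, homog (b l) (e l)) -> j = i.+1 :> nat ->
  fock_prod_fun (e \o tperm i j) = ksign R (b i && b j) *: fock_prod_fun e.
Proof.
move=> hb ij; apply/funext => w.
exact: (form_prod_sym (@cap_openr _ U D)
  (e := fun j => res (Omega1 M) (@cap_openl _ U D) (e j)) w
  (fun l => homog_res _ (hb l)) ij).
Qed.

Definition fock_prod k : supersym_map (Omega1 M) k fockO :=
  SupersymMap (@fock_prod_res k) (@fock_prod_linear k) (@fock_prod_homog k)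
    (@fock_prod_act k) (@fock_prod_sym k).

Lemma fock_hom_ex k : {L : smod_hom (Omega C k) fockO |
  forall U (e : 'I_k -> Omega1 M U), L U (wedge C k U e) = fock_prod k U e}.
Proof.
by apply: cid; have [_ /(_ fockO fockO_sheaf (fock_prod k)) [H _]] := Omega_sym_power C k.
Qed.

Definition fock_hom k := sval (fock_hom_ex k).

Lemma sub_cap_open V (h : V `<=` D) : V `<=` cap_open V D.
Proof. by move=> x Vx; split=> //; exact: h. Qed.

(** For V inside D the opens V and [cap_open V D] have the same points but are different records,
    hence the additional restriction. *)
Definition loc_coefs k V (h : V `<=` D) (s : Omega C k V) : word -> sO M V :=
  fun w => res (sO M) (sub_cap_open h) (fock_hom k V s w).

Lemma loc_coefs_linear k V (h : V `<=` D) (r : R) (s t : Omega C k V) w :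
  loc_coefs h (r *: s + t) w = r *: loc_coefs h s w + loc_coefs h t w.
Proof.
rewrite /loc_coefs linearP.
rewrite -[LHS]/(res (sO M) (sub_cap_open h)
  (r *: (fock_hom k V s w : sO M (cap_open V D)) + fock_hom k V t w)).
by rewrite linearP.
Qed.

Lemma loc_coefs_wedge k V (h : V `<=` D) (e : 'I_k -> Omega1 M V) :
  loc_coefs h (wedge C k V e) = form_prod h e.
Proof.
apply/funext => w; rewrite /loc_coefs (svalP (fock_hom_ex k)).
rewrite -[LHS]/(res (sO M) (sub_cap_open h)
  (form_prod (@cap_openr _ V D) (fun j => res (Omega1 M) (@cap_openl _ V D) (e j)) w)).
rewrite (form_prod_res _ h); congr (form_prod _ _ w); apply/funext => j.
by rewrite (res_comp _ _ (@subset_refl _ V)) res_id.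
Qed.

Lemma loc_coefs_act k V (h : V `<=` D) (f : sO M V) (s : Omega C k V) w :
  loc_coefs h (sact f s) w = smul f (loc_coefs h s w).
Proof.
rewrite /loc_coefs smhom_act.
rewrite -[LHS]/(res (sO M) (sub_cap_open h)
  (smul (res (sO M) (@cap_openl _ V D) f) (fock_hom k V s w))).
by rewrite smul_res (res_comp _ _ (@subset_refl _ V)) res_id.
Qed.

(** Meant for words of length k, for which the default value 0 of [nth] is never reached. *)
Definition word_form k V (h : V `<=` D) w : Omega C k V :=
  wedge C k V (fun j => nth 0 [seq dxform h a | a <- w] j).

Lemma word_form_homog k V (h : V `<=` D) w : size w = k ->
  homog (wpar w) (word_form k h w).
Proof.
move=> sw; have := @ssmap_homog _ _ _ _ _ (wedge C k) V
  (fun j => nth 0 [seq dxform h a | a <- w] j)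
    (fun j => nth false [seq dpar a | a <- w] j).
have -> : \big[addb/false]_(j < k) nth false [seq dpar a | a <- w] j = wpar w.
  by rewrite /wpar -(big_map (@dpar p q) xpredT id) (big_nth false) size_map sw big_mkord.
apply=> j; have jw : (j < size w)%N by rewrite sw.
case: w jw {sw} => [//|a0 w] jw.
by rewrite !(nth_map a0) //; exact: dxform_homog.
Qed.

Lemma word_form_swap k V (h : V `<=` D) u v a (b : coord p q) : (size (u ++ v)).+2 = k ->
  word_form k h (u ++ b :: a :: v) = swap_sign R a b *: word_form k h (u ++ a :: b :: v).
Proof.
rewrite size_cat => sk.
have ik : (size u < k)%N by rewrite -sk ltnW // !ltnS leq_addr.
have jk : ((size u).+1 < k)%N by rewrite -sk !ltnS leq_addr.
pose i := Ordinal ik; pose j := Ordinal jk.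
pose w := u ++ a :: b :: v.
have sw : size w = k by rewrite size_cat /= !addnS.
pose e (l : 'I_k) := nth 0 [seq dxform h x | x <- w] l.
pose bb (l : 'I_k) := nth false [seq dpar x | x <- w] l.
have hb l : homog (bb l) (e l).
  have lw : (l < size w)%N by rewrite sw.
  by rewrite /bb /e !(nth_map a) //; exact: dxform_homog.
have := @ssmap_sym _ _ _ _ _ (wedge C k) V e bb i j hb erefl.
have nthw (T : Type) (x0 : T) (g : coord p q -> T) :
    (nth x0 [seq g x | x <- w] (size u) = g a) *
      (nth x0 [seq g x | x <- w] (size u).+1 = g b).
  rewrite /w map_cat !nth_cat size_map ltnn subnn ltnNge leqnSn /= subSnn.
  by [].
rewrite /bb /i /j /= !nthw -/(swap_sign R a b) => <-.
rewrite /word_form; congr (wedge C k V _); apply/funext => l /=.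
case: tpermP => [->|->|/eqP li /eqP lj].
- by rewrite /e /= nthw map_cat nth_cat size_map ltnn subnn.
- by rewrite /e /= nthw map_cat nth_cat size_map ltnNge leqnSn /= subSnn.
rewrite /e /w !map_cat !nth_cat size_map; case: ltnP => // ul.
have ul2 : ((size u).+2 <= l)%N.
  move: li lj; rewrite -!(inj_eq val_inj) /= => li lj.
  by rewrite ltn_neqAle eq_sym lj ltn_neqAle eq_sym li.
by rewrite -(subnKC ul2) !addSn -!addnS addKn /=.
Qed.

Lemma word_form_res k V W (hV : V `<=` D) (hW : W `<=` D) (h : W `<=` V) w :
  res (Omega C k) h (word_form k hV w) = word_form k hW w.
Proof.
rewrite /word_form ssmap_res; congr (wedge C k W _); apply/funext => j.
elim: w (nat_of_ord j) => [|a w IHw] [|n] /=;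
  [exact: linear0 | exact: linear0 | | exact: IHw].
exact: dxform_res.
Qed.

(** The form with the given coefficients. The factor 1/k! compensates for the k! found in
    [wsum_creats] when a monomial is rebuilt from its values on all words. *)
Definition fock_form k V (h : V `<=` D) (f : word -> sO M V) : Omega C k V :=
  (k`!%:R)^-1 *: wsum k (fun w => sact (f w) (word_form k h w)).

Lemma fact_neq0 k : (k`!%:R : R) != 0.
Proof. by rewrite pnatr_eq0 -lt0n fact_gt0. Qed.

Lemma eq_fock_form k V (h : V `<=` D) f g : (forall w, f w = g w) ->
  fock_form k h f = fock_form k h g.
Proof. by move=> fg; rewrite /fock_form; congr (_ *: _); apply: eq_wsum => w _;
  rewrite fg. Qed.

Lemma fock_form_linear k V (h : V `<=` D) (r : R) f g :
  fock_form k h (fun w => r *: f w + g w) = r *: fock_form k h f + fock_form k h g.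
Proof.
rewrite /fock_form scalerA mulrC -scalerA -scalerDr -wsum_lin; congr (_ *: _).
by apply: eq_wsum => w _; rewrite sactDl sactZl.
Qed.

Lemma fock_form_sum k V (h : V `<=` D) (I : Type) (r : seq I) (F : I -> word -> sO M V) :
  fock_form k h (fun w => \sum_(i <- r) F i w) = \sum_(i <- r) fock_form k h (F i).
Proof.
elim: r => [|i r IHr].
  rewrite big_nil /fock_form (eq_wsum (g := fun=> 0)) ?wsum0 ?scaler0 // => w _.
  by rewrite big_nil sact0l.
rewrite big_cons -IHr -[fock_form k h (F i)]scale1r -fock_form_linear;
  apply: eq_fock_form => w.
by rewrite big_cons scale1r.
Qed.

Lemma fock_form_act k V (h : V `<=` D) (g : sO M V) f :
  fock_form k h (fun w => smul g (f w)) = sact g (fock_form k h f).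
Proof.
rewrite /fock_form sactZr; congr (_ *: _).
have sl : linear (sact g : Omega C k V -> Omega C k V) := sact_linr g.
pose L := HB.pack_for {linear Omega C k V -> Omega C k V}
  (sact g : Omega C k V -> Omega C k V)
  (GRing.isLinear.Build R _ _ *:%R (sact g : Omega C k V -> Omega C k V) sl).
rewrite -[RHS]/(L _) wsum_map; apply: eq_wsum => w _ /=.
by rewrite sactA.
Qed.

Lemma fock_form_creat k V (h : V `<=` D) a f :
  fock_form k.+1 h (creat a f) = (k`!%:R)^-1 *: wsum k
    (fun w => sact (f w) (word_form k.+1 h (a :: w))).
Proof.
rewrite /fock_form (wsum_creat (fun w x => sact x (word_form k.+1 h w))).
- rewrite scalerA; congr (_ *: _).
  rewrite factS natrM invfM mulrAC mulVf ?mul1r //.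
- by move=> w r s t; rewrite sactDl sactZl.
- move=> u v b s suv; rewrite word_form_swap ?sactZr //.
  by rewrite suv.
Qed.

Lemma fock_form_res k V W (hV : V `<=` D) (hW : W `<=` D) (h : W `<=` V) f :
  res (Omega C k) h (fock_form k hV f) = fock_form k hW (fun w => res (sO M) h (f w)).
Proof.
rewrite /fock_form linearZ /= (wsum_map _ (res (Omega C k) h)); congr (_ *: _).
by apply: eq_wsum => w _ /=; rewrite sact_res (word_form_res _ hV hW).
Qed.

Lemma creats_vac V v w :
  creats v (@vac R M p q V) w =
  (creats v (fun u => (u == [::])%:R : R^o) w : R) *: sone V.
Proof.
have sl : linear (fun x : R^o => (x : R) *: sone V : sO M V).
  by move=> r x y; rewrite scalerDl scalerA.
pose L := HB.pack_for {linear R^o -> sO M V} (fun x : R^o => (x : R) *: sone V)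
  (GRing.isLinear.Build R R^o (sO M V) *:%R (fun x : R^o => (x : R) *: sone V) sl).
elim: v w => [|a v IHv] w /=.
  by case: w => [|x w] /=; rewrite ?scale1r ?scale0r.
rewrite (eq_creat _ IHv) -[RHS]/(L _) creat_map.
by [].
Qed.

(** Each use of [wsum_creat] brings the first letter of v to the front and yields one factor of m!.
    The prefix u collects the letters already extracted, so that the induction goes through. *)
Lemma wsum_creats k m V (h : V `<=` D) u v : size v = m -> (size u + m)%N = k ->
  wsum m (fun w => sact (creats v (@vac R M p q V) w) (word_form k h (u ++ w))) =
  m`!%:R *: word_form k h (u ++ v).
Proof.
elim: m u v => [|m IHm] u [|a v] //= sv suv.
  by rewrite scale1r sact1.
rewrite -/(wsum m.+1 (fun w => sact (creat a (creats v (@vac R M p q V)) w)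
  (word_form k h (u ++ w)))).
rewrite (wsum_creat (fun w x => sact x (word_form k h (u ++ w)))).
- rewrite (eq_wsum (g := fun w => sact (creats v (@vac R M p q V) w)
  (word_form k h (rcons u a ++ w)))); last first.
    by move=> w _; rewrite cat_rcons.
  rewrite IHm ?size_rcons -?suv ?addSnnS //; last by case: sv.
  by rewrite cat_rcons scalerA -natrM factS.
- by move=> w r s t; rewrite sactDl sactZl.
- move=> u' v' b s suv'; rewrite !catA word_form_swap ?sactZr //.
  by rewrite -suv -suv' !size_cat !addnS !addnA.
Qed.

Lemma form_prod_dx V (h : V `<=` D) k (a : 'I_k -> coord p q) :
  form_prod h (fun j => dxform h (a j)) = creats [seq a j | j <- enum 'I_k]
    (@vac R M p q V).
Proof.
elim: k a => [|k IHk] a; first by rewrite enum_ord0.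
rewrite enum_ordSl /= -map_comp; apply/funext => w.
rewrite (IHk (a \o lift ord0)) /form_mul (bigD1 (a ord0)) //= big1 => [|b ba].
  rewrite addr0 form_coef_dx eqxx scale1r smul1l; apply: eq_creat => u.
  by rewrite creats_vac twistZ (twist_homog _ (sone_even V)) andbF /ksign expr0 scale1r.
by rewrite form_coef_dx eq_sym (negbTE ba) scale0r smul0l.
Qed.

(** Both sides are superlinear in each argument, so [multilinear_ext] leaves the products of the
    dx_a, where the factorial of [wsum_creats] cancels. *)
Lemma fock_form_prod k V (h : V `<=` D) (e : 'I_k -> Omega1 M V) :
  fock_form k h (form_prod h e) = wedge C k V e.
Proof.
apply: (multilinear_ext (h := h) (m := fun e => fock_form k h (form_prod h e))
  (m' := wedge C k V)).
- split.
    move=> e' i r s t; rewrite -fock_form_linear; apply: eq_fock_form => w.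
    by rewrite form_prod_linear.
  move=> e' b i d f hb hf; rewrite -fock_form_act.
  rewrite -[RHS]addr0 -[X in _ = _ + X](_ : fock_form k h (fun=> 0) = 0); last first.
    by rewrite /fock_form (eq_wsum (g := fun=> 0)) ?wsum0 ?scaler0 // => w _;
      rewrite sact0l.
  rewrite -fock_form_linear; apply: eq_fock_form => w; rewrite addr0.
  exact: form_prod_act.
- split; first by move=> e' i; exact: ssmap_linear.
  by move=> e' b i d f hb hf; exact: ssmap_act.
move=> a; rewrite form_prod_dx /fock_form.
have /= -> := @wsum_creats k k V h [::] [seq a j | j <- enum 'I_k] _ _.
- rewrite scalerA mulVf ?fact_neq0 // scale1r /word_form; congr (wedge C k V _);
  apply/funext => j.
  rewrite -map_comp (nth_map j) ?size_enum_ord // nth_ord_enum.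
  by [].
- by rewrite size_map size_enum_ord.
- by [].
Qed.

End LocalForms.

(** * The differential on the Fock space *)

Section Reconstruction.
Variables (R : realType) (p q : nat) (M : supermanifold R p q) (C : de_rham_complex M).
Variable c : chart M p q.
Local Notation D := (cdom c).
Local Notation word := (seq (coord p q)).
Implicit Types (U V W : opens M) (a : coord p q) (b : bool) (w v u : word).
Variable k : nat.

Let F : smodule M := push D (Omega C k).

Definition restr_fun U (s : Omega C k U) : F U := res (Omega C k) (@cap_openl _ U D) s.

Lemma restr_linear U : linear (@restr_fun U).
Proof. by move=> a s t; exact: linearP. Qed.

HB.instance Definition _ U :=
  GRing.isLinear.Build R (Omega C k U) (F U) *:%R (@restr_fun U) (@restr_linear U).

Lemma restr_res U V (h : V `<=` U) (s : Omega C k U) :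
  restr_fun (res (Omega C k) h s) = res F h (restr_fun s).
Proof.
rewrite /restr_fun /= (res_comp _ _ (subset_trans (@cap_openl _ V D) h)).
by rewrite (res_comp _ _ (subset_trans (@cap_openl _ V D) h)).
Qed.

Definition restr_psh : psh_hom (Omega C k) F := PshHom restr_res.

Lemma restr_even b U (s : Omega C k U) :
  restr_psh U (hpart (Omega C k) b s) = hpart F b (restr_psh U s).
Proof. by rewrite /= /restr_fun -hpart_res. Qed.

Lemma restr_act U (f : sO M U) (s : Omega C k U) :
  restr_psh U (sact f s) = sact f (restr_psh U s).
Proof. by rewrite /= /restr_fun sact_res. Qed.

Definition restr_hom : smod_hom (Omega C k) F := SModHom restr_even restr_act.

Definition rebuild_fun U (s : Omega C k U) : F U :=
  fock_form C k (@cap_openr _ U D) (fock_hom C c k U s : word -> sO M (cap_open U D)).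

Lemma rebuild_linear U : linear (@rebuild_fun U).
Proof.
move=> r s t; rewrite /rebuild_fun linearP -fock_form_linear.
by [].
Qed.

HB.instance Definition _ U :=
  GRing.isLinear.Build R (Omega C k U) (F U) *:%R (@rebuild_fun U) (@rebuild_linear U).

Lemma rebuild_res U V (h : V `<=` U) (s : Omega C k U) :
  rebuild_fun (res (Omega C k) h s) = res F h (rebuild_fun s).
Proof.
rewrite /rebuild_fun phom_res.
rewrite -[RHS]/(res (Omega C k) (cap_openS D h)
  (fock_form C k (@cap_openr _ U D) (fock_hom C c k U s : word -> sO M (cap_open U D)))).
by rewrite (fock_form_res _ _ (@cap_openr _ U D) (@cap_openr _ V D)).
Qed.

Definition rebuild_psh : psh_hom (Omega C k) F := PshHom rebuild_res.

Lemma rebuild_even b U (s : Omega C k U) :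
  rebuild_psh U (hpart (Omega C k) b s) = hpart F b (rebuild_psh U s).
Proof.
rewrite /= /rebuild_fun smhom_even.
rewrite -[RHS]/(hpart (Omega C k) b (fock_form C k (@cap_openr _ U D)
  (fock_hom C c k U s : word -> sO M (cap_open U D)))).
rewrite /fock_form linearZ /= (wsum_map _ (hpart (Omega C k) b)); congr (_ *: _).
apply: eq_wsum => w wk /=.
rewrite -[fock_part _ _ w]/(hpart (sO M) (b (+) wpar w)
  ((fock_hom C c k U s : word -> sO M (cap_open U D)) w)).
set x : sO M (cap_open U D) := (fock_hom C c k U s : word -> _) w.
have ho := word_form_homog C (@cap_openr _ U D) wk.
have hx d := sact_homog (hpart_is_homog d x) ho.
rewrite -[in RHS](hpart_sum x) sactDl linearD /= !(homog_hpart_eq _ (hx _)).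
by case: b; case: (wpar w) => /=; rewrite ?addr0 ?add0r.
Qed.

Lemma rebuild_act U (f : sO M U) (s : Omega C k U) :
  rebuild_psh U (sact f s) = sact f (rebuild_psh U s).
Proof.
rewrite /= /rebuild_fun smhom_act.
rewrite -[RHS]/(sact (res (sO M) (@cap_openl _ U D) f)
  (fock_form C k (@cap_openr _ U D) (fock_hom C c k U s : word -> sO M (cap_open U D)))).
by rewrite -fock_form_act.
Qed.

Definition rebuild_hom : smod_hom (Omega C k) F := SModHom rebuild_even rebuild_act.

(* Both sides are morphisms out of the symmetric power that agree on products. *)
Lemma rebuildE U (s : Omega C k U) : rebuild_hom U s = restr_hom U s.
Proof.
have [shO uni] := Omega_sym_power C k.
have shF : is_sheaf F := push_sheaf D shO.
(* The universal property states uniqueness next to existence, for a given supersymmetric map into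
   F; the restricted product supplies such a map. *)
have mF : supersym_map (Omega1 M) k F.
  pose m U (e : 'I_k -> Omega1 M U) : F U := restr_hom U (wedge C k U e).
  apply: (@SupersymMap R M (Omega1 M) k F m).
  - by move=> U' V h e; rewrite /m -ssmap_res phom_res.
  - by move=> U' e i r x y; rewrite /m ssmap_linear linearP.
  - move=> U' e b hb; rewrite /m /homog -smhom_even.
    by congr (restr_hom _ _); exact: (ssmap_homog _ hb).
  - by move=> U' e b i d f hb hf; rewrite /m (ssmap_act _ _ hb hf) linearZ smhom_act.
  - by move=> U' e b i j hb ij; rewrite /m (ssmap_sym _ hb ij) linearZ.
have [_ +] := uni F shF mF; apply => U' e.
rewrite /= /rebuild_fun /restr_fun (svalP (fock_hom_ex C c k)).
by rewrite [LHS]fock_form_prod ssmap_res.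
Qed.

(** A form over V is determined by its coefficients. Identities between forms are reduced in this
    way to identities between functions on words. *)
Lemma loc_coefsK V (h : V `<=` D) (s : Omega C k V) : fock_form C k h (loc_coefs h s) = s.
Proof.
have E := rebuildE s.
have := congr1 (res (Omega C k) (sub_cap_open h)) E; rewrite /= /rebuild_fun /restr_fun.
rewrite (fock_form_res _ _ (@cap_openr _ V D) h) (res_comp _ _ (@subset_refl _ V)) res_id.
by [].
Qed.

End Reconstruction.

(** * The differential in terms of coefficients *)

Section LocalDifferential.
Variables (R : realType) (p q : nat) (M : supermanifold R p q) (C : de_rham_complex M).
Variable c : chart M p q.
Local Notation D := (cdom c).
Local Notation word := (seq (coord p q)).
Implicit Types (U V W : opens M) (a : coord p q) (b : bool) (w v u : word).

Lemma loc_coefsZ k V (h : V `<=` D) (r : R) (s : Omega C k V) w :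
  loc_coefs h (r *: s) w = r *: loc_coefs h s w.
Proof.
have L0 : loc_coefs h (0 : Omega C k V) w = 0.
  have := loc_coefs_linear h (-1) 0 (0 : Omega C k V) w.
  by rewrite scaler0 addr0 scaleN1r addNr.
by rewrite -[r *: s]addr0 loc_coefs_linear L0 addr0.
Qed.

Lemma loc_coefsD k V (h : V `<=` D) (s t : Omega C k V) w : loc_coefs h (s + t) w =
  loc_coefs h s w + loc_coefs h t w.
Proof. by rewrite -[s]scale1r loc_coefs_linear !scale1r. Qed.

Lemma loc_coefs0 k V (h : V `<=` D) w : loc_coefs h (0 : Omega C k V) w = 0.
Proof. by rewrite -(scale0r 0) loc_coefsZ scale0r. Qed.

Lemma loc_coefs_wsum k m V (h : V `<=` D) (G : word -> Omega C k V) w :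
  loc_coefs h (wsum m G) w = wsum m (fun v => loc_coefs h (G v) w).
Proof.
elim: m G => [|m IHm] G //=.
rewrite (big_morph (fun s => loc_coefs h s w) (fun s t => loc_coefsD h s t w)
  (loc_coefs0 k h w)).
by apply: eq_bigr => a _; exact: IHm.
Qed.

Lemma loc_coefs_word_form k V (h : V `<=` D) w : size w = k ->
  loc_coefs h (word_form C k h w) = creats w (@vac R M p q V).
Proof.
move=> sw; rewrite /word_form loc_coefs_wedge.
case: k sw => [|k] sw; first by case: w sw.
have [a0 [w' Ew]] : exists a0 w', w = a0 :: w' by case: w sw => // x y _; exists x, y.
pose a (j : 'I_k.+1) := nth a0 w j.
have -> : (fun j : 'I_k.+1 => nth 0 [seq dxform h x | x <- w] j) = fun j =>
  dxform h (a j).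
  by apply/funext => j; rewrite (nth_map a0) // sw.
rewrite form_prod_dx; congr (creats _ _).
rewrite -[RHS](mkseq_nth a0) sw /mkseq -val_enum_ord -map_comp.
by [].
Qed.

(* d = sum_a dx_a d/dx_a, with [dx_a] moved past the coefficient. *)
Definition delta V (h : V `<=` D) a (f : sO M V) : sO M V :=
  twist (dpar a) (partial_sec a h f).

Lemma delta_linear V (h : V `<=` D) a : linear (delta h a).
Proof. by move=> r s t; rewrite /delta !linearP. Qed.

HB.instance Definition _ V (h : V `<=` D) a :=
  GRing.isLinear.Build R (sO M V) (sO M V) *:%R (delta h a) (delta_linear h a).

Lemma Dfield_coordinate V (h : V `<=` D) :
  coordinate_fields (c := chart_restrict h) (Dfield h).
Proof. by move=> a W hW f I x Wx; exact: (chcoef_partial_sec a (subset_trans hW h)). Qed.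

Lemma dxform_dual V (h : V `<=` D) : dual_forms (Dfield h) (dxform h).
Proof. by move=> a b; rewrite pairing_dx. Qed.

(** [dR_coord] has its coefficients on the right. Bringing them to the left twists by the parity of
    w before applying d and by that of [a :: w] after it; the share of w cancels and the twist by
    [dpar a] in [delta] remains. *)
Lemma dR_word_form k V (h : V `<=` D) w (f : sO M V) : size w = k ->
  dR C k V (sact f (word_form C k h w)) = \sum_a sact (delta h a f)
    (word_form C k.+1 h (a :: w)).
Proof.
move=> sw.
(* The word as a function on ['I_k]. The case k = 0 is separate because there may be no coordinate
   to serve as a default letter. *)
have [I hI] : exists I : 'I_k -> coord p q,
  forall (T : Type) (x0 : T) (g : coord p q -> T) (j : 'I_k),
  nth x0 [seq g x | x <- w] j = g (I j).
  case: k sw => [|k] sw; first by exists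
    (fun i : 'I_0 => match i with Ordinal _ H => False_rect _ (notF H) end) => T x0 g [].
  case: w sw => // a0 w sw; exists (fun j => nth a0 (a0 :: w) j) => T x0 g j.
  by rewrite (nth_map a0) // sw.
have E0 : (fun j : 'I_k => nth 0 [seq dxform h x | x <- w] j) = dxform h \o I.
  by apply/funext => j; rewrite hI.
have E1 a : (fun j : 'I_k.+1 => nth 0 [seq dxform h x | x <- a :: w] j) =
    consf (dxform h a) (dxform h \o I).
  apply/funext => j; rewrite /consf; case: (unliftP ord0 j) => [i ->|->] //=.
  by rewrite hI.
have Ep : monomial_parity I = wpar w.
  rewrite /monomial_parity /wpar -(big_map (@dpar p q) xpredT id) (big_nth false)
    size_map sw big_mkord.
  by apply: eq_bigr => j _; rewrite hI.
have hw : homog (wpar w) (wedge C k V (dxform h \o I)).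
  by rewrite -E0; exact: word_form_homog.
have haw a : homog (wpar (a :: w)) (wedge C k.+1 V (consf (dxform h a) (dxform h \o I))).
  by rewrite -E1; apply: word_form_homog; rewrite /= sw.
have := @dR_coord _ _ _ _ C (chart_restrict h) (Dfield h) (dxform h)
  (@Dfield_coordinate V h) (@dxform_dual V h) k I (twist (wpar w) f).
rewrite (ract_homog _ hw) twistK Ep /word_form E0 => ->.
apply: eq_bigr => a _; rewrite (ract_homog _ (haw a)) E1.
rewrite -sactZl; congr (sact _ _).
rewrite -[apply_field _ _]/(partial_sec a _ (twist (wpar w) f)).
rewrite (Prop_irrelevance (subset_trans _ h) h) partial_sec_twist twistZ scalerA ksignM.
rewrite [wpar w && _]andbC addbb scale1r twistM wpar_cons.
by rewrite -addbA addbb addbF.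
Qed.

Definition fock_diff V (h : V `<=` D) (f : word -> sO M V) : word -> sO M V :=
  fun w => \sum_a creat a (fun u => delta h a (f u)) w.

Lemma dR_fock_form k V (h : V `<=` D) f : dR C k V (fock_form C k h f) = fock_form C
  k.+1 h (fock_diff h f).
Proof.
rewrite /fock_diff fock_form_sum; under [RHS]eq_bigr do rewrite fock_form_creat.
rewrite -scaler_sumr /fock_form linearZ /= (wsum_map _ (dR C k V)); congr (_ *: _).
rewrite -wsum_sum; apply: eq_wsum => w wk /=.
exact: dR_word_form.
Qed.

(** The right side projects functions on words onto combinations of monomials, and the coefficients
    of a form are fixed by it. This stands in for the symmetry that the Fock space does not
    impose. *)
Lemma loc_coefs_expand k V (h : V `<=` D) (s : Omega C k V) u :
  loc_coefs h s u = (k`!%:R)^-1 *: wsum k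
    (fun w => smul (loc_coefs h s w) (creats w (@vac R M p q V) u)).
Proof.
rewrite -[in LHS](loc_coefsK h s) /fock_form loc_coefsZ loc_coefs_wsum; congr (_ *: _).
by apply: eq_wsum => w wk; rewrite loc_coefs_act loc_coefs_word_form.
Qed.

Lemma delta_creats V (h : V `<=` D) a (g : sO M V) v u :
  delta h a (smul g (creats v (@vac R M p q V) u)) =
  smul (delta h a g) (creats v (@vac R M p q V) u).
Proof. by rewrite creats_vac !smulZr !smul1r linearZ. Qed.

Lemma creat_wsum (A : lmodType R) a m (G : word -> word -> A) u :
  creat a (fun x => wsum m (fun v => G v x)) u = wsum m (fun v => creat a (G v) u).
Proof.
elim: m G => [|m IHm] G //=.
by rewrite creat_sum; apply: eq_bigr => b _; exact: IHm.
Qed.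

(** Expanding s in monomials reduces the left side to [dR_word_form]. On the right, [delta] sees
    only the coefficients, since monomials take values in real multiples of 1 ([delta_creats]). *)
Lemma loc_coefs_dR k V (h : V `<=` D) (s : Omega C k V) u :
  loc_coefs h (dR C k V s) u = fock_diff h (loc_coefs h s) u.
Proof.
have -> : dR C k V s = (k`!%:R)^-1 *: wsum k
  (fun w => \sum_a sact (delta h a (loc_coefs h s w)) (word_form C k.+1 h (a :: w))).
  rewrite -[in LHS](loc_coefsK h s) /fock_form linearZ /= (wsum_map _ (dR C k V));
    congr (_ *: _).
  by apply: eq_wsum => w wk /=; exact: dR_word_form.
rewrite loc_coefsZ loc_coefs_wsum /fock_diff.
under [RHS]eq_bigr => a _.
  rewrite (eq_creat _ (g := fun x => (k`!%:R)^-1 *: wsum k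
    (fun w => smul (delta h a (loc_coefs h s w))
      (creats w (@vac R M p q V) x)))); last first.
    move=> x; rewrite loc_coefs_expand linearZ /= (wsum_map _ (delta h a));
      congr (_ *: _).
    by apply: eq_wsum => w _ /=; exact: delta_creats.
  rewrite creatZ creat_wsum; over.
rewrite -scaler_sumr -wsum_sum; congr (_ *: _); apply: eq_wsum => w wk.
rewrite (big_morph (fun s => loc_coefs h s u) (fun s t => loc_coefsD h s t u)
  (loc_coefs0 k.+1 h u)).
apply: eq_bigr => a _; rewrite loc_coefs_act loc_coefs_word_form /= ?wk //.
by rewrite creat_smul.
Qed.

Lemma number_wsum (A : lmodType R) m (G : word -> word -> A) u :
  number (fun x => wsum m (fun v => G v x)) u = wsum m (fun v => number (G v) u).
Proof.
rewrite /number wsum_sum; apply: eq_bigr => a _.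
by rewrite -creat_wsum.
Qed.

(** This fails for a general function on words; it holds on monomials by [number_creats], and on
    coefficients of forms by expansion in monomials. *)
Lemma number_loc_coefs k V (h : V `<=` D) (s : Omega C k V) u :
  number (loc_coefs h s) u = k%:R *: loc_coefs h s u.
Proof.
have vac0 w : number (@vac R M p q V) w = 0.
  by rewrite /number big1 // => a _; rewrite (eq_creat _ (g := fun=> 0)) ?creat0.
rewrite [X in number X u](_ : _ = (fun u => (k`!%:R)^-1 *:
    wsum k (fun w => smul (loc_coefs h s w) (creats w (@vac R M p q V) u)))); last first.
  by apply/funext => x; exact: loc_coefs_expand.
have nZ (r : R) (f : word -> sO M V) x : number (fun u => r *: f u) x = r *: number f x.
  by rewrite /number scaler_sumr; apply: eq_bigr => a _; rewrite -creatZ.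
rewrite nZ number_wsum [in RHS]loc_coefs_expand [RHS]scalerA [k%:R * _]mulrC
  -[RHS]scalerA -[in RHS]wsumZ.
congr (_ *: _).
apply: eq_wsum => w wk.
have -> : number (fun x => smul (loc_coefs h s w) (creats w (@vac R M p q V) x)) u =
   smul (loc_coefs h s w) (number (creats w (@vac R M p q V)) u).
  by rewrite /number smul_sumr; apply: eq_bigr => a _; rewrite -creat_smul.
by rewrite number_creats // smulZr wk.
Qed.

Lemma deltaC V (h : V `<=` D) a (b : coord p q) (f : sO M V) :
  delta h b (delta h a f) = - (swap_sign R a b *: delta h a (delta h b f)).
Proof.
rewrite /delta !partial_sec_twist !twistZ !twistM partial_secC twistZ
  [dpar b (+) _]addbC !scalerA.
rewrite -scaleNr; congr (_ *: _).
rewrite /swap_sign !ksignM -mulN1r -[-1]/(ksign R true) !ksignM; congr (ksign R _).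
by rewrite /dpar; case: (cpar a); case: (cpar b).
Qed.

(** The creation operators commute up to [swap_sign], the operators [delta] up to its opposite
    ([deltaC]). Exchanging the two summation indices therefore reverses the sign of the double sum,
    and 2 is invertible. *)
Lemma fock_diff_fock_diff V (h : V `<=` D) (f : word -> sO M V) u : fock_diff h
  (fock_diff h f) u = 0.
Proof.
have E : fock_diff h (fock_diff h f) u = \sum_b \sum_a creat b
  (creat a (fun x => delta h b (delta h a (f x)))) u.
  apply: eq_bigr => b _.
  rewrite (eq_creat _ (g := fun x => \sum_a creat a
    (fun y => delta h b (delta h a (f y))) x)).
    by rewrite creat_sum.
  move=> x; rewrite /fock_diff linear_sum; apply: eq_bigr => a _ /=.
  by rewrite (creat_map (delta h b)).
have N : fock_diff h (fock_diff h f) u = - fock_diff h (fock_diff h f) u.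
  rewrite {1}E exchange_big {1}E -sumrN; apply: eq_bigr => b _.
  rewrite -sumrN; apply: eq_bigr => a _.
  rewrite creatC.
  rewrite (eq_creat _ (g := fun x => - swap_sign R b a *: creat a
    (fun y => delta h b (delta h a (f y))) x)); last first.
    move=> x; rewrite -creatZ; apply: eq_creat => y.
    by rewrite deltaC scaleNr.
  by rewrite creatZ scalerA mulrN swap_signC swap_signK scaleN1r.
have : 2%:R *: fock_diff h (fock_diff h f) u = 0.
  by rewrite scaler_nat mulr2n {1}N addNr.
by move/eqP; rewrite scaler_eq0 pnatr_eq0 => /eqP.
Qed.

(** A [de_rham_complex] records only the coordinate formula for d, so that d^2 = 0 has to be
    derived. *)
Lemma dR_dR_local k V (h : V `<=` D) (s : Omega C k V) : dR C k.+1 V (dR C k V s) = 0.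
Proof.
rewrite -(loc_coefsK h (dR C k.+1 V _)) -[RHS](loc_coefsK h 0); apply: eq_fock_form => w.
rewrite loc_coefs0 loc_coefs_dR -[RHS](fock_diff_fock_diff h (loc_coefs h s) w)
  /fock_diff; apply: eq_bigr => a _.
by apply: eq_creat => x; rewrite loc_coefs_dR.
Qed.

End LocalDifferential.

(** * The homotopy *)

Section Homotopy.
Variables (R : realType) (p q : nat) (M : supermanifold R p q) (C : de_rham_complex M).
Variable c : chart M p q.
Local Notation D := (cdom c).
Local Notation cpt V := (cmap c @` V).
Local Notation word := (seq (coord p q)).
Variables (V : opens M) (h : V `<=` D) (o : 'rV[R]_p).
Hypothesis st : starred o (cpt V).
Implicit Types (a : coord p q) (b : bool) (w v u : word) (f g : sO M V).

Let oV : open (cpt V) := chart_image_open h.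
Let star : forall x (t : R), cpt V x -> 0 <= t <= 1 -> cpt V (t *: (x - o) + o) := st.2.

Definition radial_sec (k : nat) f : sO M V :=
  section_of h (coefs_radial o k (chcoef h f)).

Lemma chcoef_radial_sec k f I x : cpt V x ->
  chcoef h (radial_sec k f) I x = coefs_radial o k (chcoef h f) I x.
Proof.
by move=> Vx; apply: section_ofP => //; apply: (coefs_radial_smooth oV star);
  exact: chcoef_smooth_coefs.
Qed.

Lemma radial_sec_linear k : linear (radial_sec k).
Proof.
move=> r f g; apply: (chcoef_inj (h := h)) => I x Vx.
rewrite chcoef_linear // !chcoef_radial_sec // /coefs_radial.
rewrite -(radial_lin star) //; [|exact: chcoef_smooth..].
by apply: (radial_eq star) => // y Vy; rewrite chcoef_linear.
Qed.

HB.instance Definition _ k :=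
  GRing.isLinear.Build R (sO M V) (sO M V) *:%R (radial_sec k) (radial_sec_linear k).

Lemma partial_radial_sec a k f : partial_sec a h (radial_sec k f) = radial_sec k.+1
  (partial_sec a h f).
Proof.
apply: (chcoef_inj (h := h)) => I x Vx.
rewrite chcoef_partial_sec // chcoef_radial_sec //.
rewrite (coefs_partial_eq oV _ (G := coefs_radial o k (chcoef h f))) //; last first.
  by move=> J y Vy; rewrite chcoef_radial_sec.
rewrite (coefs_partial_radial oV star) //; last exact: chcoef_smooth_coefs.
by apply: (radial_eq star) => // y Vy; rewrite chcoef_partial_sec.
Qed.

Lemma twist_radial_sec b k f : twist b (radial_sec k f) = radial_sec k (twist b f).
Proof.
apply: (chcoef_inj (h := h)) => I x Vx.
rewrite chcoef_twist // /twist_coefs !chcoef_radial_sec // /coefs_radial.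
rewrite -(radialZ oV star) //; last exact: chcoef_smooth.
by apply: (radial_eq star) => // y Vy; rewrite chcoef_twist.
Qed.

Lemma radial_sec_euler k f :
  \sum_a smul (coordsec o a h) (partial_sec a h (radial_sec k f)) +
    k.+1%:R *: radial_sec k f = f.
Proof.
apply: (chcoef_inj (h := h)) => I x Vx.
rewrite chcoefD // chcoefZ // chcoef_sum // chcoef_radial_sec //.
rewrite -[RHS](coefs_radial_euler oV star k (chcoef_smooth_coefs h f) I Vx);
  congr (_ + _).
apply: eq_bigr => a _; rewrite chcoef_mul // /coefs_mul; apply: eq_bigr => J _.
rewrite chcoef_coordsec // chcoef_partial_sec //; congr (_ * _).
by apply: (coefs_partial_eq oV) => // K y Vy; rewrite chcoef_radial_sec.
Qed.

(** The action on coefficients of the contraction with x_a d/dx_a. The contraction with d/dx_a has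
    parity [dpar a], hence the twist. The name does not refer to an odd coordinate. *)
Definition theta a f : sO M V := smul (coordsec o a h) (twist (dpar a) f).

Lemma theta_linear a : linear (theta a).
Proof. by move=> r f g; rewrite /theta !linearP. Qed.

HB.instance Definition _ a :=
  GRing.isLinear.Build R (sO M V) (sO M V) *:%R (theta a) (theta_linear a).

Definition iota_euler (F : word -> sO M V) : word -> sO M V :=
  fun w => \sum_a theta a (annih a F w).

(** The Leibniz rule for x_a, rewritten as a commutation relation whose sign is opposite to that of
    [annih_creat]. *)
Lemma delta_theta a (b : coord p q) f :
  delta h b (theta a f) + swap_sign R b a *: theta a (delta h b f) = (b == a)%:R *: f.
Proof.
have hx := coordsec_homog o a h.
rewrite /delta /theta partial_sec_mul partial_sec_coordsec smulZl smul1l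
  (twist_homog (cpar b) hx) smulZl.
rewrite twistD !twistZ.
rewrite -addrA -[RHS]addr0; congr (_ + _).
  by case: eqP => [->|_]; rewrite ?scale0r // twistM addbb twist0.
rewrite partial_sec_twist twist_smul (twist_homog _ hx) smulZl !twistZ !twistM smulZr
  !scalerA !ksignM.
rewrite [dpar b (+) _]addbC -scalerDl.
set k := (X in X *: _); suff -> : k = 0 by rewrite scale0r.
rewrite /k /swap_sign.
by rewrite /ksign /dpar; case: (cpar a); case: (cpar b); rewrite /= ?expr0 ?expr1; ring.
Qed.

(** In i_E d the diagonal term of [annih_creat] gives x_a d/dx_a. The terms that remain combine with
    those of d i_E through [delta_theta], which leaves creation after annihilation of the same
    letter, that is, [number]. *)
Lemma cartan (F : word -> sO M V) w :
  fock_diff h (iota_euler F) w + iota_euler (fock_diff h F) w =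
  \sum_a smul (coordsec o a h) (partial_sec a h (F w)) + number F w.
Proof.
have E1 : fock_diff h (iota_euler F) w =
    \sum_b \sum_a creat b (fun u => delta h b (theta a (annih a F u))) w.
  apply: eq_bigr => b _; rewrite -creat_sum; apply: eq_creat => u.
  by rewrite /iota_euler linear_sum.
have E2 : iota_euler (fock_diff h F) w = \sum_a theta a (delta h a (F w)) +
    \sum_b \sum_a creat b (fun u => swap_sign R b a *: theta a
      (delta h b (annih a F u))) w.
  rewrite exchange_big -big_split; apply: eq_bigr => a _ /=.
  rewrite /annih /fock_diff linear_sum /=.
  under eq_bigr => b _.
    rewrite linearD linearZ /= (creat_map (theta a)) -creatZ; over.
  rewrite big_split /=; congr (_ + _).
  rewrite (bigD1 a) //= eqxx big1 ?addr0 // => b ba.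
  by rewrite (negbTE ba) linear0.
rewrite E1 E2 addrCA; congr (_ + _).
  by apply: eq_bigr => a _; rewrite /theta /delta twistM addbb twist0.
rewrite -big_split /number; apply: eq_bigr => b _ /=.
rewrite -big_split /= (bigD1 b) //= big1 ?addr0 => [|a ab].
  rewrite -creatD; apply: eq_creat => u.
  by rewrite delta_theta eqxx scale1r.
rewrite -creatD -[RHS](creat0 _ b w); apply: eq_creat => u.
by rewrite delta_theta eq_sym (negbTE ab) scale0r.
Qed.

Lemma poincare_star k (s : Omega C k.+1 V) : dR C k.+1 V s = 0 ->
  exists eta : Omega C k V, dR C k V eta = s.
Proof.
move=> ds; pose F := loc_coefs h s; pose G w := radial_sec k (F w).
have fock_diff0 w : fock_diff h G w = 0.
  (* The radial operator commutes with d, with the index k replaced by k + 1, because it does so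
     with each partial derivative and each twist. *)
  have -> : fock_diff h G w = radial_sec k.+1 (fock_diff h F w).
    rewrite linear_sum; apply: eq_bigr => a _ /=.
    rewrite (creat_map (radial_sec k.+1)); apply: eq_creat => u /=.
    by rewrite /delta /G partial_radial_sec twist_radial_sec.
  by rewrite -loc_coefs_dR ds loc_coefs0 linear0.
(* The function [iota_euler G] is not known to be the coefficients of a form; [dR_fock_form] holds
   for every function on words, and the comparison is with the coefficients of s. *)
exists (fock_form C k h (iota_euler G)); rewrite dR_fock_form -[RHS](loc_coefsK h);
  apply: eq_fock_form => w.
have := cartan G w.
have -> : iota_euler (fock_diff h G) w = 0.
  by rewrite /iota_euler big1 // => a _; rewrite /annih fock_diff0 linear0.
rewrite addr0 => ->.
(* [number_loc_coefs] is available for F, the coefficients of s; it carries over to G because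
   [number] permutes letters only and commutes with an operator on coefficients. *)
have -> : number G w = k.+1%:R *: G w.
  have -> : number G w = radial_sec k (number F w).
    rewrite linear_sum; apply: eq_bigr => a _ /=.
    by rewrite (creat_map (radial_sec k)).
  by rewrite number_loc_coefs linearZ.
exact: radial_sec_euler.
Qed.

(** In the expansion of [section_hadamard] every term but the constant contains a partial derivative
    of f. *)
Lemma partial_sec_eq0_constant f : (forall a, partial_sec a h f = 0) ->
  f = chcoef h f finset.set0 o *: sone V.
Proof.
move=> f0; rewrite [LHS](section_hadamard h st) big1 ?addr0 // => a _.
have -> : section_of h (coefs_radial o 0 (coefs_partial a (chcoef h f))) = 0.
  apply: (chcoef_inj (h := h)) => I x Vx; rewrite chcoef0 // section_ofP //; last first.
    apply: (coefs_radial_smooth oV star); apply: (coefs_partial_smooth oV).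
    exact: chcoef_smooth_coefs.
  rewrite -[RHS](radial0 o (#|I| + 0) x); apply: (radial_eq star) => // y Vy.
  by rewrite -chcoef_partial_sec // f0 chcoef0.
by rewrite smul0r.
Qed.

(** The coefficient of ds at the one-letter word a is, up to a twist, the derivative along x_a of
    the function representing s. *)
Lemma closed0_constant (s : Omega C 0 V) : dR C 0 V s = 0 ->
  exists r : R, s = r *: wedge C 0 V (fun=> 0).
Proof.
move=> ds; have word_formE : word_form C 0 h [::] = wedge C 0 V (fun=> 0).
  by rewrite /word_form; congr (wedge C 0 V _); apply/funext => -[].
have E : s = sact (loc_coefs h s [::]) (wedge C 0 V (fun=> 0)).
  by rewrite -[LHS](loc_coefsK h) /fock_form /= fact0 invr1 scale1r word_formE.
exists (chcoef h (loc_coefs h s [::]) finset.set0 o).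
rewrite [LHS]E {1}[loc_coefs h s [::]]partial_sec_eq0_constant ?sactZl ?sact1 // => a.
have := loc_coefs_dR h s [:: a]; rewrite ds loc_coefs0 /fock_diff.
rewrite (bigD1 a) //= eqxx scaler0 addr0 big1 ?addr0 => [E0|b ba].
  by rewrite -[partial_sec _ _ _](twistK (dpar a)) -[X in twist _ X]/(delta h a _) -E0
    linear0.
by rewrite (negbTE ba) scaler0 addr0.
Qed.

End Homotopy.

(** * Cohomology sheaves *)

Section DeRham.
Variables (R : realType) (p q : nat) (M : supermanifold R p q) (C : de_rham_complex M).
Implicit Types (U V W : opens M) (k : nat) (x : M).

Lemma Omega_sheaf k : is_sheaf (Omega C k).
Proof. by have [] := Omega_sym_power C k. Qed.

Lemma local_chart U x : U x -> exists (c : chart M p q) V (hU : V `<=` U)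
  (h : V `<=` cdom c) o,
  V x /\ starred o (cmap c @` V).
Proof.
move=> Ux; have [c cx] := smspace_charts x.
have [V [hV [Vx st]]] := @ball_chart _ _ _ _ c (cap_open U (cdom c))
  (@cap_openr _ U (cdom c)) x (conj Ux cx).
exists c, V, (subset_trans hV (@cap_openl _ U (cdom c))),
  (subset_trans hV (@cap_openr _ U (cdom c))).
by exists (cmap c x).
Qed.

Lemma dR_dR k U (s : Omega C k U) : dR C k.+1 U (dR C k U s) = 0.
Proof.
apply: (sheaf_sep (Omega_sheaf _)) => x Ux.
have [c [V [hU [h [y [Vx _]]]]]] := local_chart Ux.
by exists V, hU; split=> //; rewrite -!phom_res (dR_dR_local h) linear0.
Qed.

Lemma dR_locally_exact : closed_locally_exact C.
Proof.
move=> k U w dw x Ux; have [c [V [hU [h [y [Vx st]]]]]] := local_chart Ux.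
have [|eta E] := @poincare_star _ _ _ _ C c V h y st k (res (Omega C k.+1) hU w).
  by rewrite phom_res dw linear0.
by exists V, hU, eta.
Qed.

(** The constant function 1. [Omega C 0] is known only as a zeroth symmetric power, so 1 has to be
    taken as the empty product. *)
Definition unit0 U : Omega C 0 U := wedge C 0 U (fun=> 0).

Lemma unit0_res U V (h : V `<=` U) : res (Omega C 0) h (unit0 U) = unit0 V.
Proof. by rewrite /unit0 ssmap_res; congr (wedge C 0 V _); apply/funext => -[]. Qed.

(** In a chart around x the coefficient at the empty word, evaluated at x, recovers the factor;
    hence the need for a point. *)
Lemma unit0_inj V x (r r' : R) : V x -> r *: unit0 V = r' *: unit0 V -> r = r'.
Proof.
move=> Vx E; have [c [W [hV [h [y [Wx st]]]]]] := local_chart Vx.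
have := congr1 (fun s => loc_coefs h (res (Omega C 0) hV s) [::]) E.
rewrite !linearZ /= !unit0_res !loc_coefsZ /unit0 loc_coefs_wedge /= /vac.
have cx : (cmap c @` W) (cmap c x) by exists x.
move=> /(congr1 (fun s => chcoef h s finset.set0 (cmap c x))).
by rewrite !chcoefZ // chcoef_one // /coefs_one eqxx !mulr1.
Qed.

Lemma dR_unit0 U : dR C 0 U (unit0 U) = 0.
Proof.
apply: (sheaf_sep (Omega_sheaf _)) => x Ux.
have [c [V [hU [h [y [Vx _]]]]]] := local_chart Ux.
exists V, hU; split=> //; rewrite -phom_res unit0_res linear0.
have -> : unit0 V = sact (sone V) (word_form C 0 h [::]).
  by rewrite sact1 /word_form /unit0; congr (wedge C 0 V _); apply/funext => -[].
rewrite (dR_word_form C h (w := [::])) // big1 // => a _.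
by rewrite /delta partial_sec_one linear0 sact0l.
Qed.

(** Separation for the covering of the empty set by the empty family. *)
Lemma sheaf_empty (F : presheaf R M) U (s t : F U) : is_sheaf F -> (forall x, ~ U x) ->
  s = t.
Proof.
move=> [sep _] U0; apply: (sep U False (fun=> U) (fun=> @subset_refl _ U)) => //.
by move=> x /U0.
Qed.

Definition constant_on U (f : points U -> R) V (r : R) : Prop :=
  forall y : points U, V (sval y) -> f y = r.

(** The opens on which f is constant cover U, so t is determined. Quantifying over all of them, and
    not over a chosen covering, makes the specification pass to restrictions. *)
Definition eps_spec U (f : points U -> R) (t : Omega C 0 U) : Prop :=
  forall V (h : V `<=` U) r, constant_on f V r -> res (Omega C 0) h t = r *: unit0 V.

Lemma locconst_near U (f : locconst R U) x : U x ->
  exists V (h : V `<=` U) r, V x /\ constant_on (val f) V r.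
Proof.
move=> Ux; have [V [Vx Vf]] := asboolP _ (valP f) (exist _ x Ux).
exists (cap_open U V), (@cap_openl _ U V), (val f (exist _ x Ux)); split=> // y [_ Vy].
exact: Vf.
Qed.

Lemma eps_spec_uniq U (f : locconst R U) (t t' : Omega C 0 U) :
  eps_spec (val f) t -> eps_spec (val f) t' -> t = t'.
Proof.
move=> ht ht'; apply: (sheaf_sep (Omega_sheaf 0)) => x Ux.
have [V [h [r [Vx Vf]]]] := locconst_near f Ux.
by exists V, h; split=> //; rewrite (ht V h r Vf) (ht' V h r Vf).
Qed.

(** Over an empty V every r satisfies [constant_on], so r and r' themselves need not agree; their
    multiples of [unit0 V] do. *)
Lemma constant_eq U (f : points U -> R) V (h : V `<=` U) r r' :
  constant_on f V r -> constant_on f V r' -> r *: unit0 V = r' *: unit0 V.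
Proof.
move=> hr hr'; have [[x Vx]|V0] := pselect (exists x, V x).
  by rewrite -(hr (exist _ x (h _ Vx)) Vx) (hr' (exist _ x (h _ Vx)) Vx).
by apply: sheaf_empty => [|x Vx]; [exact: Omega_sheaf | apply: V0; exists x].
Qed.

Lemma constant_onS U (f : points U -> R) V W r : W `<=` V -> constant_on f V r ->
  constant_on f W r.
Proof. by move=> WV Vf y /WV; exact: Vf. Qed.

(** Around each point a multiple of [unit0] is prescribed; [constant_eq] gives agreement on
    overlaps, and the glued section is then compared on any V where f is constant. *)
Lemma eps_ex U (f : locconst R U) : {t : Omega C 0 U | eps_spec (val f) t}.
Proof.
apply: cid.
have N (i : points U) : {Vr : opens M * R |
  [/\ Vr.1 `<=` U, Vr.1 (sval i) & constant_on (val f) Vr.1 Vr.2]}.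
  apply: cid; have [V [h [r [Vx Vf]]]] := locconst_near f (svalP i).
  by exists (V, r).
pose V i := (sval (N i)).1; pose r i := (sval (N i)).2.
have hV i : V i `<=` U by have [] := svalP (N i).
have Vi i : V i (sval i) by have [] := svalP (N i).
have Vf i : constant_on (val f) (V i) (r i) by have [] := svalP (N i).
have [_ glue] := Omega_sheaf 0.
have [||t ht] := glue U (points U) V hV (fun i => r i *: unit0 (V i)).
- by move=> x Ux; exists (exist _ x Ux); exact: Vi.
- move=> i j W hi hj; rewrite !linearZ /= !unit0_res.
  apply: (@constant_eq U (val f) W (subset_trans hi (hV i))).
    exact: constant_onS hi (Vf i).
  exact: constant_onS hj (Vf j).
exists t => W hW s Ws; apply: (sheaf_sep (Omega_sheaf 0)) => x Wx.
pose i : points U := exist _ x (hW _ Wx).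
exists (cap_open W (V i)), (@cap_openl _ W (V i)); split; first by split=> //;
  exact: (Vi i).
rewrite (res_comp _ _ (subset_trans (@cap_openl _ W (V i)) hW)).
rewrite -(res_comp (hV i) (@cap_openr _ W (V i))
  (subset_trans (@cap_openl _ W (V i)) hW)) ht.
rewrite !linearZ /= !unit0_res.
apply: (@constant_eq U (val f) _ (subset_trans (@cap_openl _ W (V i)) hW)).
  exact: constant_onS (@cap_openr _ W (V i)) (Vf i).
exact: constant_onS (@cap_openl _ W (V i)) Ws.
Qed.

Definition eps_fun U (f : locconst_psh R M U) : Omega C 0 U := sval (eps_ex f).

Lemma eps_funP U (f : locconst_psh R M U) : eps_spec (val f) (eps_fun f).
Proof. exact: (svalP (eps_ex f)). Qed.

Lemma eps_linear U : linear (@eps_fun U).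
Proof.
move=> a f g; apply: (sheaf_sep (Omega_sheaf 0)) => x Ux.
have [V [hV [r [Vx Vf]]]] := locconst_near f Ux.
have [W [hW [s [Wx Wg]]]] := locconst_near g Ux.
have h := subset_trans (@cap_openl _ V W) hV.
have hf : constant_on (val f) (cap_open V W) r := constant_onS (@cap_openl _ V W) Vf.
have hg : constant_on (val g) (cap_open V W) s := constant_onS (@cap_openr _ V W) Wg.
exists (cap_open V W), h; split=> //.
rewrite linearP (eps_funP h hf) (eps_funP h hg).
rewrite (eps_funP h (r := a * r + s)) ?scalerDl ?scalerA // => y hy.
by rewrite -(hf y hy) -(hg y hy).
Qed.

HB.instance Definition _ U :=
  GRing.isLinear.Build R (locconst_psh R M U) (Omega C 0 U) *:%R (@eps_fun U)
    (@eps_linear U).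

Lemma eps_res U V (h : V `<=` U) (f : locconst_psh R M U) :
  eps_fun (res (locconst_psh R M) h f) = res (Omega C 0) h (eps_fun f).
Proof.
apply: (eps_spec_uniq (f := res (locconst_psh R M) h f)); first exact: eps_funP.
move=> W hW r Wf; rewrite (res_comp _ _ (subset_trans hW h)).
apply: eps_funP => -[y Uy] /= Wy.
rewrite -(Wf (exist _ y (hW _ Wy)) Wy) /=; congr (val f _).
by congr exist; exact: Prop_irrelevance.
Qed.

Definition eps : psh_hom (locconst_psh R M) (Omega C 0) := PshHom eps_res.

Lemma eps_augmentation : is_augmentation eps.
Proof.
move=> U a e; have := @eps_funP U (locconst_cst U a) U (@subset_refl _ U) a.
rewrite res_id /= => ->; last by [].
by congr (_ *: wedge C 0 U _); apply/funext => -[].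
Qed.

Lemma eps_cst U (a : R) : eps U (locconst_cst U a) = a *: unit0 U.
Proof. exact: eps_augmentation. Qed.

Lemma eps_injective U : injective (eps U).
Proof.
move=> f g E; apply: val_inj; apply/funext => -[x Ux].
have [V [hV [r [Vx Vf]]]] := locconst_near f Ux.
have [W [hW [s [Wx Wg]]]] := locconst_near g Ux.
have h := subset_trans (@cap_openl _ V W) hV.
have hf : constant_on (val f) (cap_open V W) r := constant_onS (@cap_openl _ V W) Vf.
have hg : constant_on (val g) (cap_open V W) s := constant_onS (@cap_openr _ V W) Wg.
have Hx : cap_open V W x by [].
rewrite (hf (exist _ x Ux) Hx) (hg (exist _ x Ux) Hx).
apply: (unit0_inj Hx); rewrite -(eps_funP h hf) -(eps_funP h hg).
by rewrite -[eps_fun f]/(eps U f) E.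
Qed.

Lemma dR_eps U (f : locconst_psh R M U) : dR C 0 U (eps U f) = 0.
Proof.
apply: (sheaf_sep (Omega_sheaf 1)) => x Ux.
have [V [h [r [Vx Vf]]]] := locconst_near f Ux.
exists V, h; split=> //; rewrite -phom_res (eps_funP h Vf) linearZ /= dR_unit0.
by rewrite scaler0 linear0.
Qed.

Lemma closed0_near U (s : Omega C 0 U) x : dR C 0 U s = 0 -> U x ->
  exists V (h : V `<=` U) r, V x /\ res (Omega C 0) h s = r *: unit0 V.
Proof.
move=> ds Ux; have [c [V [hU [h [y [Vx st]]]]]] := local_chart Ux.
have [|r E] := @closed0_constant _ _ _ _ C c V h y st (res (Omega C 0) hU s).
  by rewrite phom_res ds linear0.
by exists V, hU, r.
Qed.

Lemma exact0 : exact_at eps (dR C 0).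
Proof.
move=> U s; split=> [ds x Ux|H].
  have [V [h [r [Vx E]]]] := closed0_near ds Ux.
  by exists V, h, (locconst_cst V r); split=> //; rewrite eps_cst E.
apply: (sheaf_sep (Omega_sheaf 1)) => x /H [V [h [t [Vx E]]]].
by exists V, h; split=> //; rewrite -phom_res -E dR_eps linear0.
Qed.

Lemma exactS k : exact_at (dR C k) (dR C k.+1).
Proof.
move=> U s; split=> [ds x Ux|H]; first exact: dR_locally_exact.
apply: (sheaf_sep (Omega_sheaf _)) => x /H [V [h [t [Vx E]]]].
by exists V, h; split=> //; rewrite -phom_res -E dR_dR linear0.
Qed.

Lemma dR_resolution : resolution C.
Proof.
exists eps; split; [exact: eps_augmentation | exact: eps_injective | exact: exact0 |
  exact: exactS].
Qed.

Lemma closed_sheaf k : is_sheaf (closed_forms C k).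
Proof.
have [sep glue] := Omega_sheaf k; split.
  move=> U I V hV s t cov st; apply: val_inj; apply: (sep U I V hV _ _ cov) => i.
  exact: (congr1 val (st i)).
move=> U I V hV s cov comp.
have [|t ht] := glue U I V hV (fun i => val (s i)) cov.
  by move=> i j W hi hj; exact: (congr1 val (comp i j W hi hj)).
have kt : t \in @kernel_pred _ _ _ _ (dR C k) U.
  apply/asboolP; apply: (sheaf_sep (Omega_sheaf _)) => x /cov [i Vx].
  exists (V i), (hV i); split=> //; rewrite -phom_res ht linear0.
  exact: asboolP (valP (s i)).
exists (exist (fun t => t \in @kernel_pred _ _ _ _ (dR C k) U) t kt) => i.
by apply: val_inj; exact: ht.
Qed.

Lemma closed_formP k U (s : closed_forms C k U) : dR C k U (val s) = 0.
Proof. exact: asboolP (valP s). Qed.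

(** A closed 0-form is a multiple of [unit0] near each point, and f records the factor found there.
    It is locally constant, and independent of the neighbourhoods chosen, since two factors agree on
    a nonempty overlap by [unit0_inj]. *)
Lemma eps_onto U (s : closed_forms C 0 U) : {f : locconst_psh R M U | eps U f = val s}.
Proof.
apply: cid; have ds := closed_formP s.
have N (i : points U) : {Vr : {V : opens M | V `<=` U} * R | sval Vr.1 (sval i) /\
    res (Omega C 0) (svalP Vr.1) (val s) = Vr.2 *: unit0 (sval Vr.1)}.
  apply: cid; have [V [h [r [Vx E]]]] := closed0_near ds (svalP i).
  exists (exist (fun V : opens M => V `<=` U) V h, r); split; first exact: Vx.
  exact: (etrans (@res_irr _ _ _ U V _ h _) E).
pose f (i : points U) := (sval (N i)).2.
have fE V (h : V `<=` U) r : res (Omega C 0) h (val s) = r *: unit0 V ->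
  constant_on f V r.
  move=> E i Vi; have [Wi Ei] := svalP (N i); rewrite /f.
  set W := sval (sval (N i)).1 in Wi Ei *; set hW : W `<=` U :=
    svalP (sval (N i)).1 in Ei.
  have Hx : cap_open V W (sval i) by [].
  apply: (unit0_inj Hx).
  rewrite -(unit0_res (@cap_openl _ V W)) -[RHS]linearZ -E.
  rewrite (res_comp _ _ (subset_trans (@cap_openr _ V W) hW)).
  rewrite -(res_comp hW (@cap_openr _ V W)) Ei linearZ /= !unit0_res.
  by [].
have lf : f \in @locconst_pred R M U.
  apply/asboolP => i; have [V [h [r [Vx E]]]] := closed0_near ds (svalP i).
  by exists V; split=> // y Vy; rewrite (fE V h r E i Vx) (fE V h r E y Vy).
exists (exist (fun g => g \in @locconst_pred R M U) f lf).
apply: (sheaf_sep (Omega_sheaf 0)) => x Ux.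
have [V [h [r [Vx E]]]] := closed0_near ds Ux.
exists V, h; split=> //; rewrite E; apply: eps_funP; exact: fE E.
Qed.

Definition const_of U (s : closed_forms C 0 U) : locconst_psh R M U := sval (eps_onto s).

Lemma const_ofK U (s : closed_forms C 0 U) : eps U (const_of s) = val s.
Proof. exact: (svalP (eps_onto s)). Qed.

Lemma const_of_linear U : linear (@const_of U).
Proof.
by move=> a s t; apply: eps_injective; rewrite linearP !const_ofK.
Qed.

HB.instance Definition _ U :=
  GRing.isLinear.Build R (closed_forms C 0 U) (locconst_psh R M U) *:%R (@const_of U)
    (@const_of_linear U).

Lemma const_of_res U V (h : V `<=` U) (s : closed_forms C 0 U) :
  const_of (res (closed_forms C 0) h s) = res (locconst_psh R M) h (const_of s).
Proof. by apply: eps_injective; rewrite phom_res !const_ofK. Qed.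

Definition const_hom : psh_hom (closed_forms C 0) (locconst_psh R M) :=
  PshHom const_of_res.

Lemma eps_closed U (f : locconst_psh R M U) : eps U f \in @kernel_pred _ _ _ _ (dR C 0) U.
Proof. by apply/asboolP; exact: dR_eps. Qed.

Definition closed_of U (f : locconst_psh R M U) : closed_forms C 0 U :=
  exist (fun t => t \in @kernel_pred _ _ _ _ (dR C 0) U) (eps U f) (eps_closed f).

Lemma closed_of_linear U : linear (@closed_of U).
Proof. by move=> a f g; apply: val_inj; exact: linearP. Qed.

HB.instance Definition _ U :=
  GRing.isLinear.Build R (locconst_psh R M U) (closed_forms C 0 U) *:%R (@closed_of U)
    (@closed_of_linear U).

Lemma closed_of_res U V (h : V `<=` U) (f : locconst_psh R M U) :
  closed_of (res (locconst_psh R M) h f) = res (closed_forms C 0) h (closed_of f).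
Proof. by apply: val_inj; exact: phom_res. Qed.

Definition closed_hom : psh_hom (locconst_psh R M) (closed_forms C 0) :=
  PshHom closed_of_res.

Lemma psh_id_res (F : presheaf R M) U V (h : V `<=` U) (s : F U) :
  (idfun : {linear F V -> F V}) (res F h s) = res F h ((idfun : {linear F U -> F U}) s).
Proof. by []. Qed.

Definition psh_id (F : presheaf R M) : psh_hom F F :=
  @PshHom R M F F (fun U => idfun) (@psh_id_res F).

(** In degree 0 only the zero form counts as exact, so the sheaf of closed forms, with the identity
    as class map, is already the quotient. *)
Lemma cohomology0 : cohomology_iso C 0 (locconst_psh R M).
Proof.
exists (closed_forms C 0), (psh_id (closed_forms C 0)); split; first split.
- exact: closed_sheaf.
- by move=> U w w0; apply: val_inj.
- move=> G f _ _; split; first by exists f.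
  by move=> g g' gg' U s; exact: gg'.
exists const_hom, closed_hom; split=> U s.
  by apply: val_inj; exact: const_ofK.
by apply: eps_injective; exact: const_ofK.
Qed.

Lemma zero_sheaf : is_sheaf (zero_psh R M).
Proof.
by split=> [U I V hV s t _ _|U I V hV s _ _]; [rewrite [s]thinmx0 [t]thinmx0 |
  exists 0 => i; rewrite [LHS]thinmx0 [RHS]thinmx0].
Qed.

Lemma psh_zero_res (F G : presheaf R M) U V (h : V `<=` U) (s : F U) :
  (\0 : {linear F V -> G V}) (res F h s) = res G h ((\0 : {linear F U -> G U}) s).
Proof. by rewrite /= linear0. Qed.

Definition psh_zero (F G : presheaf R M) : psh_hom F G :=
  @PshHom R M F G (fun U => \0) (@psh_zero_res F G).

(** A morphism to a sheaf that kills exact forms kills closed ones as well, since these are locally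
    exact and the target is separated. *)
Lemma cohomologyS k : cohomology_iso C k.+1 (zero_psh R M).
Proof.
exists (zero_psh R M), (psh_zero (closed_forms C k.+1) (zero_psh R M)); split;
  first split.
- exact: zero_sheaf.
- by [].
- move=> G f shG f0.
  have fz U w : f U w = 0.
    apply: (sheaf_sep shG) => x Ux.
    have [V [h [eta [Vx E]]]] := dR_locally_exact (closed_formP w) Ux.
    exists V, h; split=> //; rewrite -phom_res linear0; apply: f0.
    by exists eta.
  split; first by exists (psh_zero (zero_psh R M) G) => U w; rewrite fz.
  by move=> g g' _ U s; rewrite [s]thinmx0 !linear0.
by exists (psh_id _), (psh_id _).
Qed.

End DeRham.

Theorem theorem3p9 (R : realType) (p q : nat) (M : supermanifold R p q)
    (C : de_rham_complex M) :
  (forall k : nat,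
     cohomology_iso C k
       (match k with 0%N => locconst_psh R M | _.+1 => zero_psh R M end)) /\
  resolution C /\
  closed_locally_exact C.
Proof.
split; last by split; [exact: dR_resolution | exact: dR_locally_exact].
by case=> [|k]; [exact: cohomology0 | exact: cohomologyS].
Qed.
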